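(* Let $n\ge 1$ and let $\lambda=(\lambda_1\ge\cdots\ge\lambda_n\ge 0)$ be a partition with $n$ parts (zero parts allowed). Then: (i) the images in the symplectic Schur module $E^{\lambda,f}$ of the symplectic tableaux of shape $\lambda$ form a basis of $E^{\lambda,f}$; (ii) the $G_n$-module $E^{\lambda,f}$ is isomorphic to the irreducible representation $V_\lambda$ of $G_n=\mathrm{Sp}_{2n}\mathbb C$ with highest weight $\lambda$; (iii) the vanishing ideal $I$ of the flag variety of $G_n$ is generated by quadratic polynomials (polynomials of degree at most two) corresponding to the alternating, exchange, and symplectic relations, namely by the polynomials $x_\rho\in R$ where $\rho$ ranges over the alternating, exchange and symplectic relations on tableaux (of shapes given by partitions with $n$ parts) having at most two columns.
   Context: Let $E=\mathbb C^{2n}$ with basis $e_1,\ldots,e_n,e_{\bar 1},\ldots,e_{\bar n}$, indexed by the set $[n]'=\{1,\ldots,n,\bar 1,\ldots,\bar n\}$. Let $f$ be the nondegenerate skew form on $E$ with $f(e_i,e_j)=f(e_{\bar i},e_{\bar j})=0$ and $f(e_i,e_{\bar j})=\delta_{ij}=-f(e_{\bar j},e_i)$; $G_n=\mathrm{Sp}_{2n}\mathbb C$ is its isometry group (equivalently the stabilizer in $GL(E)$ of $\sum_i(e_i\otimes e_{\bar i}-e_{\bar i}\otimes e_i)$). Tableaux: for a partition $\lambda$ with $n$ parts and $r=|\lambda|$, draw its Young diagram in English convention (row $i$ has $\lambda_i$ left-justified boxes, rows top to bottom). A tableau of shape $\lambda$ with entries in $[n]'$ is a filling of the boxes by elements of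 $[n]'$; fixing an enumeration $b_1,\ldots,b_r$ of the boxes, a tableau $T$ is identified with the decomposable tensor $e_{T(b_1)}\otimes\cdots\otimes e_{T(b_r)}\in\bigotimes^rE$ (entry $a$ corresponds to $e_a$). Alternating relations: $T+T'=0$ where $T'$ is obtained from $T$ by interchanging two entries in one column. Exchange relations: $T=\sum_w T_w$, where for two fixed columns, the second strictly to the right of the first, and $k$ at most the length of the right column, the sum runs over all tableaux $T_w$ obtained from $T$ by interchanging the top $k$ entries of the right column with any $k$ entries of the left column, preserving the vertical order of the chosen entries. The Schur module $E^\lambda$ is the quotient of $\bigotimes^rE$ by the span of all alternating and exchange relations. Symplectic relations: given a tableau $T$ of shape $\lambda$ and two distinct boxes $B,B'$, let $F$ be the partial filling obtained by erasing the entries of $B,B'$; set $S_F=\sum_{i=1}^n(F_i-F_i')$, where $F_i$ (resp. $F_i'$) is obtained from $F$ by putting $i$ in $B$ and $\bar i$ in $B'$ (resp. $\bar i$ in $B$ and $i$ in $B'$). The symplectic Schur module $E^{\lambda,f}$ is the quotient of $E^\lambda$ by the span of the images of all $S_F$; $G_n$ acts on it. Order $[n]'$ by $1<\bar 1<2<\bar 2<\cdots<n<\bar n$. A tableau is semistandard if its entries weakly increase along each row (left to right) and strictly increase down each column. It is symplectic if it is semistandard and every entry in its $i$th row is $\ge i$ in this order (the symplectic condition). Weights: the diagonal torus of $G_n$ consists of the matrices acting by $x_i$ on $e_i$ and $x_i^{-1}$ on $e_{\bar i}$; the weight $(b_1,\ldots,b_n)$ is the character $\prod x_i^{b_i}$.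 Highest weights are taken with respect to the Borel subgroup stabilizing the isotropic flag $\langle e_1\rangle\subset\langle e_1,e_2\rangle\subset\cdots\subset\langle e_1,\ldots,e_n\rangle$. Flag variety and polynomials: let $R=\mathbb C[x_{(a_1,\ldots,a_k)}: 1\le k\le n,\ a_j\in[n]']$. For a tableau $T$ whose columns, read top to bottom, are $(a_1,\ldots,a_k),\ldots$, let $x_T$ be the product over the columns of the variables $x_{(a_1,\ldots,a_k)}$; a relation $\rho=\sum_j c_jT_j$ corresponds to $x_\rho=\sum_jc_jx_{T_j}\in R$. For a $2n\times n$ matrix $M$ with rows indexed by $[n]'$ (in the order $1,\ldots,n,\bar1,\ldots,\bar n$) and columns $v_1,\ldots,v_n$, evaluate $x_{(a_1,\ldots,a_k)}(M)=\det(M_{a_p,q})_{1\le p,q\le k}$. The flag variety of $G_n$ is the set of flags $E_1\subset\cdots\subset E_n$ in $E$ with $\dim E_k=k$ and $E_n$ isotropic for $f$; its vanishing ideal is $I=\{p\in R: p(M)=0$ for every $M$ whose columns are linearly independent and span an $f$-isotropic subspace$\}$ (the multihomogeneous ideal of the image of the flag variety in $\prod_k\mathbb P(\wedge^kE)$ under the Plücker embeddings). *)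

(* Defs.v *)
From HB Require Import structures.
From mathcomp Require Import all_boot all_order all_algebra.
From mathcomp Require Import mpoly.
From mathcomp Require Import complex reals.
Set Implicit Arguments. Unset Strict Implicit. Unset Printing Implicit Defensive.
Import Order.TTheory GRing.Theory Num.Theory.
Local Open Scope ring_scope.

(* Conventions.  Index set [n]' is encoded as 'I_n * bool:
   (i, false) stands for the (i+1)-st unbarred index, (i, true) for its bar. *)

Section Symplectic.
Variable C : fieldType.
Variable n : nat.

Definition lab := ('I_n * bool)%type.

Definition ltL (a b : lab) : bool :=
  (a.1 < b.1)%N || ((a.1 == b.1) && ~~ a.2 && b.2).
Definition leL (a b : lab) : bool := (a == b) || ltL a b.

Definition formB (a b : lab) : C :=
  if a.1 == b.1 then
    (if ~~ a.2 && b.2 then 1 else if a.2 && ~~ b.2 then -1 else 0)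
  else 0.

(* g : lab -> lab -> C is the matrix of a linear endomorphism of E:
   g c a = coefficient of e_c in g(e_a).  G_n = isometry group of f. *)
Definition isSp (g : lab -> lab -> C) : Prop :=
  forall a b, \sum_(c : lab) \sum_(d : lab) g c a * g d b * formB c d = formB a b.

(* Borel subgroup: elements of G_n stabilizing the isotropic flag
   <e_1> c <e_1,e_2> c ... c <e_1,...,e_n> *)
Definition inBorel (g : lab -> lab -> C) : Prop :=
  isSp g /\ forall (j : 'I_n) (c : lab), g c (j, false) != 0 -> c.2 = false /\ (c.1 <= j)%N.

Section Shape.
Variable lam : 'I_n -> nat.

Definition is_partition : Prop := forall i j : 'I_n, (i <= j)%N -> (lam j <= lam i)%N.

Definition bnd : nat := (\sum_(i < n) lam i).+1.

Definition box := {p : ('I_n * 'I_bnd)%type | (p.2 < lam p.1)%N}.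
Definition tab := {ffun box -> lab}.
(* bigotimes^r E, with basis the fillings (tableaux) of shape lam *)
Definition tens := {ffun tab -> C}.

Definition tvec (T : tab) : tens := [ffun S => (S == T)%:R].

Definition scl (c : C) (v : tens) : tens := [ffun S => c * v S].

Definition brow (b : box) : nat := (val b).1.
Definition bcol (b : box) : nat := (val b).2.

Definition obox (i j : nat) : option box :=
  match (insub i : option 'I_n), (insub j : option 'I_bnd) with
  | Some i', Some j' => insub (i', j')
  | _, _ => None
  end.

Definition tget (T : tab) (d : lab) (i j : nat) : lab :=
  if obox i j is Some b then T b else d.

Definition col_len (j : nat) : nat := #|[set i : 'I_n | (j < lam i)%N]|.

Definition swapT (T : tab) (b1 b2 : box) : tab :=
  [ffun b => if b == b1 then T b2 else if b == b2 then T b1 else T b].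

Definition alt_rel (v : tens) : Prop :=
  exists (T : tab) (b1 b2 : box),
    b1 != b2 /\ bcol b1 = bcol b2 /\ v = tvec T + tvec (swapT T b1 b2).

Definition rk (S : {set 'I_n}) (i : nat) : nat := #|[set s in S | (s < i)%N]|.
Definition nthS (S : {set 'I_n}) (t : nat) : nat :=
  nth 0%N (sort leq [seq val s | s <- enum S]) t.

(* the tableau obtained by interchanging the top k entries of column c2 with
   the entries of column c1 in the rows S (vertical order preserved) *)
Definition exchT (T : tab) (c1 c2 k : nat) (S : {set 'I_n}) : tab :=
  [ffun b => if bcol b == c1 then
               (if (val b).1 \in S then tget T (T b) (rk S (brow b)) c2 else T b)
             else if bcol b == c2 then
               (if (brow b < k)%N then tget T (T b) (nthS S (brow b)) c1 else T b)
             else T b].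

Definition exch_rel (v : tens) : Prop :=
  exists (T : tab) (c1 c2 k : nat),
    (c1 < c2)%N /\ (k <= col_len c2)%N /\
    v = tvec T - \sum_(S : {set 'I_n} | (S \subset [set i : 'I_n | (c1 < lam i)%N])
                                         && (#|S| == k))
                   tvec (exchT T c1 c2 k S).

Definition upd2 (T : tab) (B : box) (x : lab) (B' : box) (y : lab) : tab :=
  [ffun b => if b == B then x else if b == B' then y else T b].

Definition symp_rel (v : tens) : Prop :=
  exists (T : tab) (B B' : box),
    B != B' /\
    v = \sum_(i < n) (tvec (upd2 T B (i, false) B' (i, true))
                      - tvec (upd2 T B (i, true) B' (i, false))).

Definition rel (v : tens) : Prop := alt_rel v \/ exch_rel v \/ symp_rel v.

(* membership in the span W of all relations; E^{lam,f} = tens / W *)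
Definition inW (v : tens) : Prop :=
  exists s : seq (C * tens),
    (forall x, x \in s -> rel x.2) /\ v = \sum_(x <- s) scl x.1 x.2.

Definition symplecticT (T : tab) : bool :=
  [forall b1 : box, forall b2 : box,
     ((brow b1 == brow b2) && (bcol b1 < bcol b2)%N ==> leL (T b1) (T b2)) &&
     ((bcol b1 == bcol b2) && (brow b1 < brow b2)%N ==> ltL (T b1) (T b2))]
  && [forall b : box, (brow b <= (T b).1)%N].

(* action of g on bigotimes^r E (g^{otimes r}) *)
Definition act (g : lab -> lab -> C) (v : tens) : tens :=
  [ffun S : tab => \sum_(T : tab) (\prod_(b : box) g (S b) (T b)) * v T].

Definition subspaceP (U : tens -> Prop) : Prop :=
  U 0 /\ (forall u v, U u -> U v -> U (u + v)) /\ (forall (c : C) u, U u -> U (scl c u)).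

Definition chi (g : lab -> lab -> C) : C := \prod_(i < n) (g (i, false) (i, false)) ^+ lam i.

Definition var := {k : 'I_n & (k.+1).-tuple lab}.
Definition NV : nat := #|{: var}|.
Definition polR := {mpoly C[NV]}.

Definition mkvar (s : seq lab) : option var :=
  if (insub (size s).-1 : option 'I_n) is Some k then
    (if (insub s : option ((k.+1).-tuple lab)) is Some t then
       Some (Tagged (fun k : 'I_n => (k.+1).-tuple lab) (t : (k.+1).-tuple lab))
     else None)
  else None.

Definition Xs (s : seq lab) : polR :=
  if mkvar s is Some v then 'X_(enum_rank v) else 0.

Definition colseq (T : tab) (j : nat) : seq lab :=
  pmap (fun i => if obox i j is Some b then Some (T b) else None) (iota 0 (col_len j)).

Definition xT (T : tab) : polR :=
  \prod_(j < bnd | (0 < col_len j)%N) Xs (colseq T j).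

Definition xlin (v : tens) : polR := \sum_(T : tab) v T *: xT T.

End Shape.

Definition detv (M : lab -> 'I_n -> C) (v : var) : C :=
  \det (\matrix_(p < (tag v).+1, q < (tag v).+1)
          M (tnth (tagged v) p) (widen_ord (ltn_ord (tag v)) q)).

Definition evalM (M : lab -> 'I_n -> C) : 'I_NV -> C := fun i => detv M (enum_val i).

Definition admissible (M : lab -> 'I_n -> C) : Prop :=
  (forall c : 'I_n -> C, (forall a, \sum_(q < n) c q * M a q = 0) -> forall q, c q = 0) /\
  (forall q q' : 'I_n, \sum_(a : lab) \sum_(b : lab) M a q * M b q' * formB a b = 0).

Definition inI (p : polR) : Prop := forall M, admissible M -> p.@[evalM M] = 0.

Definition gen (g : polR) : Prop :=
  exists lam : 'I_n -> nat,
    is_partition lam /\ (forall i, (lam i <= 2)%N) /\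
    exists v : tens lam, rel v /\ g = xlin v.

Definition in_ideal (G : polR -> Prop) (p : polR) : Prop :=
  exists s : seq (polR * polR),
    (forall x, x \in s -> G x.2) /\ p = \sum_(x <- s) x.1 * x.2.

End Symplectic.

(* Main.v *)
(* Tableaux are evaluated on isotropic frames: a frame v_1, ..., v_n sends a column of
   length k to the minor of its rows in v_1, ..., v_k. This kills all relations, and
   everything follows from the fact that the kernel of evaluation is exactly the span W
   of the relations.

   Spanning.  Give T the potential sum_b (col b + 1) N^(ord T(b)) with N large. An exchange
   at a row descent only produces larger tableaux. If a column of T has too many entries of
   index < m, let P (resp. F) be the set of indices i < m such that both (resp. none) of i and
   its bar occur in it; then |F| < |P|. Modulo larger tableaux, the symplectic relation says
   that letting the index of one of the |P| pairs run over P is minus letting it run over F.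
   Hence a positive multiple of T is, up to sign, a sum over maps from P to F; none of these
   is injective, so all terms have a repeated entry.

   Independence.  Scaling the i-th hyperbolic plane by a large power of t degenerates
   isotropic frames to matrices whose entry in row a and column q vanishes for a < q and is
   otherwise free. Along a suitable curve of frames over C[t], the minors of symplectic
   tableaux have their lowest term on the diagonal, and these terms have distinct exponents.

   Irreducibility.  If U contains W strictly, some g in Sp moves a vector of U to one with a
   nonzero coordinate on the highest weight tableau T0, and a torus projects it to T0. A
   functional vanishing on U then vanishes on the orbit of T0, i.e. as a tensor it evaluates
   to 0 on all frames, so it lies in W; W being stable under complex conjugation, the
   functional is orthogonal to itself.

   Ideal.  A relation involves at most two columns, so every monomial straightens, modulo the
   two-column relations, to symplectic ones, which are independent as functions of frames. *)
Require Import Defs.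
From HB Require Import structures.
From mathcomp Require Import all_boot all_order all_algebra.
From mathcomp Require Import mpoly.
From mathcomp Require Import complex reals.
From mathcomp Require Import fingroup perm zify ring.
From Stdlib Require Import Classical_Prop.
Set Implicit Arguments. Unset Strict Implicit. Unset Printing Implicit Defensive.
Import Order.TTheory GRing.Theory Num.Theory.
Local Open Scope ring_scope.

(** All three statements use the points of one explicit curve of frames with polynomial entries. Its
    exponents behave like digits in a large base, so independence becomes a comparison of lowest
    exponents and no limit or density argument is needed. A frame with blocks A over B is isotropic
    exactly when A^T B is symmetric; after scaling the columns, A is taken unitriangular and the
    symmetric product is prescribed, which determines B. An element of the vanishing ideal is not
    assumed multihomogeneous. The weights must therefore separate tableaux of different shapes as
    well, and a single curve has to serve every shape at once. Exchanges are treated as involutions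
    of the set of boxes that do not depend on the filling. This makes them commute with the group
    action and with multilinear expansion, so the exchange identity for minors need only be checked
    on rows that are standard basis vectors. *)

(** Composing with the transposition of a moved point [x] and its preimage fixes [x], and that
    transposition stays within one class of [c]. A constant [c] yields all permutations, [bcol] the
    column-preserving ones. *)
Lemma colperm_ind (T : finType) (A : eqType) (c : T -> A) (P : {perm T} -> Prop) :
  P 1%g ->
  (forall x y (s : {perm T}), x != y -> c x = c y -> (forall b, c (s b) = c b) ->
     P s -> P (tperm x y * s)%g) ->
  forall s : {perm T}, (forall b, c (s b) = c b) -> P s.
Proof.
move=> P1 PS s.
have [m] := ubnP #|[pred b | s b != b]|.
elim: m s => // m IHm s le_m cs.
case: (pickP [pred b | s b != b]) => [x /= sx | s_id]; last first.
  suff -> : s = 1%g by [].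
  by apply/permP => b; rewrite perm1; apply/eqP; have /negbFE := s_id b.
pose y := (s^-1)%g x.
have sy : s y = x by rewrite /y permKV.
have nxy : x != y by apply: contraNneq sx => exy; rewrite {1}exy sy.
have cxy : c x = c y by rewrite -[in RHS](cs y) sy.
pose s' := (tperm x y * s)%g.
have cs' b : c (s' b) = c b.
  by rewrite permM cs; case: tpermP => // ->.
have -> : s = (tperm x y * s')%g by rewrite mulgA tperm2 mul1g.
apply: PS => //; apply: IHm => //.
apply: leq_trans (_ : #|[pred b | s b != b]| <= m)%N; last by [].
apply: proper_card; apply/properP; split.
  apply/subsetP => b; rewrite !inE permM; case: tpermP => [-> | -> |//].
    by rewrite sy eqxx.
  by move=> _; rewrite sy.
by exists x; rewrite !inE // permM tpermL sy eqxx.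
Qed.

(** Straightening produces tableaux of larger potential, so the induction descends from the maximum
    of [mu]. *)
Lemma finmax_ind (T : finType) (mu : T -> nat) (Q : T -> Prop) :
  (forall t, (forall t', (mu t < mu t')%N -> Q t') -> Q t) -> forall t, Q t.
Proof.
move=> H t.
have [m] := ubnP ((\max_t' mu t') - mu t)%N.
elim: m t => // m IHm t lt_m.
apply: H => t' lt_t; apply: IHm.
have le_t' : (mu t' <= \max_t'' mu t'')%N by apply: leq_bigmax.
lia.
Qed.

(** * Tensors and the span of the relations *)

Section Tensors.
Variables (C : fieldType) (n : nat) (lam : 'I_n -> nat).
Local Notation tens := (tens C lam).
Local Notation tab := (tab lam).
Local Notation box := (box lam).
Local Notation tvec := (@tvec C n lam).
Implicit Types (T : tab) (v : tens) (P : tens -> Prop).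

Lemma scl_lincomb (s : seq (C * tens)) c :
  scl c (\sum_(x <- s) scl x.1 x.2) = \sum_(x <- s) scl (c * x.1) x.2.
Proof.
elim: s => [|x s IHs].
  by rewrite !big_nil; apply/ffunP => T; rewrite !ffunE mulr0.
rewrite !big_cons -IHs; apply/ffunP => T.
by rewrite !ffunE mulrDr mulrA.
Qed.

Lemma scl1 v : scl 1 v = v.
Proof. by apply/ffunP => T; rewrite !ffunE mul1r. Qed.

Lemma scl0 v : scl 0 v = 0.
Proof. by apply/ffunP => T; rewrite !ffunE mul0r. Qed.

Lemma sclA a b v : scl a (scl b v) = scl (a * b) v.
Proof. by apply/ffunP => T; rewrite !ffunE mulrA. Qed.

Lemma sclDl a b v : scl (a + b) v = scl a v + scl b v.
Proof. by apply/ffunP => T; rewrite !ffunE mulrDl. Qed.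

Lemma sclDr a u v : scl a (u + v) = scl a u + scl a v.
Proof. by apply/ffunP => T; rewrite !ffunE mulrDr. Qed.

Lemma sclN a v : scl (- a) v = - scl a v.
Proof. by apply/ffunP => T; rewrite !ffunE mulNr. Qed.

Lemma sclNr a v : scl a (- v) = - scl a v.
Proof. by apply/ffunP => T; rewrite !ffunE mulrN. Qed.

Lemma scl_sumr a (I : Type) (r : seq I) (Q : pred I) (F : I -> tens) :
  scl a (\sum_(i <- r | Q i) F i) = \sum_(i <- r | Q i) scl a (F i).
Proof.
elim/big_rec2: _ => [|i y1 y2 _ <-]; last by rewrite sclDr.
by apply/ffunP => T; rewrite !ffunE mulr0.
Qed.

Lemma scl_suml v (I : Type) (r : seq I) (Q : pred I) (F : I -> C) :
  scl (\sum_(i <- r | Q i) F i) v = \sum_(i <- r | Q i) scl (F i) v.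
Proof. by elim/big_rec2: _ => [|i y1 y2 _ <-]; rewrite ?scl0 ?sclDl. Qed.

Lemma tens_sum_tvec v : v = \sum_T scl (v T) (tvec T).
Proof.
apply/ffunP => S; rewrite sum_ffunE (bigD1 S) //= !ffunE eqxx mulr1 big1 ?addr0 //.
by move=> T nTS; rewrite !ffunE eq_sym (negPf nTS) mulr0.
Qed.

Lemma inW_sub : subspaceP (@inW C n lam).
Proof.
split; first by exists [::]; rewrite big_nil.
split=> [u v [s [Hs ->]] [t [Ht ->]] | c u [s [Hs ->]]].
  exists (s ++ t); split; last by rewrite big_cat.
  by move=> x; rewrite mem_cat => /orP [] Hx; [apply: Hs | apply: Ht].
exists [seq (c * x.1, x.2) | x <- s]; split.
  by move=> x /mapP [y ys ->] /=; apply: Hs.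
by rewrite big_map /= scl_lincomb.
Qed.

Lemma inW_rel v : Defs.rel v -> inW v.
Proof.
move=> rv; exists [:: (1, v)]; split; last by rewrite big_seq1 scl1.
by move=> x; rewrite inE => /eqP ->.
Qed.

Section Subspace.
Variable P : tens -> Prop.
Hypothesis Psub : subspaceP P.

Lemma sub0 : P 0. Proof. by case: Psub. Qed.
Lemma subD u v : P u -> P v -> P (u + v). Proof. by case: Psub => _ [H _]; apply: H. Qed.
Lemma subZ c v : P v -> P (scl c v). Proof. by case: Psub => _ [_ H]; apply: H. Qed.
Lemma subN v : P v -> P (- v).
Proof. by move/(subZ (-1)); rewrite sclN scl1. Qed.
Lemma subB u v : P u -> P v -> P (u - v).
Proof. by move=> Pu Pv; apply: subD => //; apply: subN. Qed.
Lemma sub_sum (I : eqType) (r : seq I) (Q : pred I) (F : I -> tens) :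
  (forall i, i \in r -> Q i -> P (F i)) -> P (\sum_(i <- r | Q i) F i).
Proof.
move=> H; rewrite big_seq_cond.
by elim/big_rec: _ => [|i x /andP [ir Qi] Px]; [apply: sub0 | apply: subD => //; apply: H].
Qed.
Lemma sub_sumT (I : finType) (Q : pred I) (F : I -> tens) :
  (forall i, Q i -> P (F i)) -> P (\sum_(i | Q i) F i).
Proof. by move=> H; apply: sub_sum => i _; apply: H. Qed.
Lemma subZI c v : c != 0 -> P (scl c v) -> P v.
Proof. by move=> c0 /(subZ c^-1); rewrite sclA mulVf // scl1. Qed.
Lemma subDr u v : P u -> P (v + u) -> P v.
Proof. by move=> Pu Pvu; rewrite -(addrK u v); apply: subB. Qed.
Lemma sub_tvec v : (forall T, P (tvec T)) -> P v.
Proof. by move=> H; rewrite (tens_sum_tvec v); apply: sub_sumT => T _; apply: subZ. Qed.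
End Subspace.

Lemma inW_min P : subspaceP P -> (forall v, Defs.rel v -> P v) -> forall v, inW v -> P v.
Proof.
move=> Psub Prel v [s [Hs ->]].
by apply: (sub_sum Psub) => x xs _; apply: (subZ Psub); apply/Prel/Hs.
Qed.

Lemma box_eq (b b' : box) : brow b = brow b' -> bcol b = bcol b' -> b = b'.
Proof.
move=> e1 e2; apply/val_inj; move: e1 e2; rewrite /brow /bcol.
by case: (val b) => i j; case: (val b') => i' j' /= /val_inj -> /val_inj ->.
Qed.

Lemma brow_lt (b : box) : (brow b < n)%N. Proof. exact: ltn_ord. Qed.

Lemma bcol_lam (b : box) : (bcol b < lam (val b).1)%N. Proof. exact: valP b. Qed.

Lemma lam_bnd i : (lam i < bnd lam)%N.
Proof. by rewrite /bnd ltnS (bigD1 i) //= leq_addr. Qed.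

Lemma obox_brow_bcol (b : box) : obox lam (brow b) (bcol b) = Some b.
Proof.
rewrite /obox /brow /bcol !valK.
have -> : ((val b).1, (val b).2) = val b by case: (val b).
by rewrite valK.
Qed.

Lemma obox_some i j b : obox lam i j = Some b -> brow b = i /\ bcol b = j.
Proof.
rewrite /obox; case: insubP => // i' _ ei; case: insubP => // j' _ ej.
by case: insubP => // b' _ eb [<-]; rewrite /brow /bcol eb.
Qed.

Hypothesis plam : is_partition lam.

(** As the parts decrease, the rows reaching column [j] form an initial segment, which turns the
    cardinality [col_len] into a length. *)
Lemma col_lenP (i : 'I_n) j : (j < lam i)%N = (i < col_len lam j)%N.
Proof.
rewrite /col_len; set A := [set _ | _].
have mA (k k' : 'I_n) : (k' <= k)%N -> k \in A -> k' \in A.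
  by rewrite !inE => le_k /leq_trans; apply; apply: plam.
have -> : (j < lam i)%N = (i \in A) by rewrite inE.
have card_lt m : (m <= n)%N -> #|[set k : 'I_n | (k < m)%N]| = m.
  move=> le_m; rewrite -sum1_card (eq_bigl (fun k : 'I_n => (k < m)%N)).
    by rewrite (big_ord_narrow le_m) big_const_ord iter_addn addn0 mul1n.
  by move=> k; rewrite inE.
apply/idP/idP => [iA | ].
  rewrite -(card_lt i.+1) ?ltn_ord //; apply/subset_leq_card/subsetP => k.
  by rewrite inE ltnS => le_k; apply: mA iA.
apply: contraTT => niA; rewrite -leqNgt -[leqRHS](card_lt i (ltnW (ltn_ord i))).
apply/subset_leq_card/subsetP => k kA; rewrite inE ltnNge.
by apply: contra niA => le_i; apply: mA kA.
Qed.

Lemma col_len_le j : (col_len lam j <= n)%N.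
Proof. by rewrite -[leqRHS]card_ord; apply: max_card. Qed.

Lemma brow_col (b : box) : (brow b < col_len lam (bcol b))%N.
Proof. by rewrite /brow -col_lenP; apply: bcol_lam. Qed.

Lemma oboxE i j : (i < col_len lam j)%N ->
  exists2 b, obox lam i j = Some b & brow b = i /\ bcol b = j.
Proof.
move=> lt_i; have lt_n := leq_trans lt_i (col_len_le j).
have lt_j : (j < lam (Ordinal lt_n))%N by rewrite col_lenP.
have lt_jb := ltn_trans lt_j (lam_bnd _).
pose b : box := Sub (Ordinal lt_n, Ordinal lt_jb) lt_j.
by exists b => //; rewrite -(obox_brow_bcol b).
Qed.

Lemma box_exists i j : (i < col_len lam j)%N -> exists b : box, brow b = i /\ bcol b = j.
Proof. by case/oboxE => b _ ?; exists b. Qed.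

Lemma col_len_anti j j' : (j <= j')%N -> (col_len lam j' <= col_len lam j)%N.
Proof.
move=> le_j; apply/subset_leq_card/subsetP => i; rewrite !inE; exact: leq_ltn_trans.
Qed.

End Tensors.

(** * Exchanges as place permutations *)

Section Labels.
Variable n : nat.
Implicit Types a b : lab n.

Definition ordL a : nat := (a.1.*2 + a.2)%N.

Lemma ordL_inj : injective ordL.
Proof.
move=> [i x] [j y] /eqP; rewrite /ordL /= => /eqP e.
have [exy eij] : x = y /\ (i = j :> nat) by case: x e; case: y => /= e; split=> //; lia.
by rewrite exy (val_inj eij).
Qed.

Lemma ltL_ord a b : ltL a b = (ordL a < ordL b)%N.
Proof.
case: a b => [i x] [j y]; rewrite /ltL /ordL /=.
have -> : (i == j) = (nat_of_ord i == nat_of_ord j) by [].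
by case: x; case: y => /=; apply/idP/idP; lia.
Qed.

Lemma leL_ord a b : leL a b = (ordL a <= ordL b)%N.
Proof. by rewrite /leL ltL_ord [in RHS]leq_eqVlt (inj_eq ordL_inj). Qed.

Lemma ordL_ge a : (a.1.*2 <= ordL a)%N. Proof. exact: leq_addr. Qed.
Lemma ordL_lt a : (ordL a < a.1.+1.*2)%N. Proof. by rewrite /ordL; case: a.2 => /=; lia. Qed.

End Labels.

Section Exchange.
Variables (n : nat) (lam : 'I_n -> nat).
Hypothesis plam : is_partition lam.
Local Notation box := (box lam).

Definition pcomp (X : Type) (V : {ffun box -> X}) (p : box -> box) : {ffun box -> X} :=
  [ffun b => V (p b)].

Lemma swapT_comp (T : tab lam) b1 b2 : swapT T b1 b2 = pcomp T (tperm b1 b2).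
Proof.
by apply/ffunP => b; rewrite !ffunE; case: tpermP => [->|->|/eqP/negPf-> /eqP/negPf->];
  rewrite ?eqxx //; case: eqP => // ->.
Qed.

(* Interchanges the box in row [i] of column [c2] with the box in row [nth 0 hs i] of column [c1]. *)
Definition xmap (c1 c2 : nat) (hs : seq nat) (b : box) : box :=
  if bcol b == c1 then
    (if brow b \in hs then odflt b (obox lam (index (brow b) hs) c2) else b)
  else if bcol b == c2 then
    (if (brow b < size hs)%N then odflt b (obox lam (nth 0%N hs (brow b)) c1) else b)
  else b.

Definition xmap_ok c1 c2 hs :=
  [/\ c1 != c2, uniq hs, all (fun i => i < col_len lam c1)%N hs & (size hs <= col_len lam c2)%N].

Section Xmap.
Variables (c1 c2 : nat) (hs : seq nat).
Hypothesis ok : xmap_ok c1 c2 hs.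

Lemma xmap_l b : bcol b = c1 -> brow b \in hs ->
  bcol (xmap c1 c2 hs b) = c2 /\ brow (xmap c1 c2 hs b) = index (brow b) hs.
Proof.
move=> eb hb; rewrite /xmap eb eqxx hb.
have lt_i : (index (brow b) hs < col_len lam c2)%N.
  by case: ok => _ _ _; apply: leq_trans; rewrite index_mem.
by have [b' -> [-> ->]] := oboxE plam lt_i.
Qed.

Lemma xmap_r b : bcol b = c2 -> (brow b < size hs)%N ->
  bcol (xmap c1 c2 hs b) = c1 /\ brow (xmap c1 c2 hs b) = nth 0%N hs (brow b).
Proof.
move=> eb hb; rewrite /xmap eb eqxx hb; case: ok => + _ + _.
rewrite eq_sym => /negPf -> /allP hs_lt.
by have [b' -> [-> ->]] := @oboxE _ lam plam (nth 0%N hs (brow b)) c1 (hs_lt _ (mem_nth _ hb)).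
Qed.

Lemma xmap_id b :
  ~~ ((bcol b == c1) && (brow b \in hs)) -> ~~ ((bcol b == c2) && (brow b < size hs)%N) ->
  xmap c1 c2 hs b = b.
Proof.
rewrite /xmap; case: eqP => //= _; first by move=> /negPf ->.
by case: eqP => //= _ _ /negPf ->.
Qed.

Lemma xmapK : involutive (xmap c1 c2 hs).
Proof.
move=> b; have [_ uhs _ _] := ok.
have [/andP [/eqP eb hb]|nl] := boolP ((bcol b == c1) && (brow b \in hs)).
  have [e1 e2] := xmap_l eb hb.
  have hb' : (brow (xmap c1 c2 hs b) < size hs)%N by rewrite e2 index_mem.
  by have [e3 e4] := xmap_r e1 hb'; apply: box_eq; rewrite ?e3 ?e4 ?e2 ?nth_index.
have [/andP [/eqP eb hb]|nr] := boolP ((bcol b == c2) && (brow b < size hs)%N).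
  have [e1 e2] := xmap_r eb hb.
  have hb' : brow (xmap c1 c2 hs b) \in hs by rewrite e2 mem_nth.
  by have [e3 e4] := xmap_l e1 hb'; apply: box_eq; rewrite ?e3 ?e4 ?e2 ?index_uniq.
by rewrite !xmap_id.
Qed.

End Xmap.

Definition seqS (S : {set 'I_n}) : seq nat := sort leq [seq val s | s <- enum S].

Lemma mem_seqS (S : {set 'I_n}) (i : 'I_n) : (val i \in seqS S) = (i \in S).
Proof. by rewrite mem_sort mem_map ?mem_enum //; apply: val_inj. Qed.

Lemma seqSP (S : {set 'I_n}) (k : nat) : k \in seqS S -> exists2 i : 'I_n, i \in S & k = val i.
Proof. by rewrite mem_sort => H; case: (elimT mapP H) => i; rewrite mem_enum => ? ->; exists i. Qed.

Lemma seqS_uniq (S : {set 'I_n}) : uniq (seqS S).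
Proof. by rewrite sort_uniq map_inj_uniq ?enum_uniq //; apply: val_inj. Qed.

Lemma size_seqS (S : {set 'I_n}) : size (seqS S) = #|S|.
Proof. by rewrite size_sort size_map cardE. Qed.

Lemma index_sorted (s : seq nat) i : sorted ltn s -> i \in s ->
  index i s = count (fun x => x < i)%N s.
Proof.
elim: s => //= x s IHs ps; rewrite inE eq_sym.
have xs : all (ltn x) s by apply: order_path_min ps => ? ? ?; apply: ltn_trans.
case: eqP => [<- _|_ /= si]; last first.
  by have /= -> := allP xs _ si; rewrite add1n IHs // (path_sorted ps).
rewrite ltnn add0n; symmetry; apply/eqP; rewrite -leqn0 leqNgt -has_count.
by apply/hasPn => y /(allP xs) /= ?; rewrite -leqNgt ltnW.
Qed.

Lemma rk_index (S : {set 'I_n}) (i : 'I_n) : i \in S -> rk S i = index (val i) (seqS S).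
Proof.
move=> iS; rewrite index_sorted ?mem_seqS //; last first.
  by rewrite ltn_sorted_uniq_leq seqS_uniq sort_sorted //; apply: leq_total.
rewrite /seqS (seq.permP (permEl (perm_sort _ _))) count_map /rk cardE -size_filter.
apply: perm_size; apply: uniq_perm.
- exact: enum_uniq.
- by apply: filter_uniq; exact: enum_uniq.
by move=> j; rewrite mem_enum mem_filter mem_enum !inE andbC.
Qed.

Lemma exch_ok c1 c2 (S : {set 'I_n}) k : (c1 < c2)%N -> (k <= col_len lam c2)%N ->
  S \subset [set i : 'I_n | (c1 < lam i)%N] -> #|S| = k -> xmap_ok c1 c2 (seqS S).
Proof.
move=> lt_c le_k /subsetP sS cS; split; rewrite ?seqS_uniq ?size_seqS ?cS //.
  by rewrite neq_ltn lt_c.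
by apply/allP => x /seqSP [i /sS]; rewrite inE col_lenP // => ? ->.
Qed.

(** The place permutation on the right depends on [S] but not on [T]. For a strictly increasing list
    the rank of an element is its index, which links [rk] to [xmap]. *)
Lemma exchT_comp (T : tab lam) c1 c2 (S : {set 'I_n}) k :
  #|S| = k -> exchT T c1 c2 k S = pcomp T (xmap c1 c2 (seqS S)).
Proof.
move=> cS; apply/ffunP => b; rewrite !ffunE /xmap /tget size_seqS cS.
have -> : brow b = val (val b).1 by [].
rewrite mem_seqS; case: ifP => _.
  by case: ifP => // bS; rewrite rk_index //; case: obox.
by case: ifP => // _; case: ifP => // _; rewrite /nthS -/(seqS S); case: obox.
Qed.

End Exchange.

(** * Straightening *)

Section Straightening.
Variables (C : numFieldType) (n : nat) (lam : 'I_n -> nat).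
Hypothesis plam : is_partition lam.
Local Notation box := (box lam).
Local Notation tvec := (@tvec C n lam).
Implicit Types T : tab lam.

Lemma W_alt T (b1 b2 : box) : b1 != b2 -> bcol b1 = bcol b2 ->
  inW (tvec T + tvec (swapT T b1 b2)).
Proof. by move=> nb eb; apply: inW_rel; left; exists T, b1, b2. Qed.

(** Alternation puts twice the tableau into the span, and 2 is invertible. *)
Lemma W_rep T (b1 b2 : box) : b1 != b2 -> bcol b1 = bcol b2 -> T b1 = T b2 -> inW (tvec T).
Proof.
move=> nb eb eT; have := W_alt T nb eb.
have -> : swapT T b1 b2 = T.
  by apply/ffunP => b; rewrite ffunE; case: eqP => [->//|_]; case: eqP => [->|].
have -> : tvec T + tvec T = scl 2 (tvec T) by rewrite (sclDl 1 1) scl1.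
by apply: (subZI (inW_sub _ _)); rewrite pnatr_eq0.
Qed.

Definition Phi T : nat := \sum_(b : box) (bcol b).+1 * n.+2 ^ ordL (T b).
(** A swap inside a column leaves [Phi] unchanged; [Psi] grows when the larger entry moves down. *)
Definition Psi T : nat := \sum_(b : box) brow b * ordL (T b).
(* lexicographic combination of [Phi] and [Psi] *)
Definition mu T : nat := Phi T * (\sum_(b : box) n * n.*2).+1 + Psi T.

Lemma Psi_le T : (Psi T <= \sum_(b : box) n * n.*2)%N.
Proof.
apply: leq_sum => b _; apply: leq_mul; first by rewrite ltnW ?brow_lt.
by apply: leq_trans (ltnW (ordL_lt _)) _; rewrite leq_double.
Qed.

Lemma mu_Phi T T' : (Phi T < Phi T')%N -> (mu T < mu T')%N.
Proof.
move=> lt_Phi; rewrite /mu; have := Psi_le T; set L := (\sum_(b : box) _)%N => le_L.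
have : ((Phi T).+1 * L.+1 <= Phi T' * L.+1)%N by rewrite leq_mul2r lt_Phi orbT.
by rewrite mulSn; lia.
Qed.

Lemma mu_Psi T T' : Phi T = Phi T' -> (Psi T < Psi T')%N -> (mu T < mu T')%N.
Proof. by rewrite /mu => ->; rewrite ltn_add2l. Qed.

Lemma card_col_le (Q : pred box) c : (forall b, Q b -> bcol b = c) -> (#|Q| <= n)%N.
Proof.
move=> Qc; rewrite -[leqRHS]card_ord.
have inj : {in Q &, injective (fun b : box => (val b).1)}.
  by move=> b b' /Qc e /Qc e' eb; apply: box_eq; rewrite ?e ?e' // /brow eb.
by rewrite -(card_in_image inj) max_card.
Qed.

(** A column has at most [n] boxes and the base exceeds [n], so a single entry of higher order
    outweighs any set of smaller entries of one column. *)
Lemma sum_pow_lt (Q : pred box) c o (x : box -> nat) :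
  (forall b, Q b -> bcol b = c /\ (x b <= o)%N) ->
  (\sum_(b | Q b) n.+2 ^ x b < n.+2 ^ o.+1)%N.
Proof.
move=> Qc; apply: leq_ltn_trans (_ : n * n.+2 ^ o < _)%N; last first.
  by rewrite expnS ltn_mul2r expn_gt0 /=; lia.
apply: leq_trans (_ : \sum_(b | Q b) n.+2 ^ o <= _)%N.
  by apply: leq_sum => b /Qc [_ le_o]; rewrite leq_exp2l.
by rewrite sum_nat_const leq_mul2r; apply/orP; right; apply: (@card_col_le _ c) => b /Qc [].
Qed.

Variables (P : tens C lam -> Prop) (T : tab lam).
Hypothesis Psub : subspaceP P.
Hypothesis PW : forall v, inW v -> P v.
Hypothesis IH : forall T', (mu T < mu T')%N -> P (tvec T').

Lemma straighten_swap (b1 b2 : box) : bcol b1 = bcol b2 -> (brow b1 < brow b2)%N ->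
  ~~ ltL (T b1) (T b2) -> P (tvec T).
Proof.
move=> eb lt_b; have nb : b1 != b2 by apply: contraTneq lt_b => ->; rewrite ltnn.
rewrite ltL_ord -leqNgt leq_eqVlt => /orP [/eqP eT | lt_T].
  by apply/PW/(W_rep nb eb); apply/esym/ordL_inj.
apply: (subDr Psub _ (PW (W_alt T nb eb))); apply: IH; apply: mu_Psi.
  rewrite /Phi (reindex_inj (@perm_inj _ (tperm b1 b2))); apply: eq_bigr => b _.
  by rewrite swapT_comp ffunE; case: tpermP => // ->; rewrite eb.
rewrite /Psi swapT_comp !(bigD1 b2 (isT : xpredT b2)) !(bigD1 b1 nb) /= !ffunE tpermL tpermR.
rewrite !addnA; set s1 := (X in (_ + X < _)%N); set s2 := (X in (_ < _ + X)%N).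
have -> : s1 = s2.
  by apply: eq_bigr => b /andP [nb2 nb1]; rewrite ffunE tpermD // eq_sym.
rewrite ltn_add2r; nia.
Qed.

Lemma Phi_exch (c1 c2 : nat) (hs : seq nat) (b0 b1 : box) : xmap_ok lam c1 c2 hs -> (c1 < c2)%N ->
  bcol b1 = c1 -> brow b1 \in hs -> (ordL (T b0) < ordL (T b1))%N ->
  (forall b, bcol b = c2 -> (brow b < size hs)%N -> ordL (T b) <= ordL (T b0))%N ->
  (Phi T < Phi (pcomp T (xmap c1 c2 hs)))%N.
Proof.
move=> ok lt_c eb1 hb1 lt_b max_b0; set p := xmap c1 c2 hs.
have pK : involutive p := xmapK plam ok.
have -> : Phi (pcomp T p) = (\sum_b (bcol (p b)).+1 * n.+2 ^ ordL (T b))%N.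
  rewrite /Phi (reindex_inj (inv_inj pK)); apply: eq_bigr => b _.
  by rewrite ffunE pK.
pose X (b : box) := (n.+2 ^ ordL (T b))%N.
pose Lf (b : box) := (bcol b == c1) && (brow b \in hs).
pose Rt (b : box) := (bcol b == c2) && (brow b < size hs)%N.
(* The change of [Phi] is [c2 - c1] times the difference between the powers leaving the left column
   and those leaving the right one; it is written without subtraction of the sums. *)
have e : (\sum_b (bcol (p b)).+1 * X b + (c2 - c1) * \sum_(b | Rt b) X b =
          Phi T + (c2 - c1) * \sum_(b | Lf b) X b)%N.
  rewrite /Phi !big_distrr /= [X in (_ + X)%N]big_mkcond [X in (_ = _ + X)%N]big_mkcond /=.
  rewrite -!big_split /=; apply: eq_bigr => b _; rewrite -/(X b).
  case: ifP => [Rb | Rb]; case: ifP => [Lb | Lb].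
  - case/andP: Lb => /eqP eb _; case/andP: Rb => /eqP eb' _.
    by move: lt_c; rewrite -eb -eb' ltnn.
  - case/andP: Rb => /eqP eb hb; have [-> _] := xmap_r plam ok eb hb.
    by rewrite eb addn0 -mulnDl; congr (_ * _)%N; lia.
  - case/andP: Lb => /eqP eb hb; have [-> _] := xmap_l plam ok eb hb.
    by rewrite eb addn0 -mulnDl; congr (_ * _)%N; lia.
  - by rewrite /p xmap_id // -/(Lf b) -/(Rt b) ?Lb ?Rb.
have lt_RL : (\sum_(b | Rt b) X b < \sum_(b | Lf b) X b)%N.
  apply: leq_trans (_ : n.+2 ^ (ordL (T b0)).+1 <= _)%N.
    by apply: (@sum_pow_lt _ c2) => b /andP [/eqP eb hb]; split=> //; apply: max_b0.
  apply: leq_trans (_ : X b1 <= _)%N; first by rewrite leq_exp2l.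
  by rewrite (bigD1 b1) /= ?leq_addr // /Lf eb1 eqxx.
have : ((c2 - c1) * \sum_(b | Rt b) X b < (c2 - c1) * \sum_(b | Lf b) X b)%N.
  by rewrite ltn_pmul2l // subn_gt0.
by rewrite -(ltn_add2l (Phi T)) -e ltn_add2r.
Qed.

Hypothesis Tcol : forall b1 b2 : box, bcol b1 = bcol b2 -> (brow b1 < brow b2)%N ->
  ltL (T b1) (T b2).

Lemma Tcol_le (b1 b2 : box) : bcol b1 = bcol b2 -> (brow b1 <= brow b2)%N ->
  (ordL (T b1) <= ordL (T b2))%N.
Proof.
move=> eb; rewrite leq_eqVlt => /orP [/eqP er | /(Tcol eb)]; last by rewrite ltL_ord => /ltnW.
by rewrite (box_eq er eb).
Qed.

Lemma straighten_exch (b1 b2 : box) : brow b1 = brow b2 -> (bcol b1 < bcol b2)%N ->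
  ~~ leL (T b1) (T b2) -> P (tvec T).
Proof.
move=> er lt_c; rewrite leL_ord -ltnNge => lt_T.
set c1 := bcol b1; set c2 := bcol b2; set k := (brow b1).+1.
have le_k : (k <= col_len lam c2)%N by rewrite /k er brow_col.
have r : inW (tvec T - \sum_(S : {set 'I_n} | (S \subset [set i : 'I_n | (c1 < lam i)%N])
                                         && (#|S| == k)) tvec (exchT T c1 c2 k S)).
  by apply: inW_rel; right; left; exists T, c1, c2, k.
apply: (subDr Psub _ (PW r)); apply: (subN Psub); apply: (sub_sumT Psub) => S /andP [sS /eqP cS].
apply: IH; apply: mu_Phi; rewrite exchT_comp //.
have ok := exch_ok plam lt_c le_k sS cS.
(* [S] has one more element than there are rows above [b1], so it reaches the row of [b1] or below.
   The entry found there is at least [T b1], hence larger than every entry coming from the right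
   column. *)
have [i iS le_i] : exists2 i : 'I_n, i \in S & (brow b1 <= i)%N.
  case: (pickP [pred i : 'I_n | (i \in S) && (brow b1 <= i)%N]) => [i /andP [] | no]; first by exists i.
  have /subset_leq_card : S \subset [set i : 'I_n | (i < brow b1)%N].
    by apply/subsetP => i iS; rewrite inE ltnNge; have := no i; rewrite /= iS /= => ->.
  rewrite cS -sum1_card (eq_bigl (fun k : 'I_n => (k < brow b1)%N)); last by move=> j; rewrite inE.
  rewrite (big_ord_narrow (ltnW (brow_lt b1))) big_const_ord iter_addn addn0 mul1n.
  by rewrite ltnn.
have /box_exists [//|b [rb cb]] : (i < col_len lam c1)%N.
  by rewrite -col_lenP //; have := subsetP sS _ iS; rewrite inE.
apply: (Phi_exch (b0 := b2) (b1 := b) ok lt_c cb).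
- by rewrite rb mem_seqS.
- by apply: leq_trans lt_T _; apply: Tcol_le; rewrite ?cb ?rb.
move=> b' eb'; rewrite size_seqS cS ltnS => le_b'.
by apply: Tcol_le; rewrite // -er.
Qed.

End Straightening.

Lemma sum_ord_lt n m : (m <= n)%N -> (\sum_(i < n | i < m) 1 = m)%N.
Proof. by move=> le_m; rewrite (big_ord_narrow le_m) big_const_ord iter_addn addn0 mul1n. Qed.

(** * Straightening a violation of the symplectic condition *)

Section SymplecticStep.
Variables (C : numFieldType) (n : nat) (lam : 'I_n -> nat).
Hypothesis plam : is_partition lam.
Local Notation box := (box lam).
Local Notation tvec := (@tvec C n lam).
Variables (P : tens C lam -> Prop) (T : tab lam).
Hypothesis Psub : subspaceP P.
Hypothesis PW : forall v, inW v -> P v.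
Hypothesis IH : forall T', (mu T < mu T')%N -> P (tvec T').
Hypothesis Tcol : forall b1 b2 : box, bcol b1 = bcol b2 -> (brow b1 < brow b2)%N ->
  ltL (T b1) (T b2).

Lemma Tcol_inj (b1 b2 : box) : bcol b1 = bcol b2 -> T b1 = T b2 -> b1 = b2.
Proof.
move=> ec eT; have [lt_b | lt_b | er] := ltngtP (brow b1) (brow b2).
- by have := Tcol ec lt_b; rewrite eT ltL_ord ltnn.
- by have := Tcol (esym ec) lt_b; rewrite eT ltL_ord ltnn.
exact: box_eq.
Qed.

Variable B0 : box.
Hypothesis B0_lt : ((T B0).1 < brow B0)%N.
Let j := bcol B0.
Let m := brow B0.

Let app (i : 'I_n) (x : bool) : bool := [exists b : box, (bcol b == j) && (T b == (i, x))].
Let Pr : {set 'I_n} := [set i : 'I_n | [&& (i < m)%N, app i false & app i true]].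
Let Fr : {set 'I_n} := [set i : 'I_n | [&& (i < m)%N, ~~ app i false & ~~ app i true]].

Lemma appP i x : reflect (exists2 b : box, bcol b = j & T b = (i, x)) (app i x).
Proof.
apply: (iffP existsP) => [[b /andP [/eqP cb /eqP Tb]] | [b cb Tb]]; exists b => //.
by rewrite cb Tb !eqxx.
Qed.

Lemma Pr_app i x : i \in Pr -> exists2 b : box, bcol b = j & T b = (i, x).
Proof. by rewrite inE => /and3P [_ a0 a1]; apply/appP; case: x. Qed.

(** The rows from 0 to [m] of the column hold [m + 1] distinct labels, all of index below [m].
    Counting the [m] indices by how many of their two labels occur, the paired ones must outnumber
    the free ones. *)
Lemma free_lt_paired : (#|Fr| < #|Pr|)%N.
Proof.
have lt_mn : (m < n)%N := brow_lt B0.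
pose A := [set a : lab n | (a.1 < m)%N && app a.1 a.2].
have leA : (m.+1 <= #|A|)%N.
  have ob (r : 'I_m.+1) : exists2 b : box, obox lam r j = Some b & brow b = r /\ bcol b = j.
    by apply: (oboxE plam); apply: leq_ltn_trans (brow_col plam B0); rewrite -ltnS.
  pose f (r : 'I_m.+1) : lab n := T (odflt B0 (obox lam r j)).
  have f_inj : injective f.
    move=> r r'; rewrite /f; have [b -> [rb cb]] := ob r; have [b' -> [rb' cb']] := ob r'.
    move=> /= /Tcol_inj; rewrite cb cb' => /(_ erefl) ebb'.
    by apply: val_inj => /=; rewrite -rb -rb' ebb'.
  rewrite -[X in (X <= _)%N]card_ord -(card_imset _ f_inj); apply: subset_leq_card.
  apply/subsetP => _ /imsetP [r _ ->]; rewrite inE /f; have [b /= -> [rb cb]] := ob r.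
  apply/andP; split; last by apply/appP; exists b => //; case: (T _).
  have le_b : (ordL (T b) <= ordL (T B0))%N.
    by apply: Tcol_le; rewrite // rb -ltnS.
  have := leq_ltn_trans (leq_trans (ordL_ge (T b)) le_b) (ordL_lt (T B0)).
  by rewrite ltn_double ltnS => /leq_ltn_trans; apply.
have eA : #|A| = (\sum_(i < n | i < m) (app i false + app i true))%N.
  rewrite -sum1_card (eq_bigl (fun a : lab n => (a.1 < m)%N && app a.1 a.2)); last first.
    by move=> a; rewrite inE.
  transitivity (\sum_(i < n | i < m) \sum_(x : bool) if app i x then 1 else 0)%N.
    by rewrite big_mkcondr pair_big /=; apply: eq_bigl => a; rewrite andbT.
  by apply: eq_bigr => i _; rewrite big_bool addnC; case: (app i false); case: (app i true).
have e : (#|A| + #|Fr| = m + #|Pr|)%N.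
  rewrite eA -[in RHS](sum_ord_lt (ltnW lt_mn)) -!sum1_card.
  rewrite (big_mkcond (fun i => i \in Fr)) (big_mkcond (fun i => i \in Pr)) (big_mkcond (fun i : 'I_n => (i < m)%N)).
  rewrite [in RHS](big_mkcond (fun i : 'I_n => (i < m)%N)) /= -!big_split /=.
  by apply: eq_bigr => i _; rewrite !inE; case: ifP => //=; case: (app i false); case: (app i true).
by lia.
Qed.

(** Bars are kept, so the two entries of a pair always move together. *)
Let relab (h : 'I_n -> 'I_n) : tab lam :=
  [ffun b => if bcol b == j then (h (T b).1, (T b).2) else T b].
Let updh (h : {ffun 'I_n -> 'I_n}) (i x : 'I_n) : {ffun 'I_n -> 'I_n} :=
  [ffun k => if k == i then x else h k].
Local Notation XR h := (tvec (relab h)).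

Lemma relab_rep (h : 'I_n -> 'I_n) i i' x :
  i \in Pr -> i' != i -> app i' x -> h i = h i' -> inW (XR h).
Proof.
move=> iP ni /appP [b' cb' Tb'] eh; have [b cb Tb] := Pr_app x iP.
apply: (@W_rep C n lam _ b b'); rewrite ?cb ?cb' //.
  by apply: contraNneq ni => eb; rewrite eb Tb' in Tb; case: Tb => ->.
by rewrite !ffunE cb cb' eqxx Tb Tb' /= eh.
Qed.

(** This is the symplectic relation on the two boxes of the pair [i]. Its negative terms are swaps
    of the positive ones within the column, so modulo alternation it is twice the sum. *)
Lemma relab_sum h i : i \in Pr -> inW (\sum_x XR (updh h i x)).
Proof.
move=> iP; have [bf cf Tf] := Pr_app false iP; have [bt ct Tt] := Pr_app true iP.
have nb : bf != bt by apply/eqP => eb; rewrite eb Tt in Tf.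
have ebi b y : bcol b = j -> T b = (i, y) -> b = if y then bt else bf.
  by move=> cb Tb; apply: Tcol_inj; case: y Tb => Tb; rewrite ?Tb ?Tt ?Tf ?ct ?cf ?cb.
have r : inW (\sum_(x < n) (tvec (upd2 (relab h) bf (x, false) bt (x, true))
                      - tvec (upd2 (relab h) bf (x, true) bt (x, false)))).
  by apply: inW_rel; right; right; exists (relab h), bf, bt.
have s : inW (\sum_(x < n) (XR (updh h i x) + tvec (swapT (relab (updh h i x)) bf bt))).
  by apply: (sub_sumT (inW_sub _ _)) => x _; apply: W_alt; rewrite // cf ct.
have := subD (inW_sub _ _) r s; rewrite -big_split /=.
set v := \sum_(x < n) _ ; suff -> : v = scl 2 (\sum_x XR (updh h i x)).
  by apply: (subZI (inW_sub _ _)); rewrite pnatr_eq0.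
rewrite scl_sumr; apply: eq_bigr => x _.
have -> : upd2 (relab h) bf (x, false) bt (x, true) = relab (updh h i x).
  apply/ffunP => b; rewrite !ffunE; case: eqP => [->|nbf].
    by rewrite cf eqxx Tf /= eqxx.
  case: eqP => [->|nbt]; first by rewrite ct eqxx Tt /= eqxx.
  case: eqP => // cb; case: eqP => // ei.
  have := @ebi b (T b).2 cb; rewrite -ei -surjective_pairing => /(_ erefl).
  by case: ifP.
have -> : upd2 (relab h) bf (x, true) bt (x, false) = swapT (relab (updh h i x)) bf bt.
  apply/ffunP => b; rewrite !ffunE; case: eqP => [_|nbf].
    by rewrite ct eqxx Tt /= eqxx.
  case: eqP => [_|nbt]; first by rewrite cf eqxx Tf /= eqxx.
  case: eqP => // cb; case: eqP => // ei.
  have := @ebi b (T b).2 cb; rewrite -ei -surjective_pairing => /(_ erefl).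
  by case: ifP.
by rewrite addrACA addNr addr0 (sclDl 1 1) scl1.
Qed.

(** The paired entries of [T] all lie below position [2m] in the order, so one of them raised to
    index at least [m] outweighs them together, whatever happens to the others. *)
Lemma relab_big (h : 'I_n -> 'I_n) i : (forall k, k \notin Pr -> h k = k) ->
  i \in Pr -> (m <= h i)%N -> P (XR h).
Proof.
move=> hid iP le_m; apply: IH; apply: mu_Phi.
have [bf cf Tf] := Pr_app false iP.
pose Q (b : box) := (bcol b == j) && ((T b).1 \in Pr).
rewrite /Phi (bigID Q) /= [X in (_ < X)%N](bigID Q) /=.
rewrite [X in (_ < _ + X)%N](eq_bigr (fun b : box => (bcol b).+1 * n.+2 ^ ordL (T b))%N); last first.
  move=> b; rewrite /Q negb_and ffunE; case: eqP => //= _ /hid ->.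
  by case: (T b).
rewrite ltn_add2r.
rewrite (eq_bigr (fun b => j.+1 * n.+2 ^ ordL (T b)))%N; last by move=> b /andP [/eqP ->].
rewrite [X in (_ < X)%N](eq_bigr (fun b => j.+1 * n.+2 ^ ordL (relab h b)))%N; last first.
  by move=> b /andP [/eqP ->].
rewrite -!big_distrr ltn_pmul2l //=.
have i_lt : (i < m)%N by move: iP; rewrite inE => /and3P [].
apply: leq_trans (_ : n.+2 ^ (m.*2.-1.+1) <= _)%N.
  apply: (@sum_pow_lt _ _ _ j) => b /andP [/eqP -> bP]; split=> //.
  have : ((T b).1 < m)%N by move: bP; rewrite inE => /and3P [].
  by have := ordL_lt (T b); lia.
rewrite (bigD1 bf) /=; last by rewrite /Q cf eqxx Tf.
apply: leq_trans (leq_addr _ _); rewrite leq_exp2l // ffunE cf eqxx Tf.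
by apply: leq_trans (ordL_ge _); rewrite /= prednK ?leq_double // double_gt0; lia.
Qed.

(** [D] is the set of slots already sent to free indices. The sums [Y D] interpolate between
    self-maps of [Pr], for empty [D], and maps from [Pr] to [Fr], for [D = Pr]. *)
Let inH (D : {set 'I_n}) (h : {ffun 'I_n -> 'I_n}) : bool :=
  [forall k, if k \in Pr then h k \in (if k \in D then Fr else Pr) else h k == k].
Let Y D := \sum_(h | inH D h) XR h.

(** The maps are grouped by what they do away from slot [i]; the representative of a group carries
    the placeholder value [i] in that slot. *)
Lemma sum_updh (G E : pred {ffun 'I_n -> 'I_n}) (A : {set 'I_n}) i :
  (forall g, G g = (g i \in A) && E (updh g i i)) -> (forall h, E h -> h i = i) ->
  \sum_(g | G g) XR g = \sum_(h | E h) \sum_(x in A) XR (updh h i x).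
Proof.
move=> HG HE; rewrite (partition_big (fun g => updh g i i) E) /=; last first.
  by move=> g; rewrite HG => /andP [].
apply: eq_bigr => h Eh.
rewrite (reindex_onto (updh h i) (fun g => g i)) /=; last first.
  move=> g /andP [_ /eqP <-]; apply/ffunP => k; rewrite !ffunE.
  by case: eqP => // ->.
apply: eq_bigl => x; rewrite HG.
have -> : updh (updh h i x) i i = h.
  by apply/ffunP => k; rewrite !ffunE; case: eqP => // ->; rewrite HE.
by rewrite !ffunE !eqxx Eh !andbT.
Qed.

(* modulo larger tableaux, letting slot [i] run over [Pr] is minus letting it run over [Fr] *)
Lemma Y_step (D : {set 'I_n}) i : i \in Pr -> i \notin D -> P (Y D + Y (i |: D)).
Proof.
move=> iP iD.
pose E (h : {ffun 'I_n -> 'I_n}) :=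
  (h i == i) && [forall k, (k == i) ||
     (if k \in Pr then h k \in (if k \in D then Fr else Pr) else h k == k)].
have HE h : E h -> h i = i by case/andP => /eqP.
have G1 g : inH D g = (g i \in Pr) && E (updh g i i).
  rewrite /E ffunE eqxx eqxx /=; apply/forallP/andP => [H | [gi /forallP H] k].
    split; first by have := H i; rewrite iP (negPf iD).
    apply/forallP => k; have := H k; rewrite ffunE.
    by have [-> | nk] := eqVneq k i.
  have := H k; rewrite ffunE.
  by have [-> | nk] := eqVneq k i; first by rewrite iP (negPf iD).
have G2 g : inH (i |: D) g = (g i \in Fr) && E (updh g i i).
  rewrite /E ffunE eqxx eqxx /=; apply/forallP/andP => [H | [gi /forallP H] k].
    split; first by have := H i; rewrite iP in_setU1 eqxx.
    apply/forallP => k; have := H k; rewrite ffunE in_setU1.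
    by have [-> | nk] := eqVneq k i.
  have := H k; rewrite ffunE in_setU1.
  by have [-> | nk] := eqVneq k i; first by rewrite iP.
rewrite /Y (sum_updh G1 HE) (sum_updh G2 HE) -big_split /=.
apply: (sub_sumT Psub) => h Eh.
have hid k : k \notin Pr -> h k = k.
  move=> kP; case/andP: Eh => _ /forallP /(_ k); rewrite (negPf kP).
  by case: eqP => [ek|_ /eqP //]; rewrite ek iP in kP.
(* An index outside [Pr] and [Fr] is either at least [m], which gives a larger tableau, or has
   exactly one of its labels in the column, which gives a repeated entry. *)
have -> : \sum_(x in Pr) XR (updh h i x) + \sum_(x in Fr) XR (updh h i x) =
   \sum_x XR (updh h i x) - \sum_(x | (x \notin Pr) && (x \notin Fr)) XR (updh h i x).
  rewrite [\sum_x _](bigID (fun x => x \in Pr)) /= [X in _ = _ + X - _](bigID (fun x => x \in Fr)) /=.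
  rewrite addrA addrK; congr (_ + _); apply: eq_bigl => x.
  rewrite !inE; move: (x < m)%N (app x false) (app x true).
  by case; case; case.
apply: (subB Psub); first by apply/PW/relab_sum.
apply: (sub_sumT Psub) => x /andP [xP xF].
have nxi : x != i by apply: contraNneq xP => ->.
have [le_mx | lt_xm] := leqP m x.
  apply: (@relab_big _ i) => // [k kP|]; rewrite ffunE ?eqxx //.
  by case: eqP => [ek|_]; [rewrite -ek (negPf kP) in iP | apply: hid].
have [y ay] : exists y, app x y.
  move: xF; rewrite inE lt_xm /= negb_and !negbK => /orP [] ?; first by exists false.
  by exists true.
by apply/PW/(relab_rep iP nxi ay); rewrite !ffunE eqxx (negPf nxi) hid.
Qed.

Lemma Y_full : P (Y Pr).
Proof.
apply: (sub_sumT Psub) => h /forallP Hh; apply: PW.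
have [/dinjectiveP inj | ] := boolP (dinjectiveb h (mem Pr)).
  have : (#|Pr| <= #|Fr|)%N.
    rewrite -(card_in_imset inj); apply: subset_leq_card.
    by apply/subsetP => _ /imsetP [i iP ->]; have := Hh i; rewrite iP.
  by rewrite leqNgt free_lt_paired.
case/dinjectivePn => i iP [i']; rewrite !inE => /andP [ni i'P] eh.
by apply: (@relab_rep _ i i' false) => //; case/and3P: i'P.
Qed.

Lemma Y_all (D : {set 'I_n}) : D \subset Pr -> P (Y D).
Proof.
have [k] := ubnP #|Pr :\: D|; elim: k D => // k IHk D lt_k sD.
have [/eqP e0 | [i iPD] ] := set_0Vmem (Pr :\: D).
  rewrite setD_eq0 in e0; suff -> : D = Pr by apply: Y_full.
  by apply/eqP; rewrite eqEsubset sD e0.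
move: iPD; rewrite in_setD => /andP [iD iP].
apply: (subDr Psub _ (Y_step iP iD)); apply: IHk; last by rewrite subUset sub1set iP sD.
apply: leq_trans (_ : #|Pr :\: D| <= k)%N; last by [].
apply: proper_card; apply/properP; split; first by apply/setDS/subsetUr.
by exists i; rewrite !in_setD ?in_setU1 ?eqxx ?iD ?iP.
Qed.

(** Transposing two paired indices swaps two unbarred and two barred entries, so the two signs
    cancel. All permutations of the pairs thus contribute with the same sign. *)
Lemma relab_perm (s : {perm 'I_n}) : (forall i, i \notin Pr -> s i = i) ->
  inW (XR s - tvec T).
Proof.
(* [c] merges [Pr] into one class and isolates every other index, so the permutations preserving it
   are those that fix the complement of [Pr]. *)
move=> sid; pose c (i : 'I_n) := if i \in Pr then None else Some i.
have c_inv i k : c i = c k -> i != k -> (i \in Pr) && (k \in Pr).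
  rewrite /c; case: ifP; case: ifP => // _ _ [->]; by rewrite eqxx.
have cs i : c (s i) = c i.
  have [iP | iP] := boolP (i \in Pr); last by rewrite sid.
  have [-> // | ni] := eqVneq (s i) i.
  rewrite /c iP; case: ifP => // /negbT /sid /perm_inj e; by rewrite e eqxx in ni.
move: s cs {sid}; apply: (@colperm_ind _ _ c) => [|x y s nxy /c_inv /(_ nxy) /andP [xP yP] _ IHs].
  suff -> : relab (1%g : {perm 'I_n}) = T by rewrite subrr; apply: (sub0 (inW_sub _ _)).
  by apply/ffunP => b; rewrite ffunE perm1; case: ifP => //; case: (T b).
have [xf cxf Txf] := Pr_app false xP; have [xt cxt Txt] := Pr_app true xP.
have [yf cyf Tyf] := Pr_app false yP; have [yt cyt Tyt] := Pr_app true yP.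
have nb b b' : T b != T b' -> b != b' by apply: contraNneq => ->.
have nf : xf != yf by apply: nb; rewrite Txf Tyf xpair_eqE (negPf nxy).
have nt : xt != yt by apply: nb; rewrite Txt Tyt xpair_eqE (negPf nxy).
have key b : bcol b = j ->
    bcol (tperm xf yf (tperm xt yt b)) = j /\
    T (tperm xf yf (tperm xt yt b)) = (tperm x y (T b).1, (T b).2).
  move=> cb; have [->|nxt] := eqVneq b xt.
    by rewrite tpermL tpermD ?Tyt ?Txt ?tpermL //; apply: nb; rewrite ?Txf ?Tyf Tyt xpair_eqE andbF.
  have [->|nyt] := eqVneq b yt.
    by rewrite tpermR tpermD ?Tyt ?Txt ?tpermR //; apply: nb; rewrite ?Txf ?Tyf Txt xpair_eqE andbF.
  rewrite (@tpermD _ xt yt) 1?eq_sym //.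
  have [->|nxf] := eqVneq b xf; first by rewrite tpermL Txf Tyf tpermL.
  have [->|nyf] := eqVneq b yf; first by rewrite tpermR Txf Tyf tpermR.
  rewrite (@tpermD _ xf yf) 1?eq_sym //; split=> //.
  case Tb: (T b) => [i z] /=; rewrite tpermD //.
    apply/eqP => ei; rewrite -ei in Tb.
    case: z Tb => Tb; [move: nxt | move: nxf]; apply/negP; rewrite negbK; apply/eqP/Tcol_inj;
      by rewrite ?cb ?cxt ?cxf // Tb.
  apply/eqP => ei; rewrite -ei in Tb.
  case: z Tb => Tb; [move: nyt | move: nyf]; apply/negP; rewrite negbK; apply/eqP/Tcol_inj;
    by rewrite ?cb ?cyt ?cyf // Tb.
have -> : relab ((tperm x y * s)%g : {perm 'I_n}) = swapT (swapT (relab s) xf yf) xt yt.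
  apply/ffunP => b; rewrite !swapT_comp !ffunE; case: (eqVneq (bcol b) j) => cb.
    by have [-> ->] := key b cb; rewrite eqxx permM.
  have nbj b' : bcol b' = j -> b' != b by move=> cb'; apply: contraNneq cb => <-; rewrite cb'.
  by rewrite !tpermD ?nbj // (negPf cb).
have a1 : inW (XR s + tvec (swapT (relab s) xf yf)) by apply: W_alt; rewrite // cxf cyf.
have a2 : inW (tvec (swapT (relab s) xf yf) + tvec (swapT (swapT (relab s) xf yf) xt yt)).
  by apply: W_alt; rewrite // cxt cyt.
have := subD (inW_sub _ _) (subB (inW_sub _ _) a2 a1) IHs.
by rewrite [X in _ - X]addrC opprD [X in X + _]addrACA subrr add0r subrKA.
Qed.

Lemma straighten_symp : P (tvec T).
Proof.
have := Y_all (sub0set Pr); set good := fun h : {ffun 'I_n -> 'I_n} => inH set0 h && dinjectiveb h (mem Pr).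
have inj_relab h : good h -> inW (XR h - tvec T).
  case/andP => /forallP Hh /dinjectiveP inj.
  have hid k : k \notin Pr -> h k = k by move=> kP; have := Hh k; rewrite (negPf kP) => /eqP.
  have hP k : k \in Pr -> h k \in Pr by move=> kP; have := Hh k; rewrite kP in_set0.
  have h_inj : injective h.
    move=> k k'; have [kP | kP] := boolP (k \in Pr); have [k'P | k'P] := boolP (k' \in Pr).
    - exact: inj.
    - by rewrite (hid k') // => e; move: (hP _ kP); rewrite e (negPf k'P).
    - by rewrite (hid k) // => e; move: (hP _ k'P); rewrite -e (negPf kP).
    - by rewrite !hid.
  have -> : relab h = relab (perm h_inj).
    by apply/ffunP => b; rewrite !ffunE permE.
  by apply: relab_perm => i iP; rewrite permE hid.
have eY : Y set0 - scl #|good|%:R (tvec T) =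
   \sum_(h | inH set0 h && ~~ dinjectiveb h (mem Pr)) XR h + \sum_(h | good h) (XR h - tvec T).
  rewrite /Y (bigID (fun h : {ffun _ -> _} => dinjectiveb h (mem Pr))) /= big_split /= sumrN addrA [X in X - _]addrC.
  congr (_ + _ - _); rewrite -sumr_const scl_suml; apply: eq_bigr => h _.
  by rewrite scl1.
move=> PY; have : P (Y set0 - scl #|good|%:R (tvec T)).
  rewrite eY; apply: (subD Psub); apply: (sub_sumT Psub) => h; last by move=> gh; apply/PW/inj_relab.
  case/andP => _ /dinjectivePn [i iP [i']]; rewrite !inE => /andP [ni i'P] eh.
  by apply/PW/(@relab_rep _ i i' false) => //; case/and3P: i'P.
move=> /(subB Psub PY); rewrite subKr; apply: (subZI Psub).
(* The identity is one of the maps counted, so the multiple of [T] obtained is nonzero in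
   characteristic 0. *)
rewrite pnatr_eq0 -lt0n; apply/card_gt0P; exists [ffun i => i].
apply/andP; split; last by apply/dinjectiveP => i k _ _; rewrite !ffunE.
by apply/forallP => k; rewrite ffunE in_set0 eqxx; case: ifP.
Qed.

End SymplecticStep.

(** * Spanning by symplectic tableaux *)

Section Spanning.
Variables (C : numFieldType) (n : nat) (lam : 'I_n -> nat).
Hypothesis plam : is_partition lam.
Variables (P : tens C lam -> Prop).
Hypothesis Psub : subspaceP P.
Hypothesis PW : forall v, inW v -> P v.
Hypothesis Psymp : forall T, symplecticT T -> P (tvec C T).

Lemma symplectic_span v : P v.
Proof.
apply: (sub_tvec Psub); apply: (@finmax_ind _ (@mu _ _)) => T IH.
have [/forallP Tcol | ] := boolP [forall b1 : box lam, forall b2 : box lam,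
    (bcol b1 == bcol b2) && (brow b1 < brow b2)%N ==> ltL (T b1) (T b2)]; last first.
  case/forallPn => b1 /forallPn [b2]; rewrite negb_imply => /andP [/andP [/eqP cb rb] nT].
  exact: (straighten_swap Psub PW IH cb rb nT).
have {}Tcol (b1 b2 : box lam) : bcol b1 = bcol b2 -> (brow b1 < brow b2)%N -> ltL (T b1) (T b2).
  by move=> cb rb; have /forallP /(_ b2) := Tcol b1; rewrite cb eqxx rb.
have [/forallP Trow | ] := boolP [forall b1 : box lam, forall b2 : box lam,
    (brow b1 == brow b2) && (bcol b1 < bcol b2)%N ==> leL (T b1) (T b2)]; last first.
  case/forallPn => b1 /forallPn [b2]; rewrite negb_imply => /andP [/andP [/eqP rb cb] nT].
  exact: (straighten_exch plam Psub PW IH Tcol rb cb nT).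
have [/forallP Tsym | ] := boolP [forall b : box lam, (brow b <= (T b).1)%N]; last first.
  case/forallPn => b; rewrite -ltnNge => lt_b.
  exact: (straighten_symp plam Psub PW IH Tcol lt_b).
apply: Psymp; apply/andP; split; last by apply/forallP.
apply/forallP => b1; apply/forallP => b2; apply/andP; split.
  by have /forallP := Trow b1; apply.
by apply/implyP => /andP [/eqP cb rb]; apply: Tcol.
Qed.

End Spanning.

(** * Evaluation at frames *)

Section ColumnMinors.
Variables (K : comNzRingType) (n : nat) (lam : 'I_n -> nat).
Hypothesis plam : is_partition lam.
Local Notation box := (box lam).
Local Notation rows := {ffun box -> 'rV[K]_n}.
Implicit Types (V : rows) (F : rows -> K).

Definition vget V (i j : nat) : 'rV[K]_n := if obox lam i j is Some b then V b else 0.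

Definition colmx V (j : nat) : 'M[K]_(col_len lam j) :=
  \matrix_(p, q) (vget V p j) 0 (widen_ord (col_len_le lam j) q).

(** An empty column contributes the determinant of a 0 by 0 matrix, which is 1. The coefficients
    form a ring so that the same product serves for frames over the field and for curves of frames
    over its polynomials. *)
Definition EV V : K := \prod_(j < bnd lam) \det (colmx V j).

Definition upd V (b : box) (u : 'rV[K]_n) : rows := [ffun b' => if b' == b then u else V b'].

Definition multilin F := forall V b c u w,
  F (upd V b (c *: u + w)) = c * F (upd V b u) + F (upd V b w).

Lemma vget_box V (b : box) : vget V (brow b) (bcol b) = V b.
Proof. by rewrite /vget obox_brow_bcol. Qed.

Lemma upd_self V b : upd V b (V b) = V.
Proof. by apply/ffunP => b'; rewrite ffunE; case: eqP => // ->. Qed.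

Lemma updC V b b' u u' : b != b' -> upd (upd V b u) b' u' = upd (upd V b' u') b u.
Proof.
move=> nb; apply/ffunP => c; rewrite !ffunE; case: eqP => // ->.
by rewrite eq_sym (negPf nb).
Qed.

Lemma vget_upd V (b : box) u i j :
  vget (upd V b u) i j = if (i == brow b) && (j == bcol b) then u else vget V i j.
Proof.
rewrite /vget; case E: (obox lam i j) => [b'|]; last first.
  by case: andP => // -[/eqP ei /eqP ej]; rewrite ei ej obox_brow_bcol in E.
have [<- <-] := obox_some E; rewrite ffunE.
have [-> | nb] := eqVneq b' b; first by rewrite !eqxx.
case: andP => // -[/eqP e1 /eqP e2]; case/eqP: nb; exact: box_eq.
Qed.

Lemma EV_split V (b : box) :
  EV V = \det (colmx V (bcol b)) * \prod_(j < bnd lam | j != (val b).2) \det (colmx V j).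
Proof. by rewrite /EV (bigD1 (val b).2). Qed.

Lemma colmx_other V V' j :
  (forall b : box, bcol b = j -> V b = V' b) -> colmx V j = colmx V' j.
Proof.
move=> eV; apply/matrixP => p q; rewrite !mxE /vget.
case E: (obox lam p j) => [b|] //; have [_ eb] := obox_some E.
by rewrite eV.
Qed.

Lemma EV_multilin : multilin EV.
Proof.
move=> V b c u w; rewrite !(EV_split _ b).
have other x : \prod_(j < bnd lam | j != (val b).2) \det (colmx (upd V b x) j) =
               \prod_(j < bnd lam | j != (val b).2) \det (colmx V j).
  apply: eq_bigr => j nj; congr (\det _); apply: colmx_other => b' eb'.
  rewrite ffunE; case: eqP => // ebb'; case/eqP: nj; apply: val_inj.
  by rewrite /= -eb' ebb'.
rewrite !other mulrA -mulrDl; congr (_ * _).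
pose i0 := Ordinal (brow_col plam b).
rewrite -[\det (colmx (upd V b w) _)]mul1r; apply: (determinant_multilinear (i0 := i0)).
- by apply/rowP => q; rewrite !mxE !vget_upd !eqxx /= !mxE mul1r.
- apply/matrixP => p q; rewrite !mxE !vget_upd.
  by have := neq_lift i0 p; rewrite eq_sym -val_eqE /= => /negPf ->.
- apply/matrixP => p q; rewrite !mxE !vget_upd.
  by have := neq_lift i0 p; rewrite eq_sym -val_eqE /= => /negPf ->.
Qed.

Lemma multilin_sum F : multilin F -> forall V b (I : finType) (c : I -> K) (u : I -> 'rV[K]_n),
  F (upd V b (\sum_i c i *: u i)) = \sum_i c i * F (upd V b (u i)).
Proof.
move=> Fl V b I c u.
have F0 : F (upd V b 0) = 0.
  have := Fl V b 1 0 0; rewrite scale1r addr0 mul1r => e.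
  by apply: (addrI (F (upd V b 0))); rewrite -e addr0.
by elim/big_rec2: _ => // i y1 y2 _ <-.
Qed.

Definition ebas (rho : {ffun box -> 'I_n}) : rows := [ffun b => delta_mx 0 (rho b)].

Lemma multilin0 F : multilin F -> (forall rho, F (ebas rho) = 0) -> forall V, F V = 0.
Proof.
move=> Fl F0 V.
have H (s : seq box) : forall V, (forall b, b \notin s -> exists q, V b = delta_mx 0 q) -> F V = 0.
  elim: s => [|b s IHs] {}V HV.
    have ex b : exists q, V b == delta_mx 0 q by have [q ->] := HV b isT; exists q.
    have -> : V = ebas [ffun b => xchoose (ex b)]; last by apply: F0.
    by apply/ffunP => b; rewrite !ffunE; apply/eqP; apply: (xchooseP (ex b)).
  rewrite -(upd_self V b) [X in upd _ _ X]row_sum_delta (multilin_sum Fl).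
  apply: big1 => q _; rewrite IHs ?mulr0 // => b' nb'; rewrite ffunE.
  have [_ | nb] := eqVneq b' b; first by exists q.
  by apply: HV; rewrite inE negb_or nb.
by apply: (H (enum {: box})) => b; rewrite mem_enum.
Qed.

Lemma multilin_expand F : multilin F -> forall (L : finType) (x : box -> L -> K) (y : box -> L -> 'rV[K]_n),
  F [ffun b => \sum_c x b c *: y b c] =
  \sum_(S : {ffun box -> L}) (\prod_b x b (S b)) * F [ffun b => y b (S b)].
Proof.
move=> Fl L x y.
(* The difference of the two sides is again multilinear, so [multilin0] reduces the expansion to
   rows that are standard basis vectors. *)
have basis V : F V = \sum_(rho : {ffun box -> 'I_n}) (\prod_b V b 0 (rho b)) * F (ebas rho).
  apply/eqP; rewrite -subr_eq0; apply/eqP; move: V; apply: multilin0 => [V b c u w | rho].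
    rewrite Fl mulrBr addrACA -opprD; congr (_ - _).
    rewrite big_distrr -big_split /=; apply: eq_bigr => rho _.
    rewrite mulrA -mulrDl; congr (_ * _).
    rewrite !(bigD1 b (isT : xpredT b)) /= !ffunE eqxx !mxE mulrDl mulrA.
    by congr (_ * _ + _ * _); apply: eq_bigr => b' /negPf nb; rewrite !ffunE nb.
  rewrite (bigD1 rho) //= [X in _ - (_ + X)]big1 => [|rho' nrho].
    by rewrite big1 ?mul1r ?addr0 ?subrr // => b _; rewrite ffunE mxE !eqxx.
  have [b nb] : exists b, rho' b != rho b.
    by apply/existsP; apply: contraNT nrho; rewrite negb_exists => /forallP H;
      apply/eqP/ffunP => b; apply/eqP; have := H b; rewrite negbK.
  by rewrite (bigD1 b) //= ffunE mxE eqxx (negPf nb) !mul0r.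
rewrite basis (eq_bigr (fun rho : {ffun box -> 'I_n} => \sum_(S : {ffun box -> L})
    (\prod_b x b (S b)) * (\prod_b y b (S b) 0 (rho b)) * F (ebas rho))).
  rewrite exchange_big; apply: eq_bigr => S _; rewrite basis big_distrr /=.
  apply: eq_bigr => rho _; rewrite mulrA; congr (_ * _ * _).
  by apply: eq_bigr => b _; rewrite ffunE.
move=> rho _; rewrite -big_distrl /=; congr (_ * _).
rewrite (eq_bigr (fun b => \sum_c x b c * y b c 0 (rho b))); last first.
  move=> b _; rewrite ffunE summxE; apply: eq_bigr => c _; by rewrite mxE.
by rewrite bigA_distr_bigA; apply: eq_bigr => S _; rewrite big_split.
Qed.

Lemma EV_swap V (b1 b2 : box) : b1 != b2 -> bcol b1 = bcol b2 ->
  EV (pcomp V (tperm b1 b2)) = - EV V.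
Proof.
move=> nb eb; rewrite !(EV_split _ b1).
have -> : \prod_(j < bnd lam | j != (val b1).2) \det (colmx (pcomp V (tperm b1 b2)) j) =
          \prod_(j < bnd lam | j != (val b1).2) \det (colmx V j).
  apply: eq_bigr => j nj; congr (\det _); apply: colmx_other => b' eb'.
  have nj' : bcol b1 != j by rewrite eq_sym.
  by rewrite ffunE tpermD //; apply: contraNneq nj' => e; rewrite -eb' -e ?eb.
rewrite -mulNr; congr (_ * _).
have lt2 : (brow b2 < col_len lam (bcol b1))%N by rewrite eb brow_col.
pose p1 := Ordinal (brow_col plam b1); pose p2 := Ordinal lt2.
have np : p1 != p2.
  by apply: contraNneq nb => /(congr1 val) /= er; apply/eqP/box_eq.
have -> : colmx (pcomp V (tperm b1 b2)) (bcol b1) = row_perm (tperm p1 p2) (colmx V (bcol b1)).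
  apply/matrixP => p q; rewrite !mxE; move: (widen_ord _ q) => q'.
  have [b [rb cb]] := box_exists plam (ltn_ord p).
  have e1 : vget V (brow b1) (bcol b1) = V b1 by rewrite vget_box.
  have e2 : vget V (brow b2) (bcol b1) = V b2 by rewrite eb vget_box.
  have -> : vget (pcomp V (tperm b1 b2)) p (bcol b1) = V (tperm b1 b2 b).
    by rewrite -rb -cb vget_box ffunE.
  case: (tpermP b1 b2 b) => [ebb | ebb | nb1 nb2].
  - by rewrite (_ : p = p1) ?tpermL ?e2 //; apply: val_inj; rewrite /= -rb ebb.
  - by rewrite (_ : p = p2) ?tpermR ?e1 //; apply: val_inj; rewrite /= -rb ebb.
  rewrite tpermD -?rb -?cb ?vget_box //; apply/eqP => /(congr1 val) /=; rewrite -rb => er.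
    by apply: nb1; apply: box_eq.
  by apply: nb2; apply: box_eq; rewrite // cb eb.
by rewrite row_permE det_mulmx det_perm odd_tperm np expr1 mulN1r.
Qed.

Lemma EV_rep V (b1 b2 : box) : b1 != b2 -> bcol b1 = bcol b2 ->
  (forall q : 'I_n, (q < col_len lam (bcol b1))%N -> V b1 0 q = V b2 0 q) -> EV V = 0.
Proof.
move=> nb eb eV; rewrite (EV_split _ b1).
have lt2 : (brow b2 < col_len lam (bcol b1))%N by rewrite eb brow_col.
pose p1 := Ordinal (brow_col plam b1); pose p2 := Ordinal lt2.
have np : p1 != p2.
  by apply: contraNneq nb => /(congr1 val) /= er; apply/eqP/box_eq.
rewrite (determinant_alternate np) ?mul0r // => q.
have e2 : vget V (brow b2) (bcol b1) = V b2 by rewrite eb vget_box.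
by rewrite !mxE /= vget_box e2 eV //= ltn_ord.
Qed.

Lemma EV_zero V (b : box) :
  (forall q : 'I_n, (q < col_len lam (bcol b))%N -> V b 0 q = 0) -> EV V = 0.
Proof.
move=> V0; rewrite (EV_split _ b) (expand_det_row _ (Ordinal (brow_col plam b))).
rewrite big1 ?mul0r // => q _; rewrite !mxE /= vget_box V0 ?mul0r //=.
Qed.

Lemma comp_upd V (p : box -> box) b u : involutive p ->
  pcomp (upd V b u) p = upd (pcomp V p) (p b) u.
Proof.
by move=> pK; apply/ffunP => b'; rewrite !ffunE (inv_eq pK).
Qed.

End ColumnMinors.

(** * Independence of exchanges from the order of the chosen rows *)

Section ExchangeIdentity.
Variables (C : numFieldType) (n : nat) (lam : 'I_n -> nat).
Hypothesis plam : is_partition lam.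
Local Notation box := (box lam).
Local Notation rows := {ffun box -> 'rV[C]_n}.
Local Notation EV := (@EV C n lam).

Definition hperm (hs : seq nat) (s : {perm 'I_(size hs)}) : seq nat :=
  [seq nth 0%N hs (s i) | i : 'I_(size hs)].

Section Hperm.
Variable hs : seq nat.
Implicit Type s : {perm 'I_(size hs)}.

Lemma size_hperm s : size (hperm s) = size hs.
Proof. by rewrite size_map size_enum_ord. Qed.

Lemma nth_hperm s (i : 'I_(size hs)) : nth 0%N (hperm s) i = nth 0%N hs (s i).
Proof. by rewrite (nth_map i) ?size_enum_ord // nth_ord_enum. Qed.

Lemma hperm_perm s : perm_eq (hperm s) hs.
Proof.
apply/(@tuple_permP _ _ (hperm s) (in_tuple hs)); exists s => /=.
by apply: eq_map => i; rewrite (tnth_nth 0%N).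
Qed.

Lemma hperm1 : hperm (1%g : {perm 'I_(size hs)}) = hs.
Proof.
apply: (@eq_from_nth _ 0%N); rewrite size_hperm // => i lt_i.
by rewrite (nth_hperm _ (Ordinal lt_i)) perm1.
Qed.

End Hperm.

Lemma perm_hperm hs hs' : perm_eq hs' hs -> exists s, hs' = @hperm hs s.
Proof.
move/(@tuple_permP _ _ hs' (in_tuple hs)) => [s ->]; exists s => /=.
by apply: eq_map => i; rewrite (tnth_nth 0%N).
Qed.

Lemma xmap_ok_perm c1 c2 hs hs' : perm_eq hs' hs -> xmap_ok lam c1 c2 hs -> xmap_ok lam c1 c2 hs'.
Proof.
by move=> p [nc u a sz]; split; rewrite ?(perm_uniq p) ?(perm_all _ p) ?(perm_size p).
Qed.

(** Being an involution, an exchange is determined by its values on the right column and by its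
    fixed points; this is how conjugates of exchanges are recognised. *)
Lemma xmap_char c1 c2 hs (p : box -> box) : xmap_ok lam c1 c2 hs -> involutive p ->
  (forall b, bcol b = c2 -> (brow b < size hs)%N -> bcol (p b) = c1 /\ brow (p b) = nth 0%N hs (brow b)) ->
  (forall b, ~~ ((bcol b == c1) && (brow b \in hs)) -> ~~ ((bcol b == c2) && (brow b < size hs)%N) ->
     p b = b) ->
  p =1 xmap c1 c2 hs.
Proof.
move=> ok pK pr pid.
have eqr b : bcol b = c2 -> (brow b < size hs)%N -> p b = xmap c1 c2 hs b.
  by move=> cb hb; have [e1 e2] := pr b cb hb; have [e3 e4] := xmap_r plam ok cb hb;
    apply: box_eq; rewrite ?e2 ?e4 ?e1 ?e3.
move=> b; have [/andP [/eqP cb hb]|nl] := boolP ((bcol b == c1) && (brow b \in hs)).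
  have [e1 e2] := xmap_l plam ok cb hb.
  have e := eqr _ e1; rewrite e2 index_mem in e.
  by rewrite -{1}(xmapK plam ok b) -(e hb) pK.
have [/andP [/eqP cb hb]|nr] := boolP ((bcol b == c2) && (brow b < size hs)%N).
  exact: eqr.
by rewrite pid // xmap_id.
Qed.

Definition swapv (u v r : nat) := if r == u then v else if r == v then u else r.

Lemma swapvK u v : involutive (swapv u v).
Proof.
move=> r; rewrite /swapv; have [->|n1] := eqVneq r u; first by case: eqP => // _; rewrite eqxx.
by have [->|n2] := eqVneq r v; rewrite ?eqxx ?(negPf n1) ?(negPf n2).
Qed.

Section Conjugation.
Variables (c1 c2 : nat) (hs : seq nat) (b1 b2 : box).
Hypothesis ok : xmap_ok lam c1 c2 hs.
Hypotheses (e1 : bcol b1 = c1) (e2 : bcol b2 = c1).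

Lemma tperm_col b : bcol (tperm b1 b2 b) = bcol b.
Proof. by case: tpermP => [->|->|//]; rewrite e1 e2. Qed.

Lemma tperm_row b : bcol b = c1 -> brow (tperm b1 b2 b) = swapv (brow b1) (brow b2) (brow b).
Proof.
move=> cb; rewrite /swapv; case: tpermP => [->|->|n1 n2]; first by rewrite eqxx.
  by case: eqP => [->|_] //; rewrite eqxx.
case: eqP => [e|_]; first by case: n1; apply: box_eq; rewrite // cb e1.
by case: eqP => [e|_ //]; case: n2; apply: box_eq; rewrite // cb e2.
Qed.

Lemma xmap_conj_ok : xmap_ok lam c1 c2 (map (swapv (brow b1) (brow b2)) hs).
Proof.
case: ok => nc u /allP a sz; split; rewrite ?size_map ?(map_inj_uniq (inv_inj (swapvK _ _))) //.
apply/allP => _ /mapP [r rhs ->]; rewrite /swapv.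
case: eqP => _; first by rewrite -e2 brow_col.
by case: eqP => _; [rewrite -e1 brow_col | apply: a].
Qed.

Lemma xmap_conj :
  tperm b1 b2 \o xmap c1 c2 hs \o tperm b1 b2 =1 xmap c1 c2 (map (swapv (brow b1) (brow b2)) hs).
Proof.
apply: xmap_char; first exact: xmap_conj_ok.
- by move=> b /=; rewrite tpermK (xmapK plam ok) tpermK.
- move=> b cb; rewrite size_map => hb.
  have nb c : bcol c = c1 -> c != b.
    by case: ok => nc _ _ _ ec; apply: contraNneq nc => e; rewrite -ec -cb e.
  have [e3 e4] := xmap_r plam ok cb hb.
  by rewrite /= [tperm _ _ b]tpermD ?nb // tperm_col tperm_row // e3 e4 (nth_map 0%N).
move=> b nl nr /=; rewrite xmap_id ?tpermK // tperm_col; last first.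
  rewrite size_map in nr; apply: contra nr => /andP [/eqP cb]; rewrite cb eqxx.
  by rewrite tpermD //; case: ok => nc _ _ _; apply: contraNneq nc => e; rewrite -cb -e ?e1 ?e2.
apply: contra nl => /andP [/eqP cb]; rewrite cb eqxx tperm_row // => hb.
by rewrite -[brow b](swapvK (brow b1) (brow b2)) map_f.
Qed.

End Conjugation.

Lemma EV_comp_eq (V : rows) p q : p =1 q -> EV (pcomp V p) = EV (pcomp V q).
Proof. by move=> e; congr EV; apply/ffunP => b; rewrite !ffunE e. Qed.

(** Changing the order of two chosen rows conjugates the exchange by a transposition in the left
    column. Moved across the involution, this amounts to one swap in each of the two columns, and
    the signs cancel. *)
Lemma EV_hperm (c1 c2 : nat) hs (s : {perm 'I_(size hs)}) (V : rows) : xmap_ok lam c1 c2 hs ->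
  EV (pcomp V (xmap c1 c2 (hperm s))) = EV (pcomp V (xmap c1 c2 hs)).
Proof.
move=> ok; pose Q (t : {perm 'I_(size hs)}) :=
  EV (pcomp V (xmap c1 c2 (hperm t))) = EV (pcomp V (xmap c1 c2 hs)).
apply: (@colperm_ind _ _ (fun=> tt) Q) => [|x y {}s nxy _ _|b]; last by [].
  by rewrite /Q hperm1.
rewrite /Q => <-.
have okp t := xmap_ok_perm (hperm_perm t) ok.
have [nc uhs /allP ahs le_hs] := ok.
have lt_c2 (i : 'I_(size hs)) : (i < col_len lam c2)%N := leq_trans (ltn_ord i) le_hs.
have [rx [rrx crx]] := box_exists plam (lt_c2 x).
have [ry [rry cry]] := box_exists plam (lt_c2 y).
set q := xmap c1 c2 (hperm s).
have qK : involutive q := xmapK plam (okp s).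
have lt_s (i : 'I_(size hs)) : (i < size (hperm s))%N by rewrite size_hperm.
have [clx rlx] := xmap_r plam (okp s) crx (eq_ind_r (fun i => i < _)%N (lt_s x) rrx).
have [cly rly] := xmap_r plam (okp s) cry (eq_ind_r (fun i => i < _)%N (lt_s y) rry).
rewrite -/q in clx rlx cly rly.
have us : uniq (hperm s) by have [] := okp s.
have nr : rx != ry by apply: contraNneq nxy => e; rewrite -val_eqE /= -rrx -rry e.
have nl : q rx != q ry by rewrite (inj_eq (inv_inj qK)).
(* For a list without repetition, exchanging two positions is the same as exchanging the two values
   there. *)
have -> : hperm (tperm x y * s)%g = map (swapv (brow (q rx)) (brow (q ry))) (hperm s).
  apply: (@eq_from_nth _ 0%N); first by rewrite [in RHS]size_map !size_hperm.
  rewrite size_hperm => i lt_i.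
  rewrite [in RHS](nth_map 0%N) ?size_hperm //. rewrite rlx rly rrx rry (nth_hperm _ (Ordinal lt_i)) permM.
  rewrite -!nth_hperm /swapv !nth_uniq ?size_hperm //.
  have ex (z : 'I_(size hs)) : (i == z :> nat) = (Ordinal lt_i == z) by [].
  rewrite !ex; case: tpermP => [->|->|/eqP/negPf-> /eqP/negPf->]; rewrite ?eqxx //.
  by case: eqP => // ->.
rewrite -(EV_comp_eq _ (xmap_conj (okp s) clx cly)).
have e : tperm (q rx) (q ry) \o q \o tperm (q rx) (q ry) =1 q \o tperm rx ry \o tperm (q rx) (q ry).
  by move=> b /=; rewrite [RHS](inj_tperm _ _ _ (inv_inj qK)).
transitivity (EV (pcomp (pcomp (pcomp V q) (tperm rx ry)) (tperm (q rx) (q ry)))).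
  by congr EV; apply/ffunP => b; rewrite !ffunE e.
by rewrite EV_swap ?clx ?cly // EV_swap ?crx ?cry // opprK.
Qed.

Lemma EV_xmap_perm (c1 c2 : nat) hs hs' (V : rows) : xmap_ok lam c1 c2 hs -> perm_eq hs' hs ->
  EV (pcomp V (xmap c1 c2 hs')) = EV (pcomp V (xmap c1 c2 hs)).
Proof. by move=> ok /perm_hperm [s ->]; apply: EV_hperm. Qed.

End ExchangeIdentity.

(** * The exchange identity for products of minors *)

Section ExchangeVanishing.
Variables (C : numFieldType) (n : nat) (lam : 'I_n -> nat).
Hypothesis plam : is_partition lam.
Local Notation box := (box lam).
Local Notation rows := {ffun box -> 'rV[C]_n}.
Local Notation EV := (@EV C n lam).
Local Notation ebas := (@ebas C n lam).

Section Basis.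
Variables (c1 c2 k : nat) (rho : {ffun box -> 'I_n}).
Hypotheses (lt_c : (c1 < c2)%N) (le_k : (k <= col_len lam c2)%N).
Let R : {set 'I_n} := [set i : 'I_n | (c1 < lam i)%N].
Let good (S : {set 'I_n}) := (S \subset R) && (#|S| == k).
Let E (S : {set 'I_n}) := EV (pcomp (ebas rho) (xmap c1 c2 (seqS S))).

Lemma good_ok S : good S -> xmap_ok lam c1 c2 (seqS S).
Proof. by case/andP => sS /eqP cS; apply: (exch_ok plam lt_c le_k sS). Qed.

Lemma ebas_eq (p : box -> box) b b' (q : 'I_n) : rho (p b) = rho (p b') ->
  pcomp (ebas rho) p b 0 q = pcomp (ebas rho) p b' 0 q.
Proof. by move=> e; rewrite !ffunE e. Qed.

Lemma EV_ebas_big (p : box -> box) b : (col_len lam (bcol b) <= rho (p b))%N ->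
  EV (pcomp (ebas rho) p) = 0.
Proof.
move=> le_b; apply: (EV_zero plam (b := b)) => q lt_q.
by rewrite !ffunE mxE eqxx /=; case: eqP => // e; move: lt_q; rewrite e ltnNge le_b.
Qed.

Lemma comp_id (V : rows) : pcomp V id = V.
Proof. by apply/ffunP => b; rewrite ffunE. Qed.

Lemma xmap_cols hs (b : box) : xmap_ok lam c1 c2 hs -> (bcol b == c1) || (bcol b == c2) ->
  (bcol (xmap c1 c2 hs b) == c1) || (bcol (xmap c1 c2 hs b) == c2).
Proof.
move=> ok cb.
have [/andP [/eqP eb hb]|nl] := boolP ((bcol b == c1) && (brow b \in hs)).
  by have [-> _] := xmap_l plam ok eb hb; rewrite eqxx orbT.
have [/andP [/eqP eb hb]|nr] := boolP ((bcol b == c2) && (brow b < size hs)%N).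
  by have [-> _] := xmap_r plam ok eb hb; rewrite eqxx.
by rewrite xmap_id.
Qed.

Lemma cols_le (b : box) : (bcol b == c1) || (bcol b == c2) -> (col_len lam (bcol b) <= col_len lam c1)%N.
Proof. by case/orP => /eqP -> //; apply/col_len_anti/ltnW. Qed.

(** The left column is at least as long as the right one, so a basis vector beyond its length has
    only zero coordinates in whichever of the two columns it lands; both sides vanish. *)
Lemma exch_big (b : box) : (bcol b == c1) || (bcol b == c2) -> (col_len lam c1 <= rho b)%N ->
  EV (ebas rho) = \sum_(S | good S) E S.
Proof.
move=> cb le_b; rewrite -{1}(comp_id (ebas rho)) (@EV_ebas_big id b) ?big1 //; last first.
  by apply: leq_trans le_b; apply: cols_le.
move=> S /good_ok ok; apply: (@EV_ebas_big _ (xmap c1 c2 (seqS S) b)).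
rewrite (xmapK plam ok); apply: leq_trans le_b; apply: cols_le; exact: xmap_cols.
Qed.

Lemma swapv_tperm (s1 s2 i : 'I_n) : val (tperm s1 s2 i) = swapv s1 s2 i.
Proof.
rewrite /swapv; case: tpermP => [->|->|n1 n2]; rewrite ?eqxx //.
  by case: eqP => [->|].
by case: eqP => [/val_inj //|_]; case: eqP => [/val_inj //|].
Qed.

(* Exchanging along [S] and along its image under the transposition of the two
   equal rows gives opposite contributions. *)
Lemma exch_repeat (b1 b2 : box) : b1 != b2 -> bcol b1 = c1 -> bcol b2 = c1 -> rho b1 = rho b2 ->
  EV (ebas rho) = \sum_(S | good S) E S.
Proof.
move=> nb e1 e2 er.
have -> : EV (ebas rho) = 0.
  by apply: (EV_rep plam nb) => [|q _]; [rewrite e1 e2 | rewrite !ffunE er].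
pose s1 := (val b1).1; pose s2 := (val b2).1.
pose tau (S : {set 'I_n}) := tperm s1 s2 @: S.
have tau_inj : injective tau by apply: imset_inj; apply: perm_inj.
have R1 : s1 \in R by rewrite inE -e1; apply: bcol_lam.
have R2 : s2 \in R by rewrite inE -e2; apply: bcol_lam.
have Rt i : (tperm s1 s2 i \in R) = (i \in R) by case: tpermP => [->|->|//]; rewrite R1 R2.
have good_tau S : good (tau S) = good S.
  rewrite /good card_imset; last exact: perm_inj.
  congr (_ && _); apply/subsetP/subsetP => sS i iS.
    by rewrite -Rt sS // imset_f.
  by case/imsetP: iS => i' /sS i'R ->; rewrite Rt.
have E_tau S : good S -> E (tau S) = - E S.
  move=> gS; have ok := good_ok gS; rewrite /E.
  have p : perm_eq (seqS (tau S)) (map (swapv (brow b1) (brow b2)) (seqS S)).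
    apply: uniq_perm; first exact: seqS_uniq.
      by rewrite (map_inj_uniq (inv_inj (swapvK _ _))) seqS_uniq.
    move=> r; apply/idP/mapP => [/seqSP [i /imsetP [i' i'S ->] ->] | [r' /seqSP [i iS ->] ->]].
      by exists (val i'); [rewrite mem_seqS | rewrite swapv_tperm].
    by rewrite -[swapv _ _ _]swapv_tperm mem_seqS imset_f.
  rewrite (EV_xmap_perm plam _ (xmap_conj_ok plam ok e1 e2) p).
  rewrite -(EV_comp_eq _ (xmap_conj plam ok e1 e2)).
  rewrite -(EV_swap plam _ nb) ?e1 ?e2 //; congr EV; apply/ffunP => b.
  by rewrite !ffunE /=; congr (delta_mx _ _); case: (tpermP b1 b2 (xmap _ _ _ _)) => [->|->|].
have e : \sum_(S | good S) E S = - \sum_(S | good S) E S.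
  rewrite {1}(reindex_inj tau_inj) /= -sumrN; apply: eq_big => S; first exact: good_tau.
  by rewrite good_tau; apply: E_tau.
apply/esym/eqP; move/eqP: e; rewrite -addr_eq0 -mulr2n -mulr_natl mulf_eq0 pnatr_eq0.
by case/orP.
Qed.

(** The left column carries each of its initial basis vectors once, so every vector on top of the
    right column has a unique twin on the left. Exchanging with the twins changes nothing; any other
    choice leaves some twin beside its copy. *)
Lemma exch_bij :
  (forall b : box, (bcol b == c1) || (bcol b == c2) -> (rho b < col_len lam c1)%N) ->
  (forall b1 b2 : box, bcol b1 = c1 -> bcol b2 = c1 -> rho b1 = rho b2 -> b1 = b2) ->
  EV (ebas rho) = \sum_(S | good S) E S.
Proof.
move=> small inj1.
(* A repetition among the top [k] vectors of the right column kills the left side there, and every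
   term of the sum after both copies have moved to the left column. *)
have [/existsP [b1 /existsP [b2]] | top_inj] := boolP [exists b1 : box, exists b2 : box,
    [&& b1 != b2, bcol b1 == c2, bcol b2 == c2, (brow b1 < k)%N & (brow b2 < k)%N && (rho b1 == rho b2)]].
  case/and5P => nb /eqP e1 /eqP e2 l1 /andP [l2 /eqP er].
  rewrite (EV_rep plam nb) ?big1 ?e1 ?e2 // => [S gS|q _]; last by rewrite !ffunE er.
  have ok := good_ok gS; have szS : size (seqS S) = k by case/andP: gS => _ /eqP <-; rewrite size_seqS.
  rewrite -szS in l1 l2.
  have [c3 _] := xmap_r plam ok e1 l1; have [c4 _] := xmap_r plam ok e2 l2.
  apply: (EV_rep plam (b1 := xmap c1 c2 (seqS S) b1) (b2 := xmap c1 c2 (seqS S) b2)).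
  - by rewrite (inj_eq (inv_inj (xmapK plam ok))).
  - by rewrite c3 c4.
  by move=> q _; apply: ebas_eq; rewrite !(xmapK plam ok).
have {}top_inj (b1 b2 : box) : bcol b1 = c2 -> bcol b2 = c2 -> (brow b1 < k)%N -> (brow b2 < k)%N ->
    rho b1 = rho b2 -> b1 = b2.
  move=> e1 e2 l1 l2 er; apply/eqP; apply: contraNT top_inj => nb.
  by apply/existsP; exists b1; apply/existsP; exists b2; rewrite nb e1 e2 er l1 l2 !eqxx.
pose Cs : {set box} := [set b : box | bcol b == c1].
have lt_card m : (m <= n)%N -> #|[set i : 'I_n | (i < m)%N]| = m.
  move=> le_m; rewrite -[RHS](sum_ord_lt le_m) -sum1_card; apply: eq_bigl => i; by rewrite inE.
have surj : [set q : 'I_n | (q < col_len lam c1)%N] = rho @: Cs.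
  apply/esym/eqP; rewrite eqEcard; apply/andP; split.
    by apply/subsetP => _ /imsetP [b bC ->]; rewrite inE small //; move: bC; rewrite inE => ->.
  rewrite card_in_imset; last by move=> b b'; rewrite !inE => /eqP e /eqP e'; apply: inj1.
  apply: leq_trans (leq_imset_card (fun b : box => (val b).1) Cs); apply: subset_leq_card.
  apply/subsetP => q; rewrite inE => lt_q; have [b [rb cb]] := box_exists plam lt_q.
  by apply/imsetP; exists b; [rewrite inE cb | apply: val_inj].
have ex (i : 'I_k) : exists r, exists b, exists b' : box,
    [/\ bcol b = c2, brow b = i, bcol b' = c1, brow b' = r & rho b' = rho b].
  have [b [rb cb]] := box_exists plam (leq_trans (ltn_ord i) le_k).
  have : rho b \in rho @: Cs by rewrite -surj inE small // cb eqxx orbT.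
  case/imsetP => b'; rewrite inE => /eqP cb' er; exists (brow b'), b, b'; by split.
have [f Hf] := fin_all_exists ex.
pose hs := [seq f i | i : 'I_k].
have szh : size hs = k by rewrite size_map size_enum_ord.
have nth_hs (i : 'I_k) : nth 0%N hs i = f i by rewrite (nth_map i) ?size_enum_ord // nth_ord_enum.
have f_inj : injective f.
  move=> i i' ef; have [b [b' [cb rb cb' rb' er]]] := Hf i.
  have [d [d' [cd rd cd' rd' er']]] := Hf i'.
  have ebd : b' = d' by apply: box_eq; rewrite ?rb' ?rd' ?cb' ?cd'.
  apply: val_inj; rewrite /= -rb -rd; congr brow; apply: top_inj; rewrite ?rb ?rd ?ltn_ord //.
  by rewrite -er -er' ebd.
have ok : xmap_ok lam c1 c2 hs.
  split; rewrite ?szh //; first by rewrite neq_ltn lt_c.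
    by rewrite map_inj_uniq ?enum_uniq.
  apply/allP => _ /mapP [i _ ->]; have [b [b' [_ _ <- <- _]]] := Hf i; exact: brow_col.
pose S0 : {set 'I_n} := [set i : 'I_n | val i \in hs].
have pS0 : perm_eq hs (seqS S0).
  have [_ uhs /allP ahs _] := ok.
  apply: uniq_perm; rewrite ?seqS_uniq // => r; apply/idP/idP => [rh | /seqSP [i iS ->]].
    have lt_r : (r < n)%N := leq_trans (ahs _ rh) (col_len_le lam c1).
    by rewrite -[r]/(val (Ordinal lt_r)) mem_seqS inE.
  by move: iS; rewrite inE.
have gS0 : good S0.
  rewrite /good -size_seqS -(perm_size pS0) szh eqxx andbT; apply/subsetP => i.
  by rewrite !inE => ih; have [_ _ /allP ahs _] := ok; rewrite col_lenP // ahs.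
rewrite (bigD1 S0) //= big1 ?addr0.
  rewrite /E -(EV_xmap_perm plam _ (good_ok gS0) pS0); congr EV.
  apply/ffunP => b; rewrite !ffunE; congr (delta_mx _ _).
  have keyr (d : box) : bcol d = c2 -> (brow d < size hs)%N -> rho (xmap c1 c2 hs d) = rho d.
    move=> cd hd; have [e1 e2] := xmap_r plam ok cd hd.
    rewrite szh in hd; have [b0 [b' [cb rb cb' rb' er]]] := Hf (Ordinal hd).
    have -> : xmap c1 c2 hs d = b'.
      by apply: box_eq; rewrite ?e1 ?e2 ?cb' // rb' -nth_hs.
    by rewrite er; congr (rho _); apply: box_eq; rewrite ?rb ?cb ?cd.
  have [/andP [/eqP eb hb]|nl] := boolP ((bcol b == c1) && (brow b \in hs)).
    have [e1 e2] := xmap_l plam ok eb hb.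
    by rewrite -{1}(xmapK plam ok b) keyr // e2 index_mem.
  have [/andP [/eqP eb hb]|nr] := boolP ((bcol b == c2) && (brow b < size hs)%N).
    by rewrite keyr.
  by rewrite xmap_id.
move=> S /andP [gS nS]; have okS := good_ok gS.
have szS : size (seqS S) = k by case/andP: gS => _ /eqP <-; rewrite size_seqS.
have [i iS0 niS] : exists2 i, i \in S0 & i \notin S.
  apply/subsetPn; apply: contra nS => sS; rewrite eq_sym eqEcard sS /=.
  by case/andP: gS => _ /eqP ->; case/andP: gS0 => _ /eqP ->.
have /mapP [j _ ej] : val i \in hs by move: iS0; rewrite inE.
have [b [b' [cb rb cb' rb' er]]] := Hf j.
have hb : (brow b < size (seqS S))%N by rewrite szS rb.
have [c3 r3] := xmap_r plam okS cb hb.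
have nb' : brow b' \notin seqS S by rewrite rb' -ej mem_seqS.
apply: (EV_rep plam (b1 := b') (b2 := xmap c1 c2 (seqS S) b)).
- by apply: contraNneq nb' => ->; rewrite r3 mem_nth.
- by rewrite cb' c3.
move=> q _; apply: ebas_eq; rewrite (xmapK plam okS) xmap_id //.
  by rewrite cb' eqxx (negPf nb').
by rewrite cb' (ltn_eqF lt_c).
Qed.

Lemma exch_basis : EV (ebas rho) = \sum_(S | good S) E S.
Proof.
have [/existsP [b /andP [cb le_b]] | small] := boolP [exists b : box,
    ((bcol b == c1) || (bcol b == c2)) && (col_len lam c1 <= rho b)%N].
  exact: exch_big cb le_b.
have [/existsP [b1 /existsP [b2]] | inj1] := boolP [exists b1 : box, exists b2 : box,
    [&& b1 != b2, bcol b1 == c1, bcol b2 == c1 & rho b1 == rho b2]].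
  by case/and4P => nb /eqP e1 /eqP e2 /eqP er; apply: exch_repeat nb e1 e2 er.
apply: exch_bij => [b cb | b1 b2 e1 e2 er].
  by move: small; rewrite negb_exists => /forallP /(_ b); rewrite cb /= -ltnNge.
apply/eqP; apply: contraNT inj1 => nb.
by apply/existsP; exists b1; apply/existsP; exists b2; rewrite nb e1 e2 er !eqxx.
Qed.

End Basis.

(** Both sides are multilinear in the rows, since an exchange only relabels boxes; it remains to
    compare them on basis vectors. *)
Lemma EV_exch (V : rows) c1 c2 k : (c1 < c2)%N -> (k <= col_len lam c2)%N ->
  EV V = \sum_(S : {set 'I_n} | (S \subset [set i : 'I_n | (c1 < lam i)%N]) && (#|S| == k))
            EV (pcomp V (xmap c1 c2 (seqS S))).
Proof.
move=> lt_c le_k; apply/eqP; rewrite -subr_eq0; apply/eqP; move: V.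
apply: multilin0 => [V b c u w | rho]; last by rewrite -exch_basis // subrr.
rewrite (EV_multilin plam) mulrBr addrACA -opprD; congr (_ - _).
rewrite big_distrr -big_split; apply: eq_bigr => S /andP [sS /eqP cS].
have ok := exch_ok plam lt_c le_k sS cS.
by rewrite !(@comp_upd _ _ _ _ _ _ _ (xmapK plam ok)) (EV_multilin plam).
Qed.

End ExchangeVanishing.

(** * Evaluation of tensors and vanishing of the relations *)

Section Evaluation.
Variables (C : numFieldType) (n : nat).

Lemma sum_lab (V : nmodType) (F : lab n -> V) :
  \sum_(a : lab n) F a = \sum_(i < n) (F (i, false) + F (i, true)).
Proof.
transitivity (\sum_(i < n) \sum_(z : bool) F (i, z)).
  by rewrite pair_big; apply: eq_bigr => -[].
by apply: eq_bigr => i _; rewrite big_bool addrC.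
Qed.

Lemma formB_sum2 (K : fieldType) (F : lab n -> lab n -> K) :
  \sum_(a : lab n) \sum_(b : lab n) F a b * Defs.formB K a b =
  \sum_(i < n) (F (i, false) (i, true) - F (i, true) (i, false)).
Proof.
have H i z : \sum_(b : lab n) F (i, z) b * Defs.formB K (i, z) b =
    F (i, z) (i, ~~ z) * (if z then -1 else 1).
  rewrite sum_lab (bigD1 i) //= big1 ?addr0 => [|k nk].
    by rewrite /Defs.formB /= eqxx; case: z; rewrite /= !mulr0 ?addr0 ?add0r.
  by rewrite /Defs.formB /= eq_sym (negPf nk) !mulr0 addr0.
rewrite sum_lab; apply: eq_bigr => i _.
by rewrite !H /= mulr1 mulrN1.
Qed.

Lemma formB_sum (K : fieldType) (x y : lab n -> K) :
  \sum_(a : lab n) \sum_(b : lab n) x a * y b * Defs.formB K a b =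
  \sum_(i < n) (x (i, false) * y (i, true) - x (i, true) * y (i, false)).
Proof. exact: formB_sum2. Qed.

Variable lam : 'I_n -> nat.
Hypothesis plam : is_partition lam.

Definition rowM (M : lab n -> 'I_n -> C) (a : lab n) : 'rV[C]_n := \row_q M a q.

Definition evT (M : lab n -> 'I_n -> C) (T : tab lam) : C := EV [ffun b => rowM M (T b)].

Definition evl (M : lab n -> 'I_n -> C) (v : tens C lam) : C := \sum_T v T * evT M T.

Lemma evl_tvec M T : evl M (tvec C T) = evT M T.
Proof.
rewrite /evl (bigD1 T) //= ffunE eqxx mul1r big1 ?addr0 // => S nS.
by rewrite ffunE (negPf nS) mul0r.
Qed.

Lemma evlD M u v : evl M (u + v) = evl M u + evl M v.
Proof. by rewrite /evl -big_split; apply: eq_bigr => T _; rewrite ffunE mulrDl. Qed.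

Lemma evlZ M c v : evl M (scl c v) = c * evl M v.
Proof. by rewrite /evl big_distrr /=; apply: eq_bigr => T _; rewrite ffunE mulrA. Qed.

Lemma evl0 M : evl M 0 = 0.
Proof. by rewrite /evl big1 // => T _; rewrite ffunE mul0r. Qed.

Lemma evlN M v : evl M (- v) = - evl M v.
Proof. by rewrite -[v]scl1 -sclN !evlZ mulN1r mul1r. Qed.

Lemma evl_sum M (I : Type) (r : seq I) (Q : pred I) (F : I -> tens C lam) :
  evl M (\sum_(i <- r | Q i) F i) = \sum_(i <- r | Q i) evl M (F i).
Proof. by elim/big_rec2: _ => [|i y1 y2 _ <-]; rewrite ?evl0 ?evlD. Qed.

Lemma evT_comp M T p : evT M (pcomp T p) = EV (pcomp [ffun b => rowM M (T b)] p).
Proof. by congr EV; apply/ffunP => b; rewrite !ffunE. Qed.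

Lemma evT_upd2 M T B B' x y : B != B' ->
  evT M (upd2 T B x B' y) = EV (upd (upd [ffun b => rowM M (T b)] B (rowM M x)) B' (rowM M y)).
Proof.
move=> nb; congr EV; apply/ffunP => b; rewrite !ffunE.
have [->|_] := eqVneq b B; first by rewrite (negPf nb).
by case: eqP.
Qed.

(** For a symplectic relation the rows at the two boxes are expanded in coordinates. The coefficient
    attached to a pair of coordinates is then the form applied to two frame vectors, wherever the
    boxes lie. *)
Lemma evl_rel M v :
  (forall q q' : 'I_n, \sum_(a : lab n) \sum_(b : lab n) M a q * M b q' * Defs.formB C a b = 0) ->
  Defs.rel v -> evl M v = 0.
Proof.
move=> iso [[T [b1 [b2 [nb [cb ->]]]]] | [[T [c1 [c2 [k [lt_c [le_k ->]]]]]] | [T [B [B' [nb ->]]]]]].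
- by rewrite evlD !evl_tvec swapT_comp evT_comp EV_swap // addrN.
- rewrite evlD evlN evl_sum evl_tvec /evT (EV_exch plam _ lt_c le_k) -sumrB big1 //.
  by move=> S /andP [_ /eqP cS]; rewrite evl_tvec exchT_comp // evT_comp subrr.
rewrite evl_sum; set V := [ffun b => rowM M (T b)].
have fE x y : evT M (upd2 T B x B' y) =
    \sum_q \sum_q' M x q * M y q' * EV (upd (upd V B (delta_mx 0 q)) B' (delta_mx 0 q')).
  rewrite evT_upd2 // -/V updC // [X in upd _ B X]row_sum_delta (multilin_sum (EV_multilin plam)).
  apply: eq_bigr => q _; rewrite updC 1?eq_sym // [X in upd _ B' X]row_sum_delta.
  rewrite (multilin_sum (EV_multilin plam)) big_distrr /=; apply: eq_bigr => q' _.
  by rewrite !mxE mulrA.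
rewrite (eq_bigr (fun i => \sum_q \sum_q' (M (i, false) q * M (i, true) q' - M (i, true) q * M (i, false) q')
   * EV (upd (upd V B (delta_mx 0 q)) B' (delta_mx 0 q')))); last first.
  move=> i _; rewrite evlD evlN !evl_tvec !fE -sumrB; apply: eq_bigr => q _.
  by rewrite -sumrB; apply: eq_bigr => q' _; rewrite mulrBl.
rewrite exchange_big big1 // => q _; rewrite exchange_big big1 // => q' _.
by rewrite -big_distrl /= -(formB_sum (fun a => M a q) (fun b => M b q')) iso mul0r.
Qed.

Lemma evl_inW M v :
  (forall q q' : 'I_n, \sum_(a : lab n) \sum_(b : lab n) M a q * M b q' * Defs.formB C a b = 0) ->
  inW v -> evl M v = 0.
Proof.
move=> iso; move: v; apply: inW_min => [|v]; last exact: evl_rel.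
split; first exact: evl0.
by split=> [u v eu ev|c u eu]; rewrite ?evlD ?evlZ ?eu ?ev ?addr0 ?mulr0.
Qed.

End Evaluation.

(** * A curve of isotropic frames *)

Section LowestTerm.
Variable C : numFieldType.
Implicit Types (p q : {poly C}) (d e : nat).

Definition xdvd d p := exists r, p = 'X^d * r.
(** Fixing the lowest coefficient to be 1 makes the notion multiplicative with only the exponents to
    follow. *)
Definition lowest d p := exists r, p = 'X^d * (1 + 'X * r).

Lemma xdvd0 d : xdvd d 0. Proof. by exists 0; rewrite mulr0. Qed.
Lemma xdvdD d p q : xdvd d p -> xdvd d q -> xdvd d (p + q).
Proof. by move=> [r ->] [s ->]; exists (r + s); rewrite mulrDr. Qed.
Lemma xdvdMl d p q : xdvd d q -> xdvd d (p * q).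
Proof. by move=> [r ->]; exists (p * r); rewrite mulrCA. Qed.
Lemma xdvdM d e p q : xdvd d p -> xdvd e q -> xdvd (d + e) (p * q).
Proof. by move=> [r ->] [s ->]; exists (r * s); rewrite exprD; ring. Qed.
Lemma xdvd_le d e p : (d <= e)%N -> xdvd e p -> xdvd d p.
Proof. by move=> le_d [r ->]; exists ('X^(e - d) * r); rewrite mulrA -exprD subnKC. Qed.
Lemma xdvd1 : xdvd 0 1. Proof. by exists 1; rewrite expr0 mulr1. Qed.
Lemma xdvd_sum d (I : finType) (Q : pred I) (F : I -> {poly C}) :
  (forall i, Q i -> xdvd d (F i)) -> xdvd d (\sum_(i | Q i) F i).
Proof. by move=> H; elim/big_rec: _ => [|i x Qi]; [apply: xdvd0 | apply/xdvdD/H]. Qed.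
Lemma xdvd_prod (I : finType) (Q : pred I) (F : I -> {poly C}) (d : I -> nat) :
  (forall i, Q i -> xdvd (d i) (F i)) -> xdvd (\sum_(i | Q i) d i) (\prod_(i | Q i) F i).
Proof. by move=> H; elim/big_rec2: _ => [|i x y Qi]; [apply: xdvd1 | apply/xdvdM/H]. Qed.

Lemma lowest_xdvd d p : lowest d p -> xdvd d p.
Proof. by case=> r ->; exists (1 + 'X * r). Qed.
Lemma lowestX d : lowest d 'X^d.
Proof. by exists 0; rewrite mulr0 addr0 mulr1. Qed.
Lemma lowestM d e p q : lowest d p -> lowest e q -> lowest (d + e) (p * q).
Proof. by move=> [r ->] [s ->]; exists (r + s + 'X * r * s); rewrite exprD; ring. Qed.
Lemma lowestD d p q : lowest d p -> xdvd d.+1 q -> lowest d (p + q).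
Proof. by move=> [r ->] [s ->]; exists (r + s); rewrite exprS; ring. Qed.
Lemma lowest_prod (I : finType) (Q : pred I) (F : I -> {poly C}) (d : I -> nat) :
  (forall i, Q i -> lowest (d i) (F i)) -> lowest (\sum_(i | Q i) d i) (\prod_(i | Q i) F i).
Proof.
move=> H; elim/big_rec2: _ => [|i x y Qi]; last by apply/lowestM/H.
by rewrite -(expr0 'X); apply: lowestX.
Qed.

Lemma xdvd_coef d p k : xdvd d p -> (k < d)%N -> p`_k = 0.
Proof. by move=> [r ->] lt_k; rewrite coefXnM lt_k. Qed.
Lemma lowest_coef d p : lowest d p -> p`_d = 1.
Proof.
by move=> [r ->]; rewrite coefXnM ltnn subnn coefD coef1 coefXM eqxx addr0.
Qed.

Lemma lowest_indep (I : finType) (Q : pred I) (f : I -> {poly C}) (w : I -> nat) (c : I -> C) :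
  (forall i, Q i -> lowest (w i) (f i)) ->
  (forall i j, Q i -> Q j -> w i = w j -> i = j) ->
  \sum_(i | Q i) c i *: f i = 0 -> forall i, Q i -> c i = 0.
Proof.
move=> Hf Hw s0 i0 Qi0; apply/eqP; apply/negP => /negP c0.
pose Q' i := Q i && (c i != 0).
have Qi0' : Q' i0 by rewrite /Q' Qi0.
case: (arg_minnP w Qi0') => i /andP [Qi ci] min_i.
have := congr1 (fun p : {poly C} => p`_(w i)) s0; rewrite coef_sum coef0 (bigD1 i) //= coefZ.
rewrite (lowest_coef (Hf _ Qi)) mulr1 big1 ?addr0 => [/eqP|j /andP [Qj nj]].
  by rewrite (negPf ci).
rewrite coefZ; have [-> | cj] := eqVneq (c j) 0; first by rewrite mul0r.
rewrite (xdvd_coef (lowest_xdvd (Hf _ Qj))) ?mulr0 // ltn_neqAle min_i ?andbT; last first.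
  by rewrite /Q' Qj cj.
by apply: contraNneq nj => /(Hw _ _ Qi Qj) ->.
Qed.

(** The point must be nonzero because the curve of frames has powers of the parameter on its
    diagonal. *)
Lemma poly_nonzero_at p : p != 0 -> exists2 z : C, z != 0 & p.[z] != 0.
Proof.
move=> p0; pose rs : seq C := [seq i.+1%:R | i <- iota 0 (size p)].
have [/allP H | ] := boolP (all (root p) rs); last first.
  case/allPn => z /mapP [i _ ->] nr; exists i.+1%:R; first by rewrite pnatr_eq0.
  exact: nr.
have : (size rs < size p)%N.
  apply: max_poly_roots => //; first exact/allP.
  by rewrite map_inj_uniq ?iota_uniq // => i k /eqP; rewrite eqr_nat => /eqP [].
by rewrite size_map size_iota ltnn.
Qed.

End LowestTerm.

Section Curve.
Variables (C : numFieldType) (n : nat) (Om : lab n -> 'I_n -> nat).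
Hypothesis Om_lt : forall a b q, (ordL a < ordL b)%N -> (Om a q < Om b q)%N.
Local Notation PC := {poly C}.

Lemma Om_le a b q : (ordL a <= ordL b)%N -> (Om a q <= Om b q)%N.
Proof.
by rewrite leq_eqVlt => /orP [/eqP /ordL_inj -> // | /(@Om_lt _ _ q) /ltnW].
Qed.

(** The diagonal exponents are divided out of the columns, so that [A] is unitriangular and hence
    invertible over the polynomials; they are multiplied back in [isotropic_curve]. *)
Let dg (q : 'I_n) := Om (q, false) q.
Let A : 'M[PC]_n := \matrix_(i, q) if (q <= i)%N then 'X^(Om (i, false) q - dg q) else 0.
(** The symmetric value prescribed for A^T B, carrying the desired lowest terms of the barred rows
    in its lower triangle. *)
Let Sy : 'M[PC]_n := \matrix_(p, q)
  if (q <= p)%N then 'X^(Om (p, true) q - dg q) else 'X^(Om (q, true) p - dg p).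

Lemma curve_unit : A^T \in unitmx.
Proof.
rewrite unitmxE det_tr det_trig; last first.
  by apply/is_trig_mxP => i j lt_ij; rewrite mxE leqNgt lt_ij.
by rewrite big1 ?unitr1 // => i _; rewrite mxE leqnn subnn expr0.
Qed.

Lemma curve_exists : exists B : 'M[PC]_n, A^T *m B = Sy.
Proof. by exists (invmx A^T *m Sy); rewrite mulKVmx // curve_unit. Qed.

Lemma ordL_diag (i q : 'I_n) z : (q <= i)%N -> (ordL (q, false) <= ordL (i, z))%N.
Proof. by rewrite /ordL /=; lia. Qed.

(** Row [i] of the equation expresses [B i q] as the prescribed monomial minus multiples of the
    [B j q] with [j > i], whose orders are strictly larger; hence the induction from the last row
    upward. *)
Lemma curve_low (B : 'M[PC]_n) (q i : 'I_n) : A^T *m B = Sy -> (q <= i)%N ->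
  lowest (Om (i, true) q - dg q) (B i q).
Proof.
move=> eB; have [m] := ubnP (n - i)%N; elim: m i => // m IHm i lt_m le_qi.
have := congr1 (fun M : 'M[PC]_n => M i q) eB.
rewrite !mxE le_qi (bigD1 i) //= !mxE leqnn subnn expr0 mul1r.
move/(canRL (addrK _)) => ->; apply: lowestD; first exact: lowestX.
rewrite -mulN1r; apply: xdvdMl; apply: xdvd_sum => j nj; rewrite !mxE.
case: leqP => [le_ij | _]; last by rewrite mul0r; apply: xdvd0.
have lt_ij : (i < j)%N by rewrite ltn_neqAle le_ij andbT eq_sym.
apply: xdvdMl; have le_qj := leq_trans le_qi le_ij.
have lt_jm : (n - j < m)%N by have := ltn_ord j; lia.
apply: (xdvd_le _ (lowest_xdvd (IHm j lt_jm le_qj))).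
have lt_Om : (Om (i, true) q < Om (j, true) q)%N by apply: Om_lt; rewrite /ordL /=; lia.
have le_Om : (dg q <= Om (i, true) q)%N by apply: Om_le; apply: ordL_diag.
by rewrite -subSn // leq_sub2r.
Qed.

Lemma isotropic_curve : exists M : lab n -> 'I_n -> PC,
  [/\ forall i q, M (i, false) q = if (q <= i)%N then 'X^(Om (i, false) q) else 0,
      forall (i q : 'I_n), (q <= i)%N -> lowest (Om (i, true) q) (M (i, true) q),
      forall (i q : 'I_n), xdvd (Om (q, false) q) (M (i, true) q) &
      forall q q', \sum_(i < n) (M (i, false) q * M (i, true) q' - M (i, true) q * M (i, false) q') = 0].
Proof.
have [B eB] := curve_exists; exists (fun a q => (if a.2 then B a.1 q else A a.1 q) * 'X^(dg q)); split=> /=.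
- move=> i q; rewrite mxE; case: ifP => [le_q | _]; last by rewrite mul0r.
  by rewrite -exprD subnK // Om_le ?ordL_diag.
- move=> i q le_q; rewrite -(subnK (Om_le q (ordL_diag true le_q))).
  by apply: lowestM; [apply: curve_low eB le_q | apply: lowestX].
- by move=> i q; exists (B i q); rewrite mulrC.
move=> q q'; have e p p' : \sum_i A i p * B i p' = Sy p p'.
  rewrite -eB [RHS]mxE; apply: eq_bigr => i _.
  by congr (_ * _); rewrite [RHS]mxE.
have Sy_sym : Sy q q' = Sy q' q.
  rewrite !mxE; case: (leqP q' q) => le1; case: (leqP q q') => le2 //.
    by have /val_inj -> : val q = val q' by apply/eqP; rewrite eqn_leq le1 le2.
  by have := ltn_trans le1 le2; rewrite ltnn.
rewrite (eq_bigr (fun i => 'X^(dg q) * 'X^(dg q') * (A i q * B i q') -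
                           'X^(dg q) * 'X^(dg q') * (A i q' * B i q))); last first.
  by move=> i _; ring.
by rewrite sumrB -!big_distrr !e Sy_sym subrr.
Qed.

End Curve.

Section Weights.
Variables (n D : nat).

(* [expo] enumerates the pairs (entry, row); the weights [omega] separate
   contents because fewer than [wbase] boxes are ever involved. *)
Definition expo (a : lab n) (q : nat) : nat := ordL a * n + (n - q).
Definition wbase : nat := (D + n).+2.
(** One power beyond the largest exponent: a sum of at most [D + n] of the small powers stays below
    it. *)
Definition wtop : nat := wbase ^ (n.*2 * n + n).+1.
Definition omega (a : lab n) (q : nat) : nat := wtop * a.1 + wbase ^ expo a q.

Lemma expo_le a (q : nat) : (expo a q <= n.*2 * n + n)%N.
Proof.
rewrite /expo leq_add ?leq_subr // leq_mul2r; apply/orP; right.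
by apply: ltnW; apply: leq_trans (ordL_lt a) _; rewrite leq_double.
Qed.

Lemma expo_inj a b (q r : nat) : (q < n)%N -> (r < n)%N -> expo a q = expo b r -> a = b /\ q = r.
Proof.
move=> lt_q lt_r; rewrite /expo => e.
have lt : forall (x y : lab n) (q r : nat), (q < n)%N -> (r < n)%N ->
   (ordL x < ordL y)%N -> (ordL x * n + (n - q) < ordL y * n + (n - r))%N.
  move=> x y q' r' lq lr lt_o.
  have : ((ordL x).+1 * n <= ordL y * n)%N by rewrite leq_mul2r lt_o orbT.
  by rewrite mulSn; lia.
have eo : ordL a = ordL b.
  have [lt_o | lt_o | //] := ltngtP (ordL a) (ordL b).
    by have := lt _ _ _ _ lt_q lt_r lt_o; rewrite e ltnn.
  by have := lt _ _ _ _ lt_r lt_q lt_o; rewrite e ltnn.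
split; first exact: ordL_inj.
by move: e; rewrite eo; lia.
Qed.

Lemma wpow_lt e f : (e < f)%N -> (wbase * wbase ^ e <= wbase ^ f)%N.
Proof. by move=> lt_e; rewrite -expnS leq_exp2l. Qed.

Lemma omega_lt a b (q : nat) : (q < n)%N -> (ordL a < ordL b)%N -> (omega a q < omega b q)%N.
Proof.
move=> lt_q lt_o; have le_ab : (a.1 <= b.1)%N.
  by have := ordL_ge a; have := ordL_lt b; lia.
rewrite /omega -addnS; apply: leq_add; first by rewrite leq_mul2l le_ab orbT.
rewrite ltn_exp2l // /expo ltn_add2r ltn_mul2r lt_o andbT.
exact: leq_ltn_trans lt_q.
Qed.

Lemma sum_wpow_lt (I : finType) (Q : pred I) (a : I -> lab n) (r : I -> nat) :
  (#|Q| <= D + n)%N -> (\sum_(i | Q i) wbase ^ expo (a i) (r i) < wtop)%N.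
Proof.
move=> le_I; rewrite /wtop expnS.
apply: leq_ltn_trans (_ : (D + n) * wbase ^ (n.*2 * n + n) < _)%N; last first.
  by rewrite ltn_pmul2r ?expn_gt0 // /wbase.
apply: leq_trans (_ : \sum_(i | Q i) wbase ^ (n.*2 * n + n) <= _)%N.
  by apply: leq_sum => i _; rewrite leq_exp2l // expo_le.
by rewrite sum_nat_const leq_mul2r le_I orbT.
Qed.

(** An entry left of which the degenerate matrix vanishes costs a further [wtop], more than all
    small powers together. Without such an entry the multiples of [wtop] agree. The largest moved
    row [i] then satisfies [s i < i], and a smaller column raises the exponent: that one power
    exceeds the diagonal powers of the rows up to [i], while the later rows are fixed and cancel. *)
Lemma omega_diag_min k (a : 'I_k -> lab n) (s : {perm 'I_k}) (v : 'I_k -> nat) :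
  (k <= n)%N -> (forall p p' : 'I_k, (p < p')%N -> (ordL (a p) < ordL (a p'))%N) ->
  s != 1%g ->
  (forall p, (s p <= (a p).1)%N -> v p = omega (a p) (s p)) ->
  (forall p, ((a p).1 < s p)%N -> wtop * (a p).1.+1 <= v p)%N ->
  (\sum_p omega (a p) p < \sum_p v p)%N.
Proof.
move=> le_k a_lt ns v_ok v_bad.
have v_ge p : (wtop * (a p).1 <= v p)%N.
  have [/v_ok -> | /v_bad] := leqP (s p) (a p).1; first by rewrite leq_addr.
  by apply: leq_trans; rewrite leq_mul2l leqnSn orbT.
have card_k : (#|'I_k| <= D + n)%N by rewrite card_ord (leq_trans le_k) ?leq_addl.
have lt_top := sum_wpow_lt a (fun p : 'I_k => p : nat) card_k.
have eL : (\sum_p omega (a p) p = \sum_p wtop * (a p).1 + \sum_p wbase ^ expo (a p) p)%N.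
  by rewrite -big_split.
rewrite eL; case: (pickP (fun p => (a p).1 < s p)%N) => [p0 bad | no_bad].
  apply: leq_trans (_ : \sum_p wtop * (a p).1 + wtop <= _)%N; first by rewrite ltn_add2l.
  rewrite (bigD1 p0) //= [leqRHS](bigD1 p0) //= -addnA [(_ + wtop)%N]addnC addnA.
  apply: leq_add; first by have := v_bad _ bad; rewrite mulnS addnC.
  by apply: leq_sum => p _; apply: v_ge.
have le_s p : (s p <= (a p).1)%N by have := no_bad p; rewrite ltnNge => /negbFE.
rewrite [ltnRHS](eq_bigr (fun p => wtop * (a p).1 + wbase ^ expo (a p) (s p)))%N; last first.
  by move=> p _; rewrite v_ok.
rewrite big_split ltn_add2l.
have [p1 sp1] : exists p, s p != p.
  apply/existsP; apply: contraNT ns; rewrite negb_exists => /forallP H.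
  by apply/eqP/permP => p; rewrite perm1; apply/eqP; have := H p; rewrite negbK.
case: (@arg_maxnP _ p1 (fun p => s p != p) (fun p => p : nat) sp1) => i si max_i.
have fix_i (p : 'I_k) : (i < p)%N -> s p = p.
  by move=> lt_p; apply/eqP; apply: contraTT lt_p => /max_i; rewrite -leqNgt.
have lt_si : (s i < i)%N.
  rewrite ltn_neqAle si leqNgt /=; apply/negP => /fix_i /perm_inj e.
  by rewrite e eqxx in si.
rewrite [ltnLHS](bigID (fun p : 'I_k => p <= i)%N) [ltnRHS](bigID (fun p : 'I_k => p <= i)%N) /=.
rewrite [X in (_ < _ + X)%N](eq_bigr (fun p : 'I_k => wbase ^ expo (a p) p))%N; last first.
  by move=> p; rewrite -ltnNge => /fix_i ->.
rewrite ltn_add2r (bigD1 i (leqnn i)) /=.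
apply: leq_trans (_ : wbase ^ expo (a i) (s i) <= _)%N; last first.
  by rewrite [leqRHS](bigD1 i) //= leq_addr.
apply: leq_trans (_ : wbase * wbase ^ expo (a i) i <= _)%N; last first.
  by apply: wpow_lt; rewrite /expo; have := ltn_ord i; lia.
rewrite -(bigD1 i (leqnn i) (F := fun p : 'I_k => wbase ^ expo (a p) p)%N) /=.
apply: leq_ltn_trans (_ : (D + n) * wbase ^ expo (a i) i < _)%N; last first.
  by rewrite ltn_pmul2r ?expn_gt0 // /wbase.
apply: leq_trans (_ : \sum_(p < k | (p <= i)%N) wbase ^ expo (a i) i <= _)%N; last first.
  rewrite sum_nat_const leq_mul2r; apply/orP; right.
  by apply: leq_trans card_k; apply: max_card.
apply: leq_sum => p; rewrite leq_eqVlt => /orP [/eqP /val_inj -> // | lt_p].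
rewrite leq_exp2l // /expo; have := a_lt _ _ lt_p => lt_o.
have : ((ordL (a p)).+1 * n <= ordL (a i) * n)%N by rewrite leq_mul2r lt_o orbT.
by rewrite mulSn; have := ltn_ord i; lia.
Qed.

Lemma digits_uniq (E : nat) (x y : 'I_E -> nat) :
  (forall e, x e <= D)%N -> (forall e, y e <= D)%N ->
  (\sum_(e < E) x e * wbase ^ e = \sum_(e < E) y e * wbase ^ e)%N -> x =1 y.
Proof.
elim: E x y => [|E IHE] x y le_x le_y; first by move=> _ [].
rewrite !big_ord_recl !muln1.
have shift (z : 'I_E.+1 -> nat) : (\sum_(i < E) z (lift ord0 i) * wbase ^ lift ord0 i =
    wbase * \sum_(i < E) z (lift ord0 i) * wbase ^ i)%N.
  by rewrite big_distrr; apply: eq_bigr => i _; rewrite lift0 expnS mulnCA.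
rewrite !shift => e.
have lt_w z : (z <= D)%N -> (z < wbase)%N by rewrite /wbase; lia.
have e0 : x ord0 = y ord0.
  have := congr1 (modn^~ wbase) e; rewrite /= ![(_ + wbase * _)%N]addnC ![(wbase * _)%N]mulnC !modnMDl.
  by rewrite !modn_small ?lt_w.
move: e; rewrite e0 => /addnI /eqP; rewrite eqn_pmul2l // => /eqP e.
have H := IHE _ _ (fun i => le_x (lift ord0 i)) (fun i => le_y (lift ord0 i)) e.
by move=> i; case: (unliftP ord0 i) => [j ->|->].
Qed.

End Weights.

(** * Recovering a symplectic tableau from its weight *)

Section TableauWeight.
Variables (n : nat) (lam : 'I_n -> nat).
Hypothesis plam : is_partition lam.
Local Notation box := (box lam).
Implicit Types T : tab lam.

Lemma sympP T : symplecticT T ->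
  [/\ forall b1 b2 : box, brow b1 = brow b2 -> (bcol b1 <= bcol b2)%N -> (ordL (T b1) <= ordL (T b2))%N,
      forall b1 b2 : box, bcol b1 = bcol b2 -> (brow b1 < brow b2)%N -> (ordL (T b1) < ordL (T b2))%N &
      forall b : box, (brow b <= (T b).1)%N].
Proof.
case/andP => /forallP H /forallP Hr; split=> [b1 b2 er | b1 b2 ec lt_r | //].
  rewrite leq_eqVlt => /orP [/eqP ec | lt_c]; first by rewrite (box_eq er ec).
  have /forallP /(_ b2) /andP [+ _] := H b1.
  by rewrite er lt_c eqxx /= leL_ord.
have /forallP /(_ b2) /andP [_ +] := H b1.
by rewrite ec lt_r eqxx /= ltL_ord.
Qed.

Lemma box_row (q : 'I_n) j : (j < lam q)%N -> exists b : box, brow b = q /\ bcol b = j.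
Proof. by rewrite col_lenP // => /(box_exists plam). Qed.

Lemma card_row_lt (q : 'I_n) j : (j <= lam q)%N ->
  #|[set b : box | (brow b == q) && (bcol b < j)%N]| = j.
Proof.
move=> le_j.
have ex (i : 'I_j) : exists b : box, brow b = q /\ bcol b = i.
  by apply: box_row; apply: leq_trans (ltn_ord i) le_j.
have [f Hf] := fin_all_exists ex.
rewrite -[RHS]card_ord -(card_imset _ (_ : injective f)); last first.
  by move=> i i' e; apply: val_inj; rewrite /= -(proj2 (Hf i)) -(proj2 (Hf i')) e.
apply: eq_card => b; rewrite inE; apply/andP/imsetP => [[/eqP rb lt_b] | [i _ ->]].
  by exists (Ordinal lt_b) => //; have [e1 e2] := Hf (Ordinal lt_b); apply: box_eq; rewrite ?e1 ?e2.
by have [-> ->] := Hf i; rewrite eqxx ltn_ord.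
Qed.

Lemma card_row (q : 'I_n) : #|[set b : box | brow b == q]| = lam q.
Proof.
rewrite -[RHS](card_row_lt (leqnn (lam q))); apply: eq_card => b; rewrite !inE.
case: eqP => //= e; have -> : q = (val b).1 by apply: val_inj; rewrite /= -e.
by rewrite bcol_lam.
Qed.

Definition wt (D : nat) T : nat := \sum_(b : box) omega D (T b) (brow b).

Definition cnt T (a : lab n) (q : nat) : nat := #|[set b : box | (T b == a) && (brow b == q)]|.

(** Modulo [wtop] only the small powers remain, and no carries occur: the digits count the boxes
    with a given entry in a given row. *)
Lemma wt_cnt D T : (#|{: box}| <= D)%N -> (wt D T %% wtop n D =
  \sum_(e < (n.*2 * n + n).+1) #|[set b : box | expo (T b) (brow b) == e]| * wbase n D ^ e)%N.
Proof.
move=> le_D; rewrite /wt big_split /= -big_distrr /= mulnC modnMDl modn_small; last first.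
  by apply: sum_wpow_lt; apply: leq_trans le_D _; rewrite leq_addr.
have lt_e (b : box) : (expo (T b) (brow b) < (n.*2 * n + n).+1)%N by rewrite ltnS expo_le.
rewrite (partition_big (fun b => Ordinal (lt_e b)) xpredT) //=; apply: eq_bigr => e _.
rewrite -sum1_card big_distrl /=; apply: eq_big => b; first by rewrite inE -val_eqE.
by move=> /eqP <-; rewrite mul1n.
Qed.

Lemma row_count T (Pd : pred (lab n)) (q : 'I_n) :
  #|[set b : box | (brow b == q) && Pd (T b)]| = (\sum_(a | Pd a) cnt T a q)%N.
Proof.
rewrite -sum1_card (partition_big T Pd) /=; last by move=> b; rewrite inE => /andP [].
apply: eq_bigr => a Pa; rewrite /cnt -sum1_card; apply: eq_bigl => b.
by rewrite !inE andbC; case: eqP => //= ->; rewrite Pa andbT.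
Qed.

(** In a weakly increasing row the entries up to a bound form an initial segment, so their number
    locates each entry. *)
Lemma row_entry_le T (b : box) (o : nat) : symplecticT T ->
  (ordL (T b) <= o)%N = (bcol b < #|[set c : box | (brow c == (val b).1) && (ordL (T c) <= o)%N]|)%N.
Proof.
move=> /sympP [mon _ _]; apply/idP/idP => [le_o | ].
  rewrite -{1}[(bcol b).+1](card_row_lt (bcol_lam b)); apply/subset_leq_card/subsetP => c.
  rewrite !inE => /andP [/eqP rc le_c]; rewrite rc eqxx /=; apply: leq_trans le_o.
  by apply: mon; rewrite ?rc.
apply: contraTT; rewrite -!ltnNge ltnS => lt_o.
rewrite -[X in (_ <= X)%N](card_row_lt (ltnW (bcol_lam b))); apply/subset_leq_card/subsetP => c.
rewrite !inE => /andP [/eqP rc le_c]; rewrite rc eqxx /= ltnNge; apply/negP => le_bc.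
have : (ordL (T b) <= ordL (T c))%N by apply: mon; rewrite // rc.
by rewrite leqNgt (leq_ltn_trans le_c).
Qed.

End TableauWeight.

(** The digits give the content of every row: its size is the row length, and a weakly increasing
    row is determined by its content. Two shapes are allowed for the sake of the ideal. *)
Lemma wt_inj n (lam lam' : 'I_n -> nat) D (T : tab lam) (T' : tab lam') :
  is_partition lam -> is_partition lam' -> (#|{: box lam}| <= D)%N -> (#|{: box lam'}| <= D)%N ->
  symplecticT T -> symplecticT T' -> wt D T = wt D T' ->
  lam =1 lam' /\ forall (b : box lam) (b' : box lam'), brow b = brow b' -> bcol b = bcol b' -> T b = T' b'.
Proof.
move=> plam plam' leD leD' sT sT' ew.
have := wt_cnt T leD; rewrite ew (wt_cnt T' leD') => /esym /digits_uniq dig.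
have ecnt a (q : 'I_n) : cnt T a q = cnt T' a q.
  have e x : expo a q = x -> (x < (n.*2 * n + n).+1)%N by move=> <-; rewrite ltnS expo_le.
  have := dig _ _ (Ordinal (e _ erefl)) => {}dig.
  have card_eq (l : 'I_n -> nat) (S : tab l) : is_partition l ->
     #|[set b : box l | expo (S b) (brow b) == expo a q]| = cnt S a q.
    move=> pl; apply: eq_card => b; rewrite !inE; apply/eqP/andP => [eb | [/eqP -> /eqP -> //]].
    by have [-> ->] := expo_inj (brow_lt b) (ltn_ord q) eb; rewrite !eqxx.
  rewrite -!card_eq //; apply: dig => e'.
    by apply: leq_trans leD; apply: max_card.
  by apply: leq_trans leD'; apply: max_card.
have ecount (Pd : pred (lab n)) (q : 'I_n) :
   #|[set b : box lam | (brow b == q) && Pd (T b)]| = #|[set b : box lam' | (brow b == q) && Pd (T' b)]|.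
  by rewrite !row_count //; apply: eq_bigr.
split=> [q | b b' er ec].
  rewrite -(card_row plam) -(card_row plam').
  have := ecount xpredT q; rewrite /= => e; rewrite (eq_card (B := [set b : box lam | (brow b == q) && true])).
    by rewrite e; apply: eq_card => b; rewrite !inE andbT.
  by move=> b; rewrite !inE andbT.
have eq1 : (val b).1 = (val b').1 by apply: val_inj.
apply: ordL_inj; apply/eqP; rewrite eqn_leq; apply/andP; split.
  rewrite (row_entry_le plam b _ sT) ec eq1 (ecount (fun a => ordL a <= _)%N).
  by rewrite -(row_entry_le plam' b' _ sT').
rewrite (row_entry_le plam' b' _ sT') -ec -eq1 -(ecount (fun a => ordL a <= _)%N).
by rewrite -(row_entry_le plam b _ sT).
Qed.

(** * Lowest terms of minors along the curve *)

Section LowestMinors.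
Variables (C : numFieldType) (n D : nat).
Local Notation PC := {poly C}.
Local Notation Om := (fun (a : lab n) (q : 'I_n) => omega D a q).
Variable M : lab n -> 'I_n -> PC.
Hypothesis M_unbar : forall i q : 'I_n, M (i, false) q = if (q <= i)%N then 'X^(omega D (i, false) q) else 0.
Hypothesis M_low : forall i q : 'I_n, (q <= i)%N -> lowest (omega D (i, true) q) (M (i, true) q).
Hypothesis M_high : forall i q : 'I_n, xdvd (omega D (q, false) q) (M (i, true) q).

Lemma M_lowest (a : lab n) (q : 'I_n) : (q <= a.1)%N -> lowest (omega D a q) (M a q).
Proof.
case: a => i [] /= le_q; first exact: M_low.
by rewrite M_unbar le_q; apply: lowestX.
Qed.

Lemma M_xdvd (a : lab n) (q : 'I_n) : (a.1 < q)%N -> xdvd (wtop n D * a.1.+1) (M a q).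
Proof.
case: a => i [] /= lt_i; last by rewrite M_unbar leqNgt lt_i; apply: xdvd0.
apply: xdvd_le (M_high i q); rewrite /omega /=.
by apply: leq_trans (leq_addr _ _); rewrite leq_mul2l lt_i orbT.
Qed.

Variable lam : 'I_n -> nat.
Hypothesis plam : is_partition lam.

(** The symplectic condition keeps the diagonal in the region where entries have their prescribed
    lowest term; every other term of the determinant has larger order by [omega_diag_min]. *)
Lemma col_lowest (T : tab lam) j : symplecticT T ->
  lowest (\sum_(b : box lam | bcol b == j) omega D (T b) (brow b))
    (\det (colmx [ffun b => \row_q M (T b) q] j)).
Proof.
move=> sT; have [_ Tcol Tge] := sympP sT.
have ex (p : 'I_(col_len lam j)) : exists b : box lam, brow b = p /\ bcol b = j.
  exact: (box_exists plam (ltn_ord p)).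
have [f Hf] := fin_all_exists ex.
have rf p : brow (f p) = p by have [] := Hf p.
have cf p : bcol (f p) = j by have [] := Hf p.
have f_inj : injective f by move=> p p' e; apply: val_inj; rewrite /= -!rf e.
have -> : (\sum_(b : box lam | bcol b == j) omega D (T b) (brow b) =
           \sum_p omega D (T (f p)) p)%N.
  rewrite (eq_bigl (fun b => b \in f @: setT)) => [|b].
    rewrite big_imset /=; last by move=> p p' _ _; apply: f_inj.
    by apply: eq_big => p; rewrite ?inE // rf.
  apply/eqP/imsetP => [cb | [p _ ->] //].
  have lt_b : (brow b < col_len lam j)%N by rewrite -cb brow_col.
  by exists (Ordinal lt_b) => //; apply: box_eq; rewrite ?rf ?cf.
have ent p q : colmx [ffun b => \row_q M (T b) q] j p q = M (T (f p)) (widen_ord (col_len_le lam j) q).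
  have e : vget [ffun b => \row_q M (T b) q] p j = \row_q M (T (f p)) q.
    by rewrite -[in LHS](rf p) -[in LHS](cf p) vget_box ffunE.
  by rewrite mxE e mxE.
rewrite /determinant (bigD1 1%g) //=; apply: lowestD.
  rewrite odd_perm1 expr0 mul1r; apply: lowest_prod => p _; rewrite ent perm1.
  apply: (@M_lowest _ (widen_ord _ p)); rewrite /= -rf; exact: Tge.
apply: xdvd_sum => s ns; apply: xdvdMl.
pose v p : nat := if (s p <= (T (f p)).1)%N then omega D (T (f p)) (s p) else (wtop n D * (T (f p)).1.+1)%N.
have lt_v : (\sum_p omega D (T (f p)) p < \sum_p v p)%N.
  apply: (omega_diag_min (col_len_le lam j) _ ns) => [p p' lt_p | p le_p | p lt_p].
  - by apply: Tcol; rewrite ?cf ?rf.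
  - by rewrite /v le_p.
  by rewrite /v ifN // -ltnNge.
apply: xdvd_le lt_v _; apply: xdvd_prod => p _; rewrite ent /v.
case: leqP => [le_p | lt_p]; last by apply: (@M_xdvd _ (widen_ord _ (s p))).
by apply: lowest_xdvd; apply: (@M_lowest _ (widen_ord _ (s p))).
Qed.

Lemma EV_lowest (T : tab lam) : symplecticT T ->
  lowest (wt D T) (EV [ffun b => \row_q M (T b) q]).
Proof.
move=> sT; rewrite /wt (partition_big (fun b : box lam => (val b).2) xpredT) //=.
by apply: lowest_prod => j _; apply: col_lowest.
Qed.

Lemma EV_horner (T : tab lam) z :
  (EV [ffun b => \row_q M (T b) q]).[z] = evT (fun a q => (M a q).[z]) T.
Proof.
rewrite /evT /EV horner_prod; apply: eq_bigr => j _.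
rewrite -[_.[z]]/(horner_eval z _) -det_map_mx; congr (\det _).
apply/matrixP => p q; rewrite !mxE /vget; case: obox => [b|]; last by rewrite !mxE rmorph0.
by rewrite !ffunE !mxE.
Qed.

End LowestMinors.

(** The curve is chosen before the shape, so tableaux of different shapes can be compared on it. *)
Lemma isotropic_frames (C : numFieldType) n D : exists M : lab n -> 'I_n -> {poly C},
  [/\ forall i q : 'I_n, M (i, false) q = if (q <= i)%N then 'X^(omega D (i, false) q) else 0,
      forall q q' : 'I_n, \sum_(i < n) (M (i, false) q * M (i, true) q' - M (i, true) q * M (i, false) q') = 0 &
      forall (lam : 'I_n -> nat), is_partition lam -> forall T : tab lam, symplecticT T ->
        lowest (wt D T) (EV [ffun b => \row_q M (T b) q])].
Proof.
have lt_Om (a b : lab n) (q : 'I_n) : (ordL a < ordL b)%N -> (omega D a q < omega D b q)%N.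
  by apply: omega_lt.
have [M [M1 M2 M3 M4]] := @isotropic_curve C n (fun a q => omega D a q) lt_Om.
by exists M; split=> // lam plam T sT; apply: (EV_lowest M1 M2 M3 plam).
Qed.

Section Frames.
Variables (C : numFieldType) (n : nat).

Lemma triangular_admissible (M : lab n -> 'I_n -> C) :
  (forall i q : 'I_n, (i < q)%N -> M (i, false) q = 0) -> (forall q, M (q, false) q != 0) ->
  (forall q q' : 'I_n, \sum_(i < n) (M (i, false) q * M (i, true) q' - M (i, true) q * M (i, false) q') = 0) ->
  admissible M.
Proof.
move=> tri diag iso; split=> [c Hc q | q q']; last first.
  by rewrite (formB_sum (fun a => M a q) (fun a => M a q')) iso.
have [m] := ubnP (val q); elim: m q => // m IHm q lt_m.
have := Hc (q, false); rewrite (bigD1 q) //= big1 ?addr0 => [/eqP|r nr].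
  by rewrite mulf_eq0 (negPf (diag q)) orbF => /eqP.
have [lt_r | lt_r | /val_inj e] := ltngtP r q; last by rewrite e eqxx in nr.
  by rewrite IHm ?mul0r //; apply: leq_trans lt_r _; rewrite -ltnS.
by rewrite tri // mulr0.
Qed.

End Frames.

(** * The basis theorem *)

Section Basis.
Variables (C : numFieldType) (n : nat) (lam : 'I_n -> nat).
Hypothesis plam : is_partition lam.
Local Notation tab := (tab lam).
Local Notation tens := (tens C lam).
Local Notation tvec := (@tvec C n lam).

Lemma symplectic_spanning (v : tens) : exists c : tab -> C,
  inW (v - \sum_(T : tab | symplecticT T) scl (c T) (tvec T)).
Proof.
have Wsub := inW_sub C lam.
move: v; apply: (symplectic_span plam).
- split.
    exists (fun=> 0); rewrite big1 ?subr0 => [|T _]; last by rewrite scl0.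
    exact: sub0 Wsub.
  split=> [u v [c Hc] [d Hd] | a u [c Hc]].
    exists (fun T => c T + d T).
    have -> : \sum_(T : tab | symplecticT T) scl (c T + d T) (tvec T) =
       \sum_(T : tab | symplecticT T) scl (c T) (tvec T) + \sum_(T : tab | symplecticT T) scl (d T) (tvec T).
      by rewrite -big_split; apply: eq_bigr => T _; rewrite sclDl.
    by rewrite opprD addrACA; apply: (subD Wsub).
  exists (fun T => a * c T).
  have -> : \sum_(T : tab | symplecticT T) scl (a * c T) (tvec T) =
     scl a (\sum_(T : tab | symplecticT T) scl (c T) (tvec T)).
    by rewrite scl_sumr; apply: eq_bigr => T _; rewrite sclA.
  by rewrite -sclNr -sclDr; apply: (subZ Wsub).
- by move=> v Wv; exists (fun=> 0); rewrite big1 ?subr0 // => T _; rewrite scl0.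
move=> T sT; exists (fun S => (S == T)%:R).
rewrite (bigD1 T) //= eqxx scl1 big1 ?addr0 ?subrr => [|S /andP [_ /negPf ->]].
  exact: sub0 Wsub.
by rewrite scl0.
Qed.

Definition spec (M : lab n -> 'I_n -> {poly C}) (z : C) (a : lab n) (q : 'I_n) : C := (M a q).[z].

Section Curve.
Variable D : nat.
Variable M : lab n -> 'I_n -> {poly C}.
Hypothesis M_unbar : forall i q : 'I_n, M (i, false) q = if (q <= i)%N then 'X^(omega D (i, false) q) else 0.
Hypothesis M_iso : forall q q' : 'I_n,
  \sum_(i < n) (M (i, false) q * M (i, true) q' - M (i, true) q * M (i, false) q') = 0.

Lemma spec_tri z (i q : 'I_n) : (i < q)%N -> spec M z (i, false) q = 0.
Proof. by move=> lt_i; rewrite /spec M_unbar leqNgt lt_i horner0. Qed.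

Lemma spec_diag z (q : 'I_n) : z != 0 -> spec M z (q, false) q != 0.
Proof. by move=> z0; rewrite /spec M_unbar leqnn hornerXn expf_neq0. Qed.

Lemma spec_iso z (q q' : 'I_n) : \sum_(i < n) (spec M z (i, false) q * spec M z (i, true) q' -
  spec M z (i, true) q * spec M z (i, false) q') = 0.
Proof.
have := congr1 (fun p : {poly C} => p.[z]) (M_iso q q'); rewrite horner0 horner_sum => e.
by rewrite -[RHS]e; apply: eq_bigr => i _; rewrite hornerD hornerN !hornerM.
Qed.

Lemma spec_isotropic z (q q' : 'I_n) :
  \sum_(a : lab n) \sum_(b : lab n) spec M z a q * spec M z b q' * Defs.formB C a b = 0.
Proof. by rewrite (formB_sum (fun a => spec M z a q) (fun a => spec M z a q')) spec_iso. Qed.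

Hypothesis D_ge : (#|{: box lam}| <= D)%N.
Hypothesis M_lowest : forall T : tab, symplecticT T ->
  lowest (wt D T) (EV [ffun b => \row_q M (T b) q]).

Lemma spec_indep (c : tab -> C) :
  (forall z, z != 0 -> evl (spec M z) (\sum_(T | symplecticT T) scl (c T) (tvec T)) = 0) ->
  forall T, symplecticT T -> c T = 0.
Proof.
move=> H; apply: (lowest_indep M_lowest) => [S T sS sT ew | ].
  have [_ eST] := wt_inj plam plam D_ge D_ge sS sT ew.
  by apply/ffunP => b; apply: eST.
apply/eqP; apply: contraT => /poly_nonzero_at [z z0].
have := H z z0; rewrite evl_sum horner_sum => e.
rewrite -[X in X != 0](_ : 0 = _) ?eqxx //; rewrite -[LHS]e; apply: eq_bigr => T _.
by rewrite evlZ evl_tvec hornerZ EV_horner.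
Qed.

(** Modulo the relations [v] is a combination of symplectic tableaux with the same values on the
    curve, and these are independent there. *)
Lemma spec_kernel (v : tens) : (forall z, z != 0 -> evl (spec M z) v = 0) -> inW v.
Proof.
move=> H; have [c Hc] := symplectic_spanning v.
have c0 T : symplecticT T -> c T = 0.
  apply: spec_indep => z z0; have := evl_inW plam (spec_isotropic z) Hc.
  by rewrite evlD evlN H // sub0r => /eqP; rewrite oppr_eq0 => /eqP.
by move: Hc; rewrite big1 ?subr0 // => T sT; rewrite c0 ?scl0.
Qed.

End Curve.

Lemma symplectic_free (c : tab -> C) :
  inW (\sum_(T : tab | symplecticT T) scl (c T) (tvec T)) ->
  forall T : tab, symplecticT T -> c T = 0.
Proof.
move=> Wc; have [M [M1 M2 M3]] := isotropic_frames C n #|{: box lam}|.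
apply: (spec_indep (leqnn _) (M3 _ plam)) => z _.
by apply: (evl_inW plam) => // q q'; apply: spec_isotropic.
Qed.

End Basis.

(** * The symplectic group action *)

Section Group.
Variables (C : numFieldType) (n : nat).
Implicit Types g : lab n -> lab n -> C.
Local Notation formB := (@Defs.formB C n).

Lemma isSp_sum g a b : isSp g ->
  \sum_(i < n) (g (i, false) a * g (i, true) b - g (i, true) a * g (i, false) b) = formB a b.
Proof. by move=> gSp; rewrite -(formB_sum (fun c => g c a) (fun c => g c b)) gSp. Qed.

Definition mxL g : 'M[C]_#|{: lab n}| := \matrix_(i, j) g (enum_val i) (enum_val j).

Lemma sum_enum_lab (F : lab n -> C) : \sum_(i < #|{: lab n}|) F (enum_val i) = \sum_a F a.
Proof.
rewrite [RHS](reindex (fun i : 'I_#|{: lab n}| => enum_val i)) //.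
exact: onW_bij (enum_val_bij _).
Qed.

Lemma isSp_mx g : isSp g <-> (mxL g)^T *m mxL formB *m mxL g = mxL formB.
Proof.
have e i j : ((mxL g)^T *m mxL formB *m mxL g) i j =
    \sum_(c : lab n) \sum_(d : lab n) g c (enum_val i) * g d (enum_val j) * formB c d.
  rewrite mxE exchange_big /= -sum_enum_lab; apply: eq_bigr => k _.
  rewrite !mxE big_distrl /= -(sum_enum_lab (fun c => g c _ * g _ _ * formB c _)).
  by apply: eq_bigr => l _; rewrite !mxE mulrAC.
split=> [gSp | eM a b]; first by apply/matrixP => i j; rewrite e gSp mxE.
have := congr1 (fun A : 'M_ _ => A (enum_rank a) (enum_rank b)) eM.
by rewrite e mxE !enum_rankK.
Qed.

Lemma formB_sqr : mxL formB *m mxL formB = - 1%:M.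
Proof.
apply/matrixP => i j; rewrite !mxE.
under eq_bigr do rewrite !mxE.
rewrite (sum_enum_lab (fun c => formB _ c * formB c _)) sum_lab.
rewrite -(inj_eq enum_val_inj); case: (enum_val i) (enum_val j) => [k x] [l y].
rewrite (bigD1 k) //= big1 ?addr0 => [|k' nk].
  rewrite /Defs.formB /= eqxx xpair_eqE.
  by case: (k == l); case: x; case: y; rewrite /= ?mulr0 ?mul0r ?addr0 ?add0r ?mulr1 ?mul1r ?oppr0.
by rewrite /Defs.formB /= eq_sym (negPf nk) !mul0r addr0.
Qed.

(** As J^2 = -1, the relation G^T J G = J exhibits -J G^T J as a left inverse of G; it is also a
    right inverse, which gives G J G^T = J. *)
Lemma isSp_tr g : isSp g -> isSp (fun a b => g b a).
Proof.
move=> /isSp_mx; set G := mxL g; set J := mxL formB => e; apply/isSp_mx.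
have -> : mxL (fun a b => g b a) = G^T by apply/matrixP => i j; rewrite !mxE.
have JJ : J *m J = - 1%:M := formB_sqr.
have inv : (- (J *m G^T *m J)) *m G = 1%:M.
  by rewrite mulNmx -!mulmxA (mulmxA G^T) e JJ opprK.
have := mulmx1C inv; rewrite mulmxN !mulmxA => /eqP; rewrite eqr_oppLR => /eqP e2.
rewrite trmxK; have := congr1 (mulmx^~ J) e2.
by rewrite /= -!mulmxA JJ !mulmxN mulNmx !mulmx1 mul1mx => /oppr_inj.
Qed.

(* An isotropic frame [A; B] with [A] invertible is completed by [0; A^-T]. *)
Lemma frame_extension (M : lab n -> 'I_n -> C) :
  (forall i q : 'I_n, (i < q)%N -> M (i, false) q = 0) -> (forall q, M (q, false) q != 0) ->
  (forall q q' : 'I_n, \sum_(i < n) (M (i, false) q * M (i, true) q' - M (i, true) q * M (i, false) q') = 0) ->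
  exists g, isSp g /\ forall a q, g a (q, false) = M a q.
Proof.
move=> tri diag iso; pose A : 'M[C]_n := \matrix_(i, q) M (i, false) q.
have uA : A^T \in unitmx.
  rewrite unitmxE det_tr det_trig; last by apply/is_trig_mxP => i j; rewrite mxE; apply: tri.
  by rewrite unitfE; apply/prodf_neq0 => i _; rewrite mxE.
have AI (q q' : 'I_n) : \sum_i M (i, false) q * invmx A^T i q' = (q == q')%:R.
  have := congr1 (fun B : 'M_n => B q q') (mulmxV uA); rewrite !mxE => <-.
  by apply: eq_bigr => i _; rewrite !mxE.
pose g (a b : lab n) : C := if b.2 then (if a.2 then invmx A^T a.1 b.1 else 0) else M a b.1.
exists g; split=> // a b.
rewrite (formB_sum (fun c => g c a) (fun c => g c b)) /g /Defs.formB.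
case: a b => q [] [q' []] /=.
- by rewrite if_same big1 // => i _; rewrite mul0r mulr0 subrr.
- rewrite (eq_bigr (fun i => - (M (i, false) q' * invmx A^T i q))); last first.
    by move=> i _; rewrite mul0r sub0r mulrC.
  by rewrite sumrN AI eq_sym; case: eqP => // _; rewrite oppr0.
- rewrite (eq_bigr (fun i => M (i, false) q * invmx A^T i q')); last first.
    by move=> i _; rewrite mulr0 subr0.
  by rewrite AI; case: eqP.
by rewrite if_same iso.
Qed.

End Group.

(** * Invariance of the span of relations *)

Section Invariance.
Variables (C : numFieldType) (n : nat) (lam : 'I_n -> nat).
Hypothesis plam : is_partition lam.
Local Notation tab := (tab lam).
Local Notation tens := (tens C lam).
Local Notation tvec := (@tvec C n lam).
Variable g : lab n -> lab n -> C.
Local Notation box := (box lam).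

Lemma actD (u v : tens) : Defs.act g (u + v) = Defs.act g u + Defs.act g v.
Proof.
by apply/ffunP => S; rewrite !ffunE -big_split; apply: eq_bigr => T _; rewrite ffunE mulrDr.
Qed.

Lemma actZ c (v : tens) : Defs.act g (scl c v) = scl c (Defs.act g v).
Proof.
by apply/ffunP => S; rewrite !ffunE big_distrr; apply: eq_bigr => T _; rewrite ffunE mulrCA.
Qed.

Lemma act0 : Defs.act g (0 : tens) = 0.
Proof. by apply/ffunP => S; rewrite !ffunE big1 // => T _; rewrite ffunE mulr0. Qed.

Lemma actN (v : tens) : Defs.act g (- v) = - Defs.act g v.
Proof. by rewrite -[v]scl1 -sclN !actZ sclN. Qed.

Lemma act_sum (I : Type) (r : seq I) (Q : pred I) (F : I -> tens) :
  Defs.act g (\sum_(i <- r | Q i) F i) = \sum_(i <- r | Q i) Defs.act g (F i).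
Proof. by elim/big_rec2: _ => [|i y1 y2 _ <-]; rewrite ?act0 ?actD. Qed.

Lemma act_tvec (T : tab) :
  Defs.act g (tvec T) = \sum_(S : tab) scl (\prod_(b : box) g (S b) (T b)) (tvec S).
Proof.
rewrite [LHS]tens_sum_tvec; apply: eq_bigr => S _; congr (scl _ _).
rewrite ffunE (bigD1 T) //= ffunE eqxx mulr1 [X in _ + X]big1 ?addr0 // => T' nT.
by rewrite ffunE (negPf nT) mulr0.
Qed.

(* Place permutations commute with the diagonal action. *)
Lemma act_comp (T : tab) (p : box -> box) : involutive p ->
  Defs.act g (tvec (pcomp T p)) =
  \sum_(S : tab) scl (\prod_(b : box) g (S b) (T b)) (tvec (pcomp S p)).
Proof.
move=> pK; rewrite act_tvec.
have cK : involutive (fun S : tab => pcomp S p) by move=> S; apply/ffunP => b; rewrite !ffunE pK.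
rewrite (reindex_inj (inv_inj cK)); apply: eq_bigr => S _; congr (scl _ _).
rewrite [RHS](reindex_inj (inv_inj pK)); apply: eq_bigr => b _; by rewrite !ffunE.
Qed.

Hypothesis gSp : isSp g.

Lemma symp_rel_form (T : tab) (B B' : box) :
  \sum_(i < n) (tvec (upd2 T B (i, false) B' (i, true)) - tvec (upd2 T B (i, true) B' (i, false))) =
  \sum_(x : lab n) \sum_(y : lab n) scl (Defs.formB C x y) (tvec (upd2 T B x B' y)).
Proof.
apply/ffunP => S; rewrite !sum_ffunE.
rewrite (eq_bigr (fun i => tvec (upd2 T B (i, false) B' (i, true)) S -
                           tvec (upd2 T B (i, true) B' (i, false)) S)); last first.
  by move=> i _; rewrite !ffunE.
rewrite -(formB_sum2 (fun x y => tvec (upd2 T B x B' y) S)); apply: eq_bigr => x _.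
by rewrite sum_ffunE; apply: eq_bigr => y _; rewrite [RHS]ffunE mulrC.
Qed.

(** Tableaux are grouped by their filling outside the two boxes; the representative of a group
    carries [a0] in both. *)
Lemma sum_upd2 (V : nmodType) (F : tab -> V) (B B' : box) (a0 : lab n) : B != B' ->
  \sum_(S : tab) F S = \sum_(S : tab | (S B == a0) && (S B' == a0))
     \sum_(x : lab n) \sum_(y : lab n) F (upd2 S B x B' y).
Proof.
move=> nb; rewrite (partition_big (fun S => upd2 S B a0 B' a0) (fun S => (S B == a0) && (S B' == a0))) /=.
  apply: eq_bigr => S /andP [/eqP S1 /eqP S2].
  rewrite pair_big (reindex_onto (fun p : lab n * lab n => upd2 S B p.1 B' p.2) (fun S' => (S' B, S' B'))) /=.
    apply: eq_bigl => -[x y] /=; rewrite !ffunE eqxx [B' == B]eq_sym (negPf nb) !eqxx andbT.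
    by apply/eqP/ffunP => b; rewrite !ffunE; case: eqP => [->//|_]; case: eqP => [->|].
  move=> S' /eqP <-; apply/ffunP => b; rewrite !ffunE /=.
  by case: eqP => [->//|_]; case: eqP => [->|].
by move=> S _; rewrite !ffunE !eqxx if_same eqxx.
Qed.

Lemma act_symp (T : tab) (B B' : box) : B != B' ->
  inW (Defs.act g (\sum_(i < n) (tvec (upd2 T B (i, false) B' (i, true))
                      - tvec (upd2 T B (i, true) B' (i, false))))).
Proof.
move=> nb; pose R (S : tab) := \prod_(b : box | (b != B) && (b != B')) g (S b) (T b).
have prodE (S : tab) x y : \prod_(b : box) g (S b) (upd2 T B x B' y b) = g (S B) x * g (S B') y * R S.
  have nb' : B' != B by rewrite eq_sym.
  rewrite (bigD1 B) //= (bigD1 B') //= !ffunE eqxx (negPf nb') eqxx mulrA; congr (_ * _).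
  by apply: eq_bigr => b /andP [/negPf n1 /negPf n2]; rewrite ffunE n1 n2.
have -> : Defs.act g (\sum_(i < n) (tvec (upd2 T B (i, false) B' (i, true))
     - tvec (upd2 T B (i, true) B' (i, false)))) =
     \sum_(S : tab) scl (R S * Defs.formB C (S B) (S B')) (tvec S).
  rewrite act_sum [RHS](eq_bigr (fun S : tab => \sum_(i < n)
    (scl (g (S B) (i, false) * g (S B') (i, true) * R S) (tvec S) -
     scl (g (S B) (i, true) * g (S B') (i, false) * R S) (tvec S)))); last first.
    (* Invariance of the tensor dual to the form pairs rows of [g], not columns, which is why the
       transpose enters. *)
    move=> S _; rewrite -(isSp_sum _ _ (isSp_tr gSp)) big_distrr scl_suml.
    by apply: eq_bigr => i _; rewrite /= mulrBr sclDl sclN !(mulrC (R S)).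
  rewrite exchange_big; apply: eq_bigr => i _; rewrite actD actN !act_tvec -sumrB.
  by apply: eq_bigr => S _; rewrite !prodE.
have a0 : lab n := ((val B).1, false).
rewrite (sum_upd2 _ a0 nb); apply: (sub_sumT (inW_sub _ _)) => S _.
have -> : \sum_(x : lab n) \sum_(y : lab n) scl (R (upd2 S B x B' y) *
    Defs.formB C (upd2 S B x B' y B) (upd2 S B x B' y B')) (tvec (upd2 S B x B' y)) =
   scl (R S) (\sum_(x : lab n) \sum_(y : lab n) scl (Defs.formB C x y) (tvec (upd2 S B x B' y))).
  rewrite scl_sumr; apply: eq_bigr => x _; rewrite scl_sumr; apply: eq_bigr => y _.
  rewrite sclA; congr (scl (_ * _) _).
    by apply: eq_bigr => b /andP [/negPf n1 /negPf n2]; rewrite ffunE n1 n2.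
  by rewrite !ffunE !eqxx eq_sym (negPf nb).
rewrite -symp_rel_form; apply: (subZ (inW_sub _ _)); apply: inW_rel.
by right; right; exists S, B, B'.
Qed.

Lemma act_inW (v : tens) : inW v -> inW (Defs.act g v).
Proof.
have Wsub := inW_sub C lam.
move: v; apply: inW_min.
  split; first by rewrite act0; apply: sub0.
  by split=> [u v Wu Wv | c u Wu]; rewrite ?actD ?actZ; [apply: subD | apply: subZ].
move=> v [[T [b1 [b2 [nb [cb ->]]]]] | [[T [c1 [c2 [k [lt_c [le_k ->]]]]]] | [T [B [B' [nb ->]]]]]].
- rewrite actD swapT_comp (act_comp _ (@tpermK _ b1 b2)) act_tvec -big_split /=.
  apply: (sub_sumT Wsub) => S _; rewrite -sclDr -swapT_comp; apply: (subZ Wsub); exact: W_alt.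
- rewrite actD actN act_tvec act_sum.
  rewrite (eq_bigr (fun S : {set 'I_n} => \sum_(T' : tab)
      scl (\prod_(b : box) g (T' b) (T b)) (tvec (exchT T' c1 c2 k S)))); last first.
    move=> S /andP [sS /eqP cS]; have ok := exch_ok plam lt_c le_k sS cS.
    rewrite exchT_comp // (act_comp _ (xmapK plam ok)); apply: eq_bigr => T' _.
    by rewrite exchT_comp.
  rewrite exchange_big -sumrB /=; apply: (sub_sumT Wsub) => S _.
  rewrite -scl_sumr -sclNr -sclDr; apply: (subZ Wsub); apply: inW_rel.
  by right; left; exists S, c1, c2, k.
exact: act_symp.
Qed.

End Invariance.

(** * Irreducibility *)

Section HighestWeight.
Variables (C : numFieldType) (n : nat) (lam : 'I_n -> nat).
Hypothesis plam : is_partition lam.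
Local Notation box := (box lam).
Local Notation tab := (tab lam).
Local Notation tens := (tens C lam).
Local Notation tvec := (@tvec C n lam).

Definition T0 : tab := [ffun b => ((val b).1, false)].

Lemma symplectic_T0 : symplecticT T0.
Proof.
apply/andP; split; last by apply/forallP => b; rewrite ffunE.
apply/forallP => b1; apply/forallP => b2; rewrite !ffunE; apply/andP; split; apply/implyP.
  case/andP => /eqP er _; rewrite leL_ord /ordL /=.
  by have -> : (val b1).1 = (val b2).1 by apply: val_inj.
by case/andP => _ lt_r; rewrite ltL_ord /ordL /= !addn0 ltn_double.
Qed.

Lemma T0_notW : ~ inW (tvec T0).
Proof.
move=> W0; have := @symplectic_free C n lam plam (fun T => (T == T0)%:R).
rewrite (bigD1 T0) ?symplectic_T0 //= eqxx scl1 big1 ?addr0 => [|T /andP [_ /negPf ->]]; last first.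
  by rewrite scl0.
move=> /(_ W0 _ symplectic_T0) /eqP; by rewrite eqxx oner_eq0.
Qed.

Lemma T0_highest (g : lab n -> lab n -> C) : inBorel g ->
  inW (Defs.act g (tvec T0) - scl (chi lam g) (tvec T0)).
Proof.
case=> _ gB; rewrite act_tvec (bigD1 T0) //=.
have -> : \prod_(b : box) g (T0 b) (T0 b) = chi lam g.
  rewrite (partition_big (fun b : box => (val b).1) xpredT) //=; apply: eq_bigr => i _.
  rewrite (eq_bigr (fun=> g (i, false) (i, false))); last by move=> b /eqP <-; rewrite ffunE.
  rewrite -(card_row plam i) -prodr_const; apply: eq_bigl => b; by rewrite inE.
rewrite addrAC subrr add0r; apply: (sub_sumT (inW_sub _ _)) => S nS.
have [-> | p0] := eqVneq (\prod_(b : box) g (S b) (T0 b)) 0.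
  by rewrite scl0; apply: sub0 (inW_sub _ _).
apply: (subZ (inW_sub _ _)).
have Sb (b : box) : (S b).2 = false /\ ((S b).1 <= (val b).1)%N.
  by apply: gB; move/prodf_neq0: p0 => /(_ b isT); rewrite ffunE.
have [b1 nb1] : exists b, S b != T0 b.
  apply/existsP; apply: contraNT nS; rewrite negb_exists => /forallP H.
  by apply/eqP/ffunP => b; apply/eqP; have := H b; rewrite negbK.
(* In the topmost box where [S] differs from [T0], the entry is an unbarred index smaller than the
   row. The box of that row in the same column agrees with [T0], so the entry is repeated. *)
case: (@arg_minnP _ b1 (fun b => S b != T0 b) (fun b : box => brow b) nb1) => b nb min_b.
have eS (c : box) : S c = ((S c).1, false) by have [<- _] := Sb c; case: (S c).
have lt_b : ((S b).1 < brow b)%N.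
  have [_ le_b] := Sb b; rewrite ltn_neqAle le_b andbT; apply: contraNneq nb => e.
  by rewrite eS ffunE; apply/eqP; congr (_, _); apply: val_inj.
have [b' [rb cb]] := box_exists plam (ltn_trans lt_b (brow_col plam b)).
apply: (@W_rep C n lam _ b' b) => //.
  by apply: contraTneq lt_b => e; rewrite -rb e ltnn.
have /eqP -> : S b' == T0 b'.
  by apply: contraT => /min_b; rewrite leqNgt rb lt_b.
by rewrite ffunE eS; congr (_, _); apply: val_inj.
Qed.

(** The action on tensors is adjoint to multiplication of the frame by the transpose of [g]. *)
Lemma evl_act (M : lab n -> 'I_n -> C) (g : lab n -> lab n -> C) (v : tens) :
  evl M (Defs.act g v) = evl (fun a q => \sum_c g c a * M c q) v.
Proof.
have e (T : tab) : evT (fun a q => \sum_c g c a * M c q) T =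
    \sum_(S : tab) (\prod_(b : box) g (S b) (T b)) * evT M S.
  rewrite -(multilin_expand (EV_multilin plam) (fun b c => g c (T b)) (fun b c => rowM M c)).
  congr EV; apply/ffunP => b; rewrite !ffunE; apply/rowP => q.
  by rewrite mxE summxE; apply: eq_bigr => c _; rewrite !mxE.
rewrite /evl (eq_bigr (fun S : tab => \sum_(T : tab) v T * ((\prod_(b : box) g (S b) (T b)) * evT M S))).
  by rewrite exchange_big; apply: eq_bigr => T _; rewrite e big_distrr.
move=> S _; rewrite ffunE big_distrl; apply: eq_bigr => T _ /=; by rewrite mulrCA mulrA.
Qed.

Definition idM (a : lab n) (q : 'I_n) : C := (a == (q, false))%:R.

Lemma idM_isotropic (q q' : 'I_n) :
  \sum_(a : lab n) \sum_(b : lab n) idM a q * idM b q' * Defs.formB C a b = 0.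
Proof.
rewrite (formB_sum (fun a => idM a q) (fun a => idM a q')) big1 // => i _.
by rewrite /idM !xpair_eqE !andbF mulr0 mul0r subrr.
Qed.

(** The symplectic condition makes the matrices of the standard frame triangular, and a mismatch
    with [T0] puts a zero on a diagonal. Evaluation at the standard frame thus reads off the
    coordinate at [T0]. *)
Lemma evT_idM (S : tab) : symplecticT S -> S != T0 -> evT idM S = 0.
Proof.
move=> sS nS; have [_ _ Sge] := sympP sS.
have [b nb] : exists b, S b != T0 b.
  apply/existsP; apply: contraNT nS; rewrite negb_exists => /forallP H.
  by apply/eqP/ffunP => b; apply/eqP; have := H b; rewrite negbK.
rewrite /evT (EV_split _ b) -det_tr det_trig; last first.
  apply/is_trig_mxP => q p lt_qp; rewrite !mxE.
  have [c [rc cc]] := box_exists plam (ltn_ord p).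
  have -> : vget [ffun b => rowM idM (S b)] p (bcol b) = rowM idM (S c).
    by rewrite -rc -cc vget_box ffunE.
  rewrite mxE /idM; case: eqP => // e; have := Sge c.
  by rewrite e rc leqNgt lt_qp.
rewrite (bigD1 (Ordinal (brow_col plam b))) //= !mxE /= vget_box ffunE mxE /idM.
case: eqP => [e | _]; last by rewrite !mul0r.
case/eqP: nb; rewrite ffunE e; congr (_, _); exact: val_inj.
Qed.

(** Indices start at 0, so the exponent is at least 1 and every unbarred value exceeds 1. An entry
    of index at least [i] then has value at most that of the unbarred [i], with equality only
    there. *)
Definition torus (a : lab n) : C :=
  if a.2 then (2 ^+ (n - a.1))^-1 else 2 ^+ (n - a.1).

Lemma torus_gt0 a : 0 < torus a.
Proof. by rewrite /torus; case: a.2; rewrite ?invr_gt0 exprn_gt0 // ltr0n. Qed.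

Definition torus_mx (a b : lab n) : C := if a == b then torus a else 0.

Lemma torus_Sp : isSp torus_mx.
Proof.
move=> a b; rewrite (formB_sum (fun c => torus_mx c a) (fun c => torus_mx c b)).
case: a b => k x [l y]; rewrite (bigD1 k) //= big1 ?addr0 => [|i ni]; last first.
  by rewrite /torus_mx !xpair_eqE (negPf ni) !mul0r subrr.
rewrite /torus_mx /Defs.formB !xpair_eqE eqxx /=.
have t0 : 2 ^+ (n - k) != 0 :> C by rewrite expf_neq0 // pnatr_eq0.
by case: (k == l); case: x; case: y; rewrite /= /torus /= ?mulr0 ?mul0r ?subr0 ?sub0r ?oppr0
  ?(mulfV t0) ?(mulVf t0).
Qed.

Definition tweight (T : tab) : C := \prod_(b : box) torus (T b).

Lemma act_torus (T : tab) : Defs.act torus_mx (tvec T) = scl (tweight T) (tvec T).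
Proof.
rewrite act_tvec (bigD1 T) //= [X in _ + X]big1 ?addr0 => [|S nS].
  by congr (scl _ _); apply: eq_bigr => b _; rewrite /torus_mx eqxx.
have [b nb] : exists b, S b != T b.
  apply/existsP; apply: contraNT nS; rewrite negb_exists => /forallP H.
  by apply/eqP/ffunP => b; apply/eqP; have := H b; rewrite negbK.
by rewrite (bigD1 b) //= /torus_mx (negPf nb) mul0r scl0.
Qed.

Lemma tweight_lt (S : tab) : symplecticT S -> S != T0 -> tweight S < tweight T0.
Proof.
move=> sS nS; have [_ _ Sge] := sympP sS.
have [b nb] : exists b, S b != T0 b.
  apply/existsP; apply: contraNT nS; rewrite negb_exists => /forallP H.
  by apply/eqP/ffunP => b; apply/eqP; have := H b; rewrite negbK.
have two : 1 < 2 :> C by rewrite ltr1n.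
have lt_or (c : box) : S c != T0 c -> torus (S c) < torus (T0 c).
  rewrite /torus ffunE /=; have := Sge c; rewrite /brow.
  case: (S c) => i [] /= le_i ne.
    apply: le_lt_trans (_ : 1 < _).
      by rewrite invf_le1 ?exprn_gt0 ?exprn_ege1 ?ltr0n // ltW.
    by rewrite exprn_egt1 // -lt0n subn_gt0.
  rewrite ltr_eXn2l // ltn_sub2l // ltn_neqAle le_i andbT.
  by apply: contraNneq ne => e; apply/eqP; congr (_, _); apply: val_inj.
have le_all (c : box) : torus (S c) <= torus (T0 c).
  by have [-> // | /lt_or /ltW] := eqVneq (S c) (T0 c).
rewrite /tweight (bigD1 b) //= [ltRHS](bigD1 b) //=.
apply: lt_le_trans (_ : torus (T0 b) * \prod_(i | i != b) torus (S i) <= _).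
  rewrite ltr_pM2r ?lt_or //; apply: prodr_gt0 => c _; exact: torus_gt0.
rewrite ler_pM2l ?torus_gt0 //; apply: ler_prod => c _.
by rewrite ltW ?torus_gt0 // le_all.
Qed.

Section Submodule.
Variable U : tens -> Prop.
Hypothesis Usub : subspaceP U.
Hypothesis UW : forall v, inW v -> U v.
Hypothesis UG : forall g, isSp g -> forall v, U v -> U (Defs.act g v).

(** Each factor comes from applying the torus element minus an eigenvalue. With the weights of all
    symplectic tableaux other than [T0] in the list, only [T0] survives. *)
Lemma torus_proj (L : seq tab) (c : tab -> C) :
  U (\sum_(S | symplecticT S) scl (c S) (tvec S)) ->
  U (\sum_(S | symplecticT S) scl (c S * \prod_(S' <- L) (tweight S - tweight S')) (tvec S)).
Proof.
elim: L c => [|S' L IHL] c Uc.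
  by under eq_bigr do rewrite big_nil mulr1.
under eq_bigr do rewrite big_cons mulrA; apply: IHL.
have := subB Usub (UG torus_Sp Uc) (subZ Usub (tweight S') Uc).
rewrite act_sum scl_sumr -sumrB; congr U; apply: eq_bigr => S _.
by rewrite actZ act_torus !sclA -sclN -sclDl mulrBr [tweight S' * _]mulrC.
Qed.

Lemma T0_in_submodule (u : tens) : U u -> ~ inW u -> U (tvec T0).
Proof.
move=> Uu nWu; have [M [M1 M2 M3]] := isotropic_frames C n #|{: box}|.
have [z z0 ez] : exists2 z, z != 0 & evl (spec M z) u != 0.
  have [c Hc] := symplectic_spanning plam u.
  pose p : {poly C} := \sum_(S | symplecticT S) c S *: EV [ffun b => \row_q M (S b) q].
  have [p0 | /poly_nonzero_at [z z0 pz]] := eqVneq p 0.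
    case: nWu; apply: (spec_kernel plam M2 (leqnn _) (M3 _ plam)) => z z0.
    have c0 := lowest_indep (M3 _ plam) _ p0.
    have := evl_inW plam (spec_isotropic M2 z) Hc; rewrite evlD evlN evl_sum big1 ?subr0 // => T sT.
    rewrite evlZ c0 ?mul0r // => S T' sS sT' ew.
    have [_ eST] := wt_inj plam plam (leqnn _) (leqnn _) sS sT' ew.
    by apply/ffunP => b; apply: eST.
  exists z => //; have := evl_inW plam (spec_isotropic M2 z) Hc; rewrite evlD evlN => /eqP.
  rewrite subr_eq0 => /eqP ->; rewrite evl_sum; apply: contraNneq pz => e.
  rewrite /p horner_sum -[X in _ == X]e; apply/eqP; apply: eq_bigr => T _.
  by rewrite evlZ evl_tvec hornerZ EV_horner.
have [g [gSp gM]] := frame_extension (spec_tri M1 z) (fun q => spec_diag M1 q z0) (spec_iso M2 z).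
(* The first columns of [g] are the chosen frame, so evaluating the translate by the transpose at
   the standard frame is evaluating [u] at that frame. *)
have Uu' := UG (isSp_tr gSp) Uu; set u' := Defs.act _ u in Uu'.
have eu' : evl idM u' = evl (spec M z) u.
  rewrite evl_act; apply: eq_bigr => T _; congr (_ * EV _); apply/ffunP => b; rewrite !ffunE.
  apply/rowP => q; rewrite !mxE (bigD1 (q, false)) //= /idM eqxx mulr1 gM big1 ?addr0 //.
  by move=> a /negPf ->; rewrite mulr0.
have [c Hc] := symplectic_spanning plam u'.
set y := \sum_(T | _) _ in Hc.
have Uy : U y by have := subB Usub Uu' (UW Hc); rewrite subKr.
have c0 : c T0 != 0.
  move: ez; rewrite -eu'; have := evl_inW plam idM_isotropic Hc.
  rewrite evlD evlN => /eqP; rewrite subr_eq0 => /eqP ->.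
  rewrite evl_sum (bigD1 T0) ?symplectic_T0 //= big1 ?addr0 => [|S /andP [sS nS]].
    by rewrite evlZ; apply: contraNneq => ->; rewrite mul0r.
  by rewrite evlZ evl_tvec evT_idM // mulr0.
have := torus_proj [seq S <- enum {: tab} | symplecticT S && (S != T0)] Uy.
rewrite (bigD1 T0) ?symplectic_T0 //= [X in _ + X]big1 ?addr0 => [|S /andP [sS nS]]; last first.
  rewrite (big_rem S) /=; first by rewrite subrr mul0r mulr0 scl0.
  by rewrite mem_filter mem_enum sS nS.
apply: (subZI Usub); rewrite mulf_neq0 // prodf_seq_neq0; apply/allP => S.
rewrite mem_filter => /andP [/andP [sS nS] _] /=.
by rewrite subr_eq0 eq_sym lt_eqF // tweight_lt.
Qed.

End Submodule.

Lemma T0_perm (s : {perm box}) : (forall b, bcol (s b) = bcol b) ->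
  exists c : C, inW (tvec (pcomp T0 s) - scl c (tvec T0)).
Proof.
have Wsub := inW_sub C lam.
pose Q (s : {perm box}) := exists c : C, inW (tvec (pcomp T0 s) - scl c (tvec T0)).
apply: (@colperm_ind _ _ (@bcol n lam) Q) => [|x y {}s nxy cxy _ [c Wc]].
  exists 1; rewrite scl1.
  have -> : pcomp T0 (1%g : {perm box}) = T0 by apply/ffunP => b; rewrite !ffunE perm1.
  by rewrite subrr; apply: sub0.
exists (- c).
have -> : pcomp T0 ((tperm x y * s)%g : {perm box}) = swapT (pcomp T0 s) x y.
  by rewrite swapT_comp; apply/ffunP => b; rewrite !ffunE permM.
have := subB Wsub (W_alt C (pcomp T0 s) nxy cxy) Wc.
rewrite opprB [X in inW X -> _]addrC subrKA [X in inW X -> _]addrC sclN opprK; exact.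
Qed.

(** A nonzero value forces [rho] to permute the row indices within each column, so the tableau is
    [T0] with its columns permuted. *)
Lemma row_tableau (rho : {ffun box -> 'I_n}) : EV (ebas C rho) != 0 ->
  exists c : C, inW (tvec [ffun b => (rho b, false)] - scl c (tvec T0)).
Proof.
move=> e0.
have lt_rho (b : box) : (rho b < col_len lam (bcol b))%N.
  rewrite ltnNge; apply: contraNN e0 => le_b; apply/eqP; apply: (EV_zero plam (b := b)) => q lt_q.
  by rewrite !ffunE mxE eqxx /=; case: eqP => // e; move: lt_q; rewrite e ltnNge le_b.
have [f Hf] := fin_all_exists (fun b => box_exists plam (lt_rho b)).
have f_inj : injective f.
  move=> b b' e; have [r1 k1] := Hf b; have [r2 k2] := Hf b'.
  have ecol : bcol b = bcol b' by rewrite -k1 -k2 e.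
  apply/eqP; apply: contraNT e0 => nb; apply/eqP; apply: (EV_rep plam nb ecol) => q _.
  by rewrite !ffunE; congr (delta_mx _ _ _ _); apply: val_inj; rewrite /= -r1 -r2 e.
have [c Hc] : exists c : C, inW (tvec (pcomp T0 (perm f_inj)) - scl c (tvec T0)).
  by apply: T0_perm => b; rewrite permE; have [] := Hf b.
exists c; suff -> : [ffun b => (rho b, false)] = pcomp T0 (perm f_inj) by [].
apply/ffunP => b; rewrite !ffunE permE; congr (_, _); apply: val_inj => /=.
by have [] := Hf b.
Qed.

(* Up to alternation, pairing [psi] with [g T0] is evaluating [psi] at the frame
   formed by the first columns of [g]. *)
Lemma orbit_functional (psi : tens) :
  (forall v : tens, inW v -> \sum_T psi T * v T = 0) ->
  (forall g, isSp g -> \sum_T psi T * Defs.act g (tvec T0) T = 0) -> inW psi.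
Proof.
move=> psiW psiG; have [M [M1 M2 M3]] := isotropic_frames C n #|{: box}|.
apply: (spec_kernel plam M2 (leqnn _) (M3 _ plam)) => z z0.
have [g [gSp gM]] := frame_extension (spec_tri M1 z) (fun q => spec_diag M1 q z0) (spec_iso M2 z).
have e (T : tab) : evT (spec M z) T = \sum_(rho : {ffun box -> 'I_n})
    Defs.act g (tvec [ffun b => (rho b, false)]) T * EV (ebas C rho).
  rewrite /evT (_ : [ffun b => rowM _ _] = [ffun b => \sum_(q < n) spec M z (T b) q *: delta_mx 0 q]); last first.
    apply/ffunP => b; rewrite !ffunE {1}[rowM _ _]row_sum_delta; apply: eq_bigr => q _; by rewrite mxE.
  rewrite (multilin_expand (EV_multilin plam) (fun b q => spec M z (T b) q) (fun b q => delta_mx 0 q)).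
  apply: eq_bigr => rho _; congr (_ * _); rewrite act_tvec sum_ffunE (bigD1 T) //= [X in _ + X]big1 ?addr0.
    rewrite !ffunE eqxx mulr1; apply: eq_bigr => b _; by rewrite ffunE gM.
  by move=> S nS; rewrite !ffunE eq_sym (negPf nS) mulr0.
rewrite /evl (eq_bigr (fun T => \sum_(rho : {ffun box -> 'I_n})
    psi T * Defs.act g (tvec [ffun b => (rho b, false)]) T * EV (ebas C rho))); last first.
  by move=> T _; rewrite e big_distrr; apply: eq_bigr => rho _; rewrite /= mulrA.
rewrite exchange_big big1 // => rho _; rewrite -big_distrl /=.
have [-> | /row_tableau [c Hc]] := eqVneq (EV (ebas C rho)) 0; first by rewrite mulr0.
have := psiW _ (act_inW plam gSp Hc); rewrite actD actN actZ => H.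
rewrite (eq_bigr (fun T => psi T * (Defs.act g (tvec [ffun b => (rho b, false)]) -
    scl c (Defs.act g (tvec T0))) T + c * (psi T * Defs.act g (tvec T0) T))).
  by rewrite big_split /= H -big_distrr /= psiG // mulr0 addr0 mul0r.
have subE (u v : tens) T : (u - v) T = u T - v T by rewrite !ffunE.
have sclE a (v : tens) T : scl a v T = a * v T by rewrite ffunE.
by move=> T _; rewrite subE sclE; ring.
Qed.

End HighestWeight.

(** * Separation of subspaces by functionals *)

Section Functionals.
Variables (C : fieldType) (n : nat) (lam : 'I_n -> nat).
Local Notation tab := (tab lam).
Local Notation tens := (tens C lam).

(** The subspace is only a predicate. Vectors are added to a matrix until its rank can grow no
    further, which realises [U] as a row space; the columns of its cokernel are functionals
    vanishing on [U]. *)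
Lemma subspace_full (U : tens -> Prop) : subspaceP U ->
  (forall psi : tens, (forall u, U u -> \sum_T psi T * u T = 0) -> psi = 0) -> forall v, U v.
Proof.
move=> Usub Hpsi; pose N := #|{: tab}|.
pose rv (v : tens) : 'rV[C]_N := \row_i v (enum_val i).
pose vr (x : 'rV[C]_N) : tens := [ffun T => x 0 (enum_rank T)].
have vrK v : vr (rv v) = v by apply/ffunP => T; rewrite !ffunE mxE enum_rankK.
have vrD x y : vr (x + y) = vr x + vr y by apply/ffunP => T; rewrite !ffunE mxE.
have vrZ c x : vr (c *: x) = scl c (vr x) by apply/ffunP => T; rewrite !ffunE mxE.
have [A [AU UA]] : exists A : 'M[C]_N, (forall x, (x <= A)%MS -> U (vr x)) /\
    (forall u, U u -> (rv u <= A)%MS).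
  suff H m (A : 'M[C]_N) : (N - \rank A < m)%N -> (forall x, (x <= A)%MS -> U (vr x)) ->
      exists A : 'M[C]_N, (forall x, (x <= A)%MS -> U (vr x)) /\ (forall u, U u -> (rv u <= A)%MS).
    apply: (H N.+1 0); first by rewrite ltnS leq_subr.
    move=> x; rewrite submx0 => /eqP ->.
    have -> : vr 0 = 0 by apply/ffunP => T; rewrite !ffunE mxE.
    exact: sub0.
  elim: m A => // m IHm A lt_m AU.
  have [[u [Uu nuA]] | no] := classic (exists u, U u /\ ~~ (rv u <= A)%MS); last first.
    by exists A; split=> // u Uu; apply: contraT => nuA; case: no; exists u.
  have lt_rk : (\rank A < \rank (A + rv u)%MS)%N.
    rewrite ltn_neqAle mxrankS ?addsmxSl // andbT; apply: contra nuA => e.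
    have : (A + rv u <= A)%MS by have := mxrank_leqif_sup (addsmxSl A (rv u)) => -[_ <-].
    by apply: submx_trans; apply: addsmxSr.
  apply: (IHm (A + rv u)%MS); first by have := rank_leq_row (A + rv u)%MS; lia.
  move=> x /sub_addsmxP [[y w] /= ->]; rewrite vrD; apply: (subD Usub); first exact/AU/submxMl.
  by rewrite (mx11_scalar w) mul_scalar_mx vrZ vrK; apply: subZ.
suff A1 : cokermx A = 0 by move=> v; rewrite -(vrK v); apply: AU; rewrite submxE A1 mulmx0.
apply/matrixP => i k; rewrite [RHS]mxE.
have := Hpsi [ffun T => cokermx A (enum_rank T) k].
move=> H; have /ffunP /(_ (enum_val i)) : [ffun T => cokermx A (enum_rank T) k] = 0 :> tens.
  apply: H => u Uu; have := UA _ Uu; rewrite submxE => /eqP /matrixP /(_ 0 k).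
  rewrite !mxE => e; rewrite -[RHS]e (reindex (fun j : 'I_N => enum_val j)) /=; last first.
    exact: onW_bij (enum_val_bij _).
  by apply: eq_bigr => j _; rewrite ffunE [rv u 0 j]mxE enum_valK mulrC.
by rewrite !ffunE enum_valK.
Qed.

End Functionals.

Section Irreducibility.
Variables (C : numClosedFieldType) (n : nat) (lam : 'I_n -> nat).
Hypothesis plam : is_partition lam.
Local Notation tab := (tab lam).
Local Notation tens := (tens C lam).
Local Notation tvec := (@tvec C n lam).

Definition conjv (v : tens) : tens := [ffun T => (v T)^*].

Lemma conjvD (u v : tens) : conjv (u + v) = conjv u + conjv v.
Proof. by apply/ffunP => T; rewrite !ffunE rmorphD. Qed.

Lemma conjvN (u : tens) : conjv (- u) = - conjv u.
Proof. by apply/ffunP => T; rewrite !ffunE rmorphN. Qed.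

Lemma conjv_tvec (T : tab) : conjv (tvec T) = tvec T.
Proof. by apply/ffunP => S; rewrite !ffunE conjC_nat. Qed.

Lemma conjv_sum (I : Type) (r : seq I) (Q : pred I) (F : I -> tens) :
  conjv (\sum_(i <- r | Q i) F i) = \sum_(i <- r | Q i) conjv (F i).
Proof.
elim/big_rec2: _ => [|i y1 y2 _ <-]; last by rewrite conjvD.
by apply/ffunP => T; rewrite !ffunE rmorph0.
Qed.

Lemma conjv_inW (v : tens) : inW v -> inW (conjv v).
Proof.
have Wsub := inW_sub C lam.
move: v; apply: inW_min => [|v rv].
  split; first by have -> : conjv 0 = 0 by [apply/ffunP => T; rewrite !ffunE rmorph0]; apply: sub0.
  split=> [u v Wu Wv | c u Wu]; first by rewrite conjvD; apply: subD.
  have -> : conjv (scl c u) = scl c^* (conjv u) by apply/ffunP => T; rewrite !ffunE rmorphM.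
  exact: subZ.
suff -> : conjv v = v by apply: inW_rel.
case: rv => [[T [b1 [b2 [_ [_ ->]]]]] | [[T [c1 [c2 [k [_ [_ ->]]]]]] | [T [B [B' [_ ->]]]]]].
- by rewrite conjvD !conjv_tvec.
- rewrite conjvD conjvN conjv_sum conjv_tvec; congr (_ - _).
  by apply: eq_bigr => S _; rewrite conjv_tvec.
by rewrite conjv_sum; apply: eq_bigr => i _; rewrite conjvD conjvN !conjv_tvec.
Qed.

Lemma irreducible (U : tens -> Prop) : subspaceP U ->
  (forall v, inW v -> U v) ->
  (forall g, isSp g -> forall v, U v -> U (Defs.act g v)) ->
  (forall v, U v -> inW v) \/ (forall v, U v).
Proof.
move=> Usub UW UG.
have [[u [Uu nWu]] | no] := classic (exists u, U u /\ ~ inW u); last first.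
  by left=> v Uv; apply: NNPP => nWv; apply: no; exists v.
right; have UT0 := T0_in_submodule plam Usub UW UG Uu nWu.
apply: subspace_full => // psi Hpsi.
have Wpsi : inW psi.
  apply: orbit_functional => // [v Wv|g gSp]; apply: Hpsi; first exact: UW.
  exact: UG.
(* Relations have integer coefficients, so the conjugate of [psi] also lies in their span, hence in
   [U], where [psi] vanishes. *)
have /psumr_eq0P e : \sum_T psi T * (psi T)^* = 0.
  rewrite -[RHS](Hpsi _ (UW _ (conjv_inW Wpsi))); apply: eq_bigr => T _; by rewrite ffunE.
apply/ffunP => T; rewrite ffunE; apply/eqP; rewrite -mul_conjC_eq0 e //.
by move=> S _; apply: mul_conjC_ge0.
Qed.

End Irreducibility.

(** * The ideal of the flag variety *)

Lemma det_cast (K : comNzRingType) m m' (A : 'M[K]_m) (B : 'M[K]_m') : m = m' ->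
  (forall (p q : 'I_m) (p' q' : 'I_m'), val p = val p' -> val q = val q' -> A p q = B p' q') ->
  \det A = \det B.
Proof. by move=> e; subst m'; move=> H; congr (\det _); apply/matrixP => p q; apply: H. Qed.

Section Monomials.
Variables (C : numFieldType) (n : nat).
Local Notation polR := (polR C n).

Lemma Xs_tuple (k : 'I_n) (t : (k.+1).-tuple (lab n)) :
  Xs C t = 'X_(enum_rank (Tagged (fun k : 'I_n => (k.+1).-tuple (lab n)) t)).
Proof. by rewrite /Xs /mkvar size_tuple /= valK valK. Qed.

Section Shape.
Variable lam : 'I_n -> nat.
Hypothesis plam : is_partition lam.

Lemma pmap_someE (A B : eqType) (f : A -> option B) (g : A -> B) s :
  (forall x, x \in s -> f x = Some (g x)) -> pmap f s = map g s.
Proof.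
elim: s => //= x s IHs H; rewrite (H x) ?mem_head //= IHs // => y ys.
by apply: H; rewrite inE ys orbT.
Qed.

Lemma colseqE (d : lab n) (T : tab lam) j :
  colseq T j = [seq tget T d i j | i <- iota 0 (col_len lam j)].
Proof.
apply: pmap_someE => i; rewrite mem_iota add0n => /andP [_ lt_i].
by have [b eb _] := oboxE plam lt_i; rewrite /tget eb.
Qed.

Lemma size_colseq (d : lab n) (T : tab lam) j : size (colseq T j) = col_len lam j.
Proof. by rewrite (colseqE d) size_map size_iota. Qed.

Lemma nth_colseq (d : lab n) (T : tab lam) (b : box lam) :
  nth d (colseq T (bcol b)) (brow b) = T b.
Proof.
have lt_b := brow_col plam b.
by rewrite (colseqE d) (nth_map 0%N) ?size_iota // nth_iota // add0n /tget obox_brow_bcol.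
Qed.

Definition Xcol (T : tab lam) (j : nat) : polR :=
  if (0 < col_len lam j)%N then Xs C (colseq T j) else 1.

Lemma col_len_bnd j : (bnd lam <= j)%N -> col_len lam j = 0%N.
Proof.
move=> le_j; apply/eqP; rewrite cards_eq0; apply/eqP/setP => i; rewrite !inE.
by rewrite ltnNge (leq_trans (ltnW (lam_bnd lam i)) le_j).
Qed.

(** Empty columns count as 1, so shapes with different values of [bnd] can be compared over a common
    range. *)
Lemma xT_wide (T : tab lam) B : (forall j, (B <= j)%N -> col_len lam j = 0%N) ->
  xT C T = \prod_(0 <= j < B) Xcol T j.
Proof.
have H B1 B2 : (B1 <= B2)%N -> (forall j, (B1 <= j)%N -> col_len lam j = 0%N) ->
    \prod_(0 <= j < B2) Xcol T j = \prod_(0 <= j < B1) Xcol T j.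
  move=> le_B B0; rewrite (@big_cat_nat _ _ _ B1) //= [X in _ * X]big_nat_cond.
  rewrite [X in _ * X]big1 ?mulr1 // => j /andP [/andP [le_j _] _].
  by rewrite /Xcol B0.
move=> HB; have -> : xT C T = \prod_(0 <= j < bnd lam) Xcol T j.
  by rewrite /xT big_mkcond big_mkord.
have [le_B | /ltnW le_B] := leqP (bnd lam) B.
  by rewrite (H _ _ le_B) // => j; apply: col_len_bnd.
by rewrite -(H _ _ le_B HB).
Qed.

Lemma xT_eval (M : lab n -> 'I_n -> C) (T : tab lam) : (xT C T).@[evalM M] = evT M T.
Proof.
rewrite /xT /evT /EV (big_morph _ (mevalM (evalM M)) (meval1 (evalM M))) big_mkcond.
apply: eq_bigr => j _; case: ifP => [lt0 | /negbT]; last first.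
  rewrite -leqNgt leqn0 => /eqP e0; symmetry.
  by rewrite -[RHS](det1 C 0); apply: det_cast => [//|p]; have := ltn_ord p; rewrite [X in (_ < X)%N]e0.
have lt_n : ((col_len lam j).-1 < n)%N.
  by rewrite prednK //; apply: col_len_le.
have [b0 _] := box_exists plam lt0; pose d := T b0.
pose k := Ordinal lt_n.
have sz : size (colseq T j) == k.+1 by rewrite (size_colseq d) /= prednK.
rewrite -[colseq T j]/(val (Tuple sz)) (@Xs_tuple k) mevalXU /evalM enum_rankK /detv.
apply: det_cast => [|p q p' q' ep eq]; first by rewrite /= prednK.
rewrite !mxE (tnth_nth d) /= ep (colseqE d).
have lt_p := ltn_ord p'.
rewrite (nth_map 0%N) ?size_iota // nth_iota // add0n /vget /tget.
have [b -> _] := oboxE plam lt_p; rewrite ffunE mxE; congr M; exact: val_inj.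
Qed.

Lemma xlin_eval (M : lab n -> 'I_n -> C) (v : tens C lam) : (xlin v).@[evalM M] = evl M v.
Proof.
rewrite /xlin (big_morph _ (mevalD (evalM M)) (meval0 (evalM M))); apply: eq_bigr => T _.
by rewrite mevalZ xT_eval.
Qed.

Lemma xlinD (u v : tens C lam) : xlin (u + v) = xlin u + xlin v.
Proof. by rewrite /xlin -big_split; apply: eq_bigr => T _; rewrite ffunE scalerDl. Qed.

Lemma xlinZ c (v : tens C lam) : xlin (scl c v) = c *: xlin v.
Proof. by rewrite /xlin scaler_sumr; apply: eq_bigr => T _; rewrite ffunE scalerA. Qed.

Lemma xlin0 : xlin (0 : tens C lam) = 0.
Proof. by rewrite /xlin big1 // => T _; rewrite ffunE scale0r. Qed.

Lemma xlinN (v : tens C lam) : xlin (- v) = - xlin v.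
Proof. by rewrite -[v]scl1 -sclN !xlinZ scaleN1r scale1r. Qed.

Lemma xlin_sum (I : Type) (r : seq I) (Q : pred I) (F : I -> tens C lam) :
  xlin (\sum_(i <- r | Q i) F i) = \sum_(i <- r | Q i) xlin (F i).
Proof. by elim/big_rec2: _ => [|i y1 y2 _ <-]; rewrite ?xlin0 ?xlinD. Qed.

Lemma xlin_tvec (T : tab lam) : xlin (tvec C T) = xT C T.
Proof.
rewrite /xlin (bigD1 T) //= ffunE eqxx scale1r big1 ?addr0 // => S nS.
by rewrite ffunE (negPf nS) scale0r.
Qed.

End Shape.

Section Ideal.
Variable G : polR -> Prop.

Lemma ideal0 : in_ideal G 0. Proof. by exists [::]; rewrite big_nil. Qed.

Lemma idealD p q : in_ideal G p -> in_ideal G q -> in_ideal G (p + q).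
Proof.
move=> [s [Hs ->]] [t [Ht ->]]; exists (s ++ t); split; last by rewrite big_cat.
by move=> x; rewrite mem_cat => /orP [/Hs | /Ht].
Qed.

Lemma idealM r p : in_ideal G p -> in_ideal G (r * p).
Proof.
move=> [s [Hs ->]]; exists [seq (r * x.1, x.2) | x <- s]; split.
  by move=> x /mapP [y ys ->]; apply: (Hs y).
by rewrite big_map big_distrr; apply: eq_bigr => x _; rewrite /= mulrA.
Qed.

Lemma ideal_gen p : G p -> in_ideal G p.
Proof.
move=> Gp; exists [:: (1, p)]; split; last by rewrite big_seq1 mul1r.
by move=> x; rewrite inE => /eqP ->.
Qed.

Lemma idealZ c p : in_ideal G p -> in_ideal G (c *: p).
Proof. by rewrite -mul_mpolyC; apply: idealM. Qed.

End Ideal.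

Lemma gen_inI (g : polR) : gen g -> inI g.
Proof.
move=> [lam [plam [_ [v [rv ->]]]]] M [_ iso].
by rewrite xlin_eval //; apply: evl_rel.
Qed.

Lemma ideal_inI (p : polR) : in_ideal (@gen C n) p -> inI p.
Proof.
move=> [s [Hs ->]] M adm; rewrite (big_morph _ (mevalD (evalM M)) (meval0 (evalM M))).
by rewrite big_seq big1 // => x xs; rewrite mevalM (gen_inI (Hs _ xs) adm) mulr0.
Qed.

(** * Reduction of relations to two columns *)

Section TwoColumns.
Variable lam : 'I_n -> nat.
Hypothesis plam : is_partition lam.
Variables c1 c2 : nat.
Hypothesis lt_c : (c1 < c2)%N.

Definition lam2 (i : 'I_n) : nat := (c1 < lam i)%N + (c2 < lam i)%N.

Lemma lam2_part : is_partition lam2.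
Proof.
move=> i j le_ij; have le_lam := plam le_ij; rewrite /lam2.
have H c : ((c < lam j)%N <= (c < lam i)%N)%N.
  by case: (boolP (c < lam j)%N) => // lt; rewrite (leq_trans lt le_lam).
by apply: leq_add.
Qed.

Lemma lam2_le i : (lam2 i <= 2)%N. Proof. by rewrite /lam2; case: (c1 < lam i)%N; case: (c2 < lam i)%N. Qed.

Lemma lam2_0 i : (0 < lam2 i)%N = (c1 < lam i)%N.
Proof.
rewrite /lam2; case: (ltnP c1 (lam i)) => h1; case: (ltnP c2 (lam i)) => h2 //=.
by have := leq_trans h2 (leq_trans h1 (ltnW lt_c)); rewrite ltnn.
Qed.

Lemma lam2_1 i : (1 < lam2 i)%N = (c2 < lam i)%N.
Proof.
rewrite /lam2; case: (ltnP c1 (lam i)) => h1; case: (ltnP c2 (lam i)) => h2 //=.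
by have := leq_trans h2 (leq_trans h1 (ltnW lt_c)); rewrite ltnn.
Qed.

Lemma col_len2_0 : col_len lam2 0 = col_len lam c1.
Proof. by rewrite /col_len; apply: eq_card => i; rewrite !inE lam2_0. Qed.

Lemma col_len2_1 : col_len lam2 1 = col_len lam c2.
Proof. by rewrite /col_len; apply: eq_card => i; rewrite !inE lam2_1. Qed.

Definition sel (j : nat) : nat := if j == 0%N then c1 else c2.

Lemma bcol2 (b : box lam2) : bcol b = 0%N \/ bcol b = 1%N.
Proof. by have := leq_trans (bcol_lam b) (lam2_le _); case: (bcol b) => [|[|]]; auto. Qed.

Lemma embed_exists (b : box lam2) : exists b' : box lam, brow b' = brow b /\ bcol b' = sel (bcol b).
Proof.
apply: (box_exists plam); have := brow_col lam2_part b.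
by case: (bcol2 b) => ->; rewrite /sel /= ?col_len2_0 ?col_len2_1.
Qed.

Variable iota2 : box lam2 -> box lam.
Hypothesis row2 : forall b, brow (iota2 b) = brow b.
Hypothesis col2 : forall b, bcol (iota2 b) = sel (bcol b).

Lemma sel_inj (b b' : box lam2) : sel (bcol b) = sel (bcol b') -> bcol b = bcol b'.
Proof.
rewrite /sel; case: (bcol2 b) => ->; case: (bcol2 b') => -> //= e.
  by move: lt_c; rewrite e ltnn.
by move: lt_c; rewrite e ltnn.
Qed.

Lemma iota2_inj : injective iota2.
Proof.
move=> b b' e; apply: box_eq; first by rewrite -!row2 e.
by apply: sel_inj; rewrite -!col2 e.
Qed.

Lemma iota2_onto (b : box lam) : bcol b = c1 \/ bcol b = c2 -> exists b', iota2 b' = b.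
Proof.
move=> cb; pose j := if bcol b == c1 then 0%N else 1%N.
have sj : sel j = bcol b.
  by rewrite /sel /j; case: cb => ->; rewrite ?eqxx ?(gtn_eqF lt_c).
have lt_b : (brow b < col_len lam2 j)%N.
  have := brow_col plam b; rewrite /j; case: eqP => [-> | ne]; first by rewrite col_len2_0.
  by case: cb => // ->; rewrite col_len2_1.
have [b' [rb cb']] := box_exists lam2_part lt_b.
by exists b'; apply: box_eq; rewrite ?row2 ?col2 ?rb ?cb'.
Qed.

Definition restr (T : tab lam) : tab lam2 := [ffun b => T (iota2 b)].

Lemma obox2 i j : (j < 2)%N -> (i < col_len lam2 j)%N ->
  exists2 b, obox lam2 i j = Some b & obox lam i (sel j) = Some (iota2 b).
Proof.
move=> lt_j lt_i; have [b eb [rb cb]] := oboxE lam2_part lt_i.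
by exists b => //; rewrite -(obox_brow_bcol (iota2 b)) row2 col2 rb cb.
Qed.

Lemma Xcol_restr (T : tab lam) j : (j < 2)%N -> Xcol (restr T) j = Xcol T (sel j).
Proof.
move=> lt_j; have ecl : col_len lam2 j = col_len lam (sel j).
  by case: j lt_j => [|[|]] // _; rewrite ?col_len2_0 ?col_len2_1.
rewrite /Xcol -ecl; case: ifP => // lt0; congr (Xs C _).
have [b0 _] := box_exists lam2_part lt0; pose d := restr T b0.
rewrite (colseqE lam2_part d) (colseqE plam d) -ecl; apply/eq_in_map => i.
rewrite mem_iota add0n => /andP [_ lt_i]; rewrite /tget.
by have [b -> ->] := obox2 lt_j lt_i; rewrite ffunE.
Qed.

(** The cofactor [r] depends on [T] alone and is common to all the tableaux of a relation, so the
    polynomial of the relation is [r] times that of a two-column relation. *)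
Lemma restr_factor (T : tab lam) : exists r, forall T' : tab lam,
  (forall b, bcol b != c1 -> bcol b != c2 -> T' b = T b) -> xT C T' = r * xT C (restr T').
Proof.
(* [c2] may lie beyond the diagram, for instance in an exchange of 0 entries, so the range is
   extended to contain it. *)
pose B := maxn (bnd lam) c2.+1.
have lt_1 : (c1 < B)%N by rewrite leq_max ltnS (ltnW lt_c) orbT.
have lt_2 : (c2 < B)%N by rewrite leq_max leqnn orbT.
exists (\prod_(j < B | (j != Ordinal lt_1) && (j != Ordinal lt_2)) Xcol T j) => T' eT.
rewrite (@xT_wide _ T' B) => [|j le_j]; last first.
  by apply: col_len_bnd; apply: leq_trans le_j; rewrite leq_maxl.
rewrite big_mkord (bigD1 (Ordinal lt_1)) //= (bigD1 (Ordinal lt_2)) /=; last first.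
  by rewrite -val_eqE /= gtn_eqF.
rewrite (@xT_wide _ (restr T') 2) => [|j le_j]; last first.
  apply/eqP; rewrite cards_eq0; apply/eqP/setP => i; rewrite !inE ltnNge.
  by rewrite (leq_trans (lam2_le i) le_j).
rewrite !big_nat_recr //= big_nil mul1r !Xcol_restr // /sel /= mulrA mulrC; congr (_ * _).
apply: eq_bigr => j /andP [n1 n2]; rewrite /Xcol; case: ifP => // lt0; congr (Xs C _).
have [b0 _] := box_exists plam lt0; rewrite !(colseqE plam (T b0)); apply/eq_in_map => i.
rewrite mem_iota add0n => /andP [_ lt_i]; rewrite /tget.
have [b -> [_ cb]] := oboxE plam lt_i; apply: eT; rewrite cb.
  by move: n1; rewrite -val_eqE.
by move: n2; rewrite -val_eqE.
Qed.

Lemma restr_swapT (T : tab lam) b1 b2 :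
  restr (swapT T (iota2 b1) (iota2 b2)) = swapT (restr T) b1 b2.
Proof. by apply/ffunP => b; rewrite !ffunE !(inj_eq iota2_inj). Qed.

Lemma restr_upd2 (T : tab lam) B x B' y :
  restr (upd2 T (iota2 B) x (iota2 B') y) = upd2 (restr T) B x B' y.
Proof. by apply/ffunP => b; rewrite !ffunE !(inj_eq iota2_inj). Qed.

Lemma restr_comp (T : tab lam) hs : xmap_ok lam c1 c2 hs -> xmap_ok lam2 0 1 hs ->
  restr (pcomp T (xmap c1 c2 hs)) = pcomp (restr T) (xmap 0 1 hs).
Proof.
move=> ok ok2; apply/ffunP => b; rewrite !ffunE; congr (T _).
have [/andP [/eqP cb hb]|nl] := boolP ((bcol b == 0%N) && (brow b \in hs)).
  have [e1 e2] := xmap_l lam2_part ok2 cb hb.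
  have c3 : bcol (iota2 b) = c1 by rewrite col2 cb.
  have [e3 e4] := xmap_l plam ok c3 (eq_ind_r (fun r => r \in hs) hb (row2 b)).
  by apply: box_eq; rewrite ?e4 ?e3 ?row2 ?row2 ?col2 ?e2 ?e1.
have [/andP [/eqP cb hb]|nr] := boolP ((bcol b == 1%N) && (brow b < size hs)%N).
  have [e1 e2] := xmap_r lam2_part ok2 cb hb.
  have c3 : bcol (iota2 b) = c2 by rewrite col2 cb.
  have [e3 e4] := xmap_r plam ok c3 (eq_ind_r (fun r => r < size hs)%N hb (row2 b)).
  by apply: box_eq; rewrite ?e4 ?e3 ?row2 ?row2 ?col2 ?e2 ?e1.
rewrite [xmap 0 1 hs b]xmap_id // xmap_id //.
  apply: contra nl => /andP [/eqP cb]; rewrite row2 => ->; rewrite andbT.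
  by move: cb; rewrite col2 /sel; case: eqP => // _ e; move: lt_c; rewrite e ltnn.
apply: contra nr => /andP [/eqP cb]; rewrite row2 => ->; rewrite andbT.
move: cb; rewrite col2 /sel; case: (bcol2 b) => -> //= e; by move: lt_c; rewrite e ltnn.
Qed.

End TwoColumns.

Lemma embed2 (lam : 'I_n -> nat) c1 c2 : is_partition lam -> (c1 < c2)%N ->
  exists f : box (lam2 lam c1 c2) -> box lam,
    (forall b, brow (f b) = brow b) /\ (forall b, bcol (f b) = sel c1 c2 (bcol b)).
Proof.
move=> plam lt_c; have [f Hf] := fin_all_exists (embed_exists plam lt_c).
by exists f; split=> b; have [] := Hf b.
Qed.

Lemma gen_xlin (lam : 'I_n -> nat) c1 c2 : is_partition lam -> (c1 < c2)%N ->
  forall v : tens C (lam2 lam c1 c2), Defs.rel v -> gen (xlin v).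
Proof.
move=> plam lt_c v rv; exists (lam2 lam c1 c2); split; first exact: lam2_part.
by split; [apply: lam2_le | exists v].
Qed.

Lemma rel_ideal (lam : 'I_n -> nat) (v : tens C lam) : is_partition lam ->
  Defs.rel v -> in_ideal (@gen C n) (xlin v).
Proof.
move=> plam.
case=> [[T [b1 [b2 [nb [cb ->]]]]] | [[T [c1 [c2 [k [lt_c [le_k ->]]]]]] | [T [B [B' [nb ->]]]]]].
(* An alternating relation concerns one column; the next one, possibly empty, only completes the
   pair. *)
- have lt_c : (bcol b1 < (bcol b1).+1)%N by [].
  have [f [fr fc]] := embed2 plam lt_c.
  have [d1 e1] := iota2_onto plam lt_c fr fc (or_introl (erefl (bcol b1))).
  have [d2 e2] := iota2_onto plam lt_c fr fc (or_introl (esym cb)).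
  have [r Hr] := restr_factor plam lt_c fr fc T.
  rewrite xlinD !xlin_tvec Hr // Hr => [|b n1 n2]; last first.
    rewrite ffunE; case: eqP => [e|_]; first by rewrite e eqxx in n1.
    by case: eqP => [e|//]; rewrite e cb eqxx in n1.
  rewrite -mulrDr; apply: idealM; apply: ideal_gen.
  have -> : swapT T b1 b2 = swapT T (f d1) (f d2) by rewrite e1 e2.
  rewrite restr_swapT // -!xlin_tvec -xlinD; apply: gen_xlin => //.
  left; exists (restr f T), d1, d2; split; last split=> //.
    by apply: contraNneq nb => e; rewrite -e1 -e2 e.
  by apply: (sel_inj lt_c); rewrite -!fc e1 e2.
- have [f [fr fc]] := embed2 plam lt_c.
  have [r Hr] := restr_factor plam lt_c fr fc T.
  pose R2 := [set i : 'I_n | (0 < lam2 lam c1 c2 i)%N].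
  have eR : [set i : 'I_n | (c1 < lam i)%N] = R2.
    by apply/setP => i; rewrite !inE lam2_0.
  have le_k2 : (k <= col_len (lam2 lam c1 c2) 1)%N by rewrite col_len2_1.
  have exE (S : {set 'I_n}) : (S \subset R2) && (#|S| == k) ->
     xT C (exchT T c1 c2 k S) = r * xT C (exchT (restr f T) 0 1 k S).
    case/andP => sS /eqP cS.
    have ok : xmap_ok lam c1 c2 (seqS S) by apply: (exch_ok plam lt_c le_k _ cS); rewrite eR.
    have ok2 := exch_ok (lam2_part plam c1 c2) (ltn0Sn 0) le_k2 sS cS.
    rewrite !exchT_comp // Hr => [|b n1 n2]; first by rewrite restr_comp.
    by rewrite ffunE xmap_id // ?(negPf n1) ?(negPf n2).
  have -> : xlin (tvec C T - \sum_(S : {set 'I_n} | (S \subset [set i : 'I_n | (c1 < lam i)%N])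
        && (#|S| == k)) tvec C (exchT T c1 c2 k S)) =
     r * xlin (tvec C (restr f T) - \sum_(S : {set 'I_n} | (S \subset R2) && (#|S| == k))
        tvec C (exchT (restr f T) 0 1 k S)).
    rewrite !xlinD !xlinN !xlin_sum !xlin_tvec mulrBr -Hr //; congr (_ - _).
    by rewrite eR big_distrr; apply: eq_bigr => S HS; rewrite !xlin_tvec exE.
  apply: idealM; apply: ideal_gen; apply: gen_xlin => //.
  by right; left; exists (restr f T), 0%N, 1%N, k.
have [c1 [c2 [lt_c [cB cB']]]] : exists c1, exists c2, (c1 < c2)%N /\
    (bcol B = c1 \/ bcol B = c2) /\ (bcol B' = c1 \/ bcol B' = c2).
  have [lt | lt | e] := ltngtP (bcol B) (bcol B').
  - by exists (bcol B), (bcol B'); split=> //; split; [left | right].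
  - by exists (bcol B'), (bcol B); split=> //; split; [right | left].
  by exists (bcol B), (bcol B).+1; split=> //; split; left.
have [f [fr fc]] := embed2 plam lt_c.
have [d1 e1] := iota2_onto plam lt_c fr fc cB.
have [d2 e2] := iota2_onto plam lt_c fr fc cB'.
have [r Hr] := restr_factor plam lt_c fr fc T.
have updE x y : xT C (upd2 T B x B' y) = r * xT C (upd2 (restr f T) d1 x d2 y).
  rewrite Hr => [|b n1 n2].
    have -> : upd2 T B x B' y = upd2 T (f d1) x (f d2) y by rewrite e1 e2.
    by rewrite restr_upd2.
  rewrite ffunE; case: eqP => [e|_].
    by rewrite e in n1 n2; case: cB => e'; rewrite e' eqxx in n1 n2.
  case: eqP => [e|//].
  by rewrite e in n1 n2; case: cB' => e'; rewrite e' eqxx in n1 n2.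
have -> : xlin (\sum_(i < n) (tvec C (upd2 T B (i, false) B' (i, true)) -
      tvec C (upd2 T B (i, true) B' (i, false)))) =
   r * xlin (\sum_(i < n) (tvec C (upd2 (restr f T) d1 (i, false) d2 (i, true)) -
      tvec C (upd2 (restr f T) d1 (i, true) d2 (i, false)))).
  rewrite !xlin_sum big_distrr; apply: eq_bigr => i _.
  by rewrite !xlinD !xlinN !xlin_tvec !updE /= mulrBr.
apply: idealM; apply: ideal_gen; apply: gen_xlin => //.
right; right; exists (restr f T), d1, d2; split=> //.
by apply: contraNneq nb => e; rewrite -e1 -e2 e.
Qed.

Lemma inW_ideal (lam : 'I_n -> nat) (v : tens C lam) : is_partition lam ->
  inW v -> in_ideal (@gen C n) (xlin v).
Proof.
move=> plam; move: v; apply: inW_min => [|v rv]; last exact: rel_ideal.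
split; first by rewrite xlin0; apply: ideal0.
by split=> [u v Iu Iv | c u Iu]; rewrite ?xlinD ?xlinZ; [apply: idealD | apply: idealZ].
Qed.

End Monomials.

(** * Monomials as tableaux and generation of the ideal *)

Section Generators.
Variables (C : numFieldType) (n : nat).
Hypothesis n_gt0 : (0 < n)%N.
Local Notation polR := (polR C n).
Local Notation var := (Defs.var n).

Definition lab0 : lab n := (Ordinal n_gt0, false).
Definition var0 : var := Tagged (fun k : 'I_n => (k.+1).-tuple (lab n)) (nseq_tuple (Ordinal n_gt0).+1 lab0).

(** This is conjugation of partitions: for columns sorted by decreasing length, row [i] has one box
    for each column reaching it. The tag of a variable is its length minus 1, so [i <= tag v] says
    that the column has a row [i]. *)
Lemma count_sorted (X : eqType) (x0 : X) (f : X -> nat) (s : seq X) i j :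
  sorted (fun x y => f y <= f x)%N s ->
  (j < count (fun x => i <= f x)%N s)%N = (j < size s)%N && (i <= f (nth x0 s j))%N.
Proof.
elim: s j => [|x s IHs] j //= ps.
have ss := path_sorted ps.
have /allP xs : all (fun y => f y <= f x)%N s.
  by apply: order_path_min ps => a b c /= ba cb; apply: leq_trans cb ba.
have [le_x | lt_x] := leqP i (f x); last first.
  have -> : count (fun y => i <= f y)%N s = 0%N.
    apply/eqP; rewrite -leqn0 leqNgt -has_count; apply/hasPn => y /xs le_y.
    by rewrite -ltnNge (leq_ltn_trans le_y).
  case: j => [|j] /=; first by rewrite (leqNgt i) lt_x ?andbF.
  symmetry; apply/negbTE; rewrite negb_and -!ltnNge !ltnS orbC.
  case: (ltnP j (size s)) => [lt_j|]; last by rewrite orbT.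
  rewrite orbF.
  by apply: leq_ltn_trans lt_x; apply: xs; apply: mem_nth.
case: j => [|j] /=; first by rewrite le_x.
by rewrite add1n !ltnS -IHs.
Qed.

Section List.
Variable L : seq var.
Hypothesis sL : sorted (fun v w : var => tag w <= tag v)%N L.
Variable lam : 'I_n -> nat.
Hypothesis elam : forall i : 'I_n, lam i = count (fun v : var => i <= tag v)%N L.

Lemma list_part : is_partition lam.
Proof.
move=> i j le_ij; rewrite !elam; apply: sub_count => v; exact: leq_trans.
Qed.

Lemma list_lam (i : 'I_n) j : (j < lam i)%N = (j < size L)%N && (i <= tag (nth var0 L j))%N.
Proof. by rewrite elam (@count_sorted _ var0 (fun v : var => tag v : nat)). Qed.

Lemma list_col_len j : col_len lam j = if (j < size L)%N then (tag (nth var0 L j)).+1 else 0%N.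
Proof.
rewrite /col_len; case: ltnP => [lt_j | le_j].
  rewrite -sum1_card -[RHS](sum_ord_lt (ltn_ord (tag (nth var0 L j)))).
  by apply: eq_bigl => i; rewrite inE list_lam lt_j ltnS.
by apply/eqP; rewrite cards_eq0; apply/eqP/setP => i; rewrite !inE list_lam ltnNge le_j.
Qed.

Definition list_tab : tab lam :=
  [ffun b => nth lab0 (val (tagged (nth var0 L (bcol b)))) (brow b)].

Lemma list_xT : xT C list_tab = \prod_(v <- L) 'X_(enum_rank v).
Proof.
have plam := list_part.
rewrite (@xT_wide _ _ _ _ (size L)) => [|j le_j]; last by rewrite list_col_len ltnNge le_j.
rewrite (big_nth var0) big_nat_cond [RHS]big_nat_cond; apply: eq_bigr => j /andP [/andP [_ lt_j] _].
rewrite /Xcol list_col_len lt_j /=.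
have -> : colseq list_tab j = val (tagged (nth var0 L j)).
  apply: (@eq_from_nth _ lab0).
    by rewrite (size_colseq plam lab0) list_col_len lt_j size_tuple.
  rewrite (size_colseq plam lab0) => i lt_i; have [b [rb cb]] := box_exists plam lt_i.
  by rewrite -rb -cb (nth_colseq plam) ffunE.
by rewrite Xs_tuple; case: (nth var0 L j).
Qed.

End List.

Lemma monomial_list (m : 'X_{1..NV n}) : exists L : seq var,
  [/\ sorted (fun v w : var => tag w <= tag v)%N L, size L = mdeg m &
      'X_[m] = \prod_(v <- L) 'X_(enum_rank v) :> polR].
Proof.
pose L0 := flatten [seq nseq (m i) (enum_val i) | i <- enum 'I_(NV n)] : seq var.
exists (sort (fun v w : var => tag w <= tag v)%N L0); split.
- by apply: sort_sorted => v w; apply: leq_total.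
- rewrite size_sort size_flatten /shape -map_comp mdegE sumnE big_map big_enum /=.
  by apply: eq_bigr => i _; rewrite size_nseq.
rewrite (perm_big L0) /=; last by rewrite perm_sort.
rewrite mpolyXE_id big_flatten big_map big_enum /=; apply: eq_bigr => i _.
by rewrite big_nseq enum_valK -Monoid.iteropE; elim: (m i) => [|k IHk]; rewrite ?expr0 // exprS IHk.
Qed.

Section Degree.
Variable d : nat.

(** A row of the tableau of a monomial is at most as long as its degree. Bounding the parts by [d]
    makes the tableaux of all relevant shapes a finite type over which one can sum. *)
Definition shapes := {ffun 'I_n -> 'I_d}.
Definition shape_of (l : shapes) (i : 'I_n) : nat := l i.
Definition stab := {l : shapes & tab (shape_of l)}.

Definition good_stab (s : stab) : bool :=
  [forall i : 'I_n, forall j : 'I_n, (i <= j)%N ==> (tag s j <= tag s i)%N] && symplecticT (tagged s).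

Lemma good_part (s : stab) : good_stab s -> is_partition (shape_of (tag s)).
Proof. by case/andP => /forallP H _ i j le_ij; have /forallP /(_ j) := H i; rewrite le_ij. Qed.

Lemma monomial_straighten (m : 'X_{1..NV n}) : (mdeg m < d)%N ->
  exists c : stab -> C, in_ideal (@gen C n)
    ('X_[m] - \sum_(s | good_stab s) c s *: xT C (tagged s)).
Proof.
move=> lt_m; have [L [sL szL ->]] := monomial_list m.
have lt_d (i : 'I_n) : (count (fun v : var => i <= tag v)%N L < d)%N.
  by apply: leq_ltn_trans lt_m; rewrite -szL count_size.
pose l : shapes := [ffun i => Ordinal (lt_d i)].
have el (i : 'I_n) : shape_of l i = count (fun v : var => i <= tag v)%N L by rewrite /shape_of ffunE.
have pl := list_part el.
rewrite -(list_xT sL el); set T := list_tab _ _.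
have [c Hc] := symplectic_spanning pl (tvec C T).
(* Summing over the tableaux of shape [l] equal to [s] transports the coefficients to the dependent
   pair without a cast, giving 0 for other shapes. *)
exists (fun s => \sum_(S | symplecticT S && (Tagged (fun l => tab (shape_of l)) S == s)) c S).
have := inW_ideal pl Hc; rewrite xlinD xlinN xlin_sum xlin_tvec.
congr (in_ideal _ (_ - _)).
rewrite (eq_bigr (fun S => c S *: xT C S)); last by move=> S _; rewrite xlinZ xlin_tvec.
rewrite [RHS](eq_bigr (fun s => \sum_(S | symplecticT S && (Tagged (fun l => tab (shape_of l)) S == s))
    c S *: xT C S)); last first.
  move=> s _; rewrite scaler_suml; apply: eq_bigr => S /andP [_ /eqP <-]; by [].
rewrite (exchange_big_dep (fun S => symplecticT S)) /=; last by move=> s S _ /andP [].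
apply: eq_bigr => S sS; rewrite sS /= (bigD1 (Tagged (fun l => tab (shape_of l)) S)) /=; last first.
  rewrite eqxx andbT /good_stab sS andbT; apply/forallP => i; apply/forallP => j.
  by apply/implyP; apply: pl.
by rewrite big1 ?addr0 // => s /andP [/andP [_ /eqP ->]]; rewrite eqxx.
Qed.

End Degree.

Lemma ideal_generated (p : polR) : inI p -> in_ideal (@gen C n) p.
Proof.
move=> Ip; pose d := msize p.
have [c Hc] : exists c : stab d -> C, in_ideal (@gen C n)
    (p - \sum_(s | good_stab s) c s *: xT C (tagged s)).
  rewrite [in X in exists c, in_ideal _ (X - _)](mpolyE p).
  have : {in msupp p, forall m, (mdeg m < d)%N} by move=> m; apply: msize_mdeg_lt.
  elim: (msupp p) => [|m s IHs] H.
    exists (fun=> 0); rewrite big_nil big1 ?subr0 => [|i _]; last by rewrite scale0r.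
    exact: ideal0.
  have [|c Hc] := IHs; first by move=> m' ms; apply: H; rewrite inE ms orbT.
  have [c' Hc'] := monomial_straighten (H m (mem_head _ _)).
  exists (fun i => p@_m * c' i + c i).
  rewrite big_cons (eq_bigr (fun i => p@_m *: (c' i *: xT C (tagged i)) + c i *: xT C (tagged i))).
    rewrite big_split /= -scaler_sumr opprD addrACA -scalerBr.
    by apply: idealD => //; apply: idealZ.
  by move=> i _; rewrite scalerDl scalerA.
(* One bound on the number of boxes for all the shapes in play, so that the digits of the weights
   stay below the base simultaneously. *)
pose D := (\max_(s : stab d) #|{: box (shape_of (tag s))}|)%N.
have leD (s : stab d) : (#|{: box (shape_of (tag s))}| <= D)%N.
  exact: (leq_bigmax (F := fun s : stab d => #|{: box (shape_of (tag s))}|)).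
have [M [M1 M2 M3]] := isotropic_frames C n D.
pose f (s : stab d) : {poly C} := EV [ffun b => \row_q M (tagged s b) q].
have low (s : stab d) : good_stab s -> lowest (wt D (tagged s)) (f s).
  by move=> gs; apply: M3; [apply: good_part | case/andP: gs].
have indep := @lowest_indep C (stab d) (@good_stab d) f (fun s => wt D (tagged s)) c low.
suff c0 s : good_stab s -> c s = 0.
  by move: Hc; rewrite big1 ?subr0 // => s gs; rewrite c0 ?scale0r.
move: s; apply: indep => [s s' g1 g2 ew | ].
  have p1 := good_part g1; have p2 := good_part g2.
  have sT : symplecticT (tagged s) by case/andP: g1.
  have sT' : symplecticT (tagged s') by case/andP: g2.
  have [el eT] := wt_inj p1 p2 (leD s) (leD s') sT sT' ew.
  move: el eT; clear; case: s => l T; case: s' => l' T' /= el eT.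
  have ell : l = l' by apply/ffunP => i; apply: val_inj; apply: el.
  subst l'; congr (Tagged _ _); apply/ffunP => b; exact: eT.
apply/eqP; apply: contraT => /poly_nonzero_at [z z0 fz].
have adm : admissible (spec M z).
  apply: triangular_admissible; [exact: spec_tri M1 z | | exact: spec_iso M2 z].
  by move=> q; apply: (spec_diag M1).
have := ideal_inI Hc adm; rewrite mevalB (Ip _ adm) sub0r => /eqP; rewrite oppr_eq0 => /eqP e.
case/eqP: fz; rewrite horner_sum -[RHS]e.
rewrite (big_morph _ (mevalD (evalM (spec M z))) (meval0 (evalM (spec M z)))).
apply: eq_bigr => s gs; rewrite hornerZ mevalZ; congr (_ * _).
by rewrite (xT_eval (good_part gs)) EV_horner.
Qed.

End Generators.

Theorem theorem1 (R : realType) (n : nat) (lam : 'I_n -> nat) :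
  (0 < n)%N -> is_partition lam ->
  let C := R[i] in
  (* (i) the symplectic tableaux give a basis of E^{lam,f} = tens / W *)
  ((forall v : tens C lam, exists c : tab lam -> C,
       inW (v - \sum_(T : tab lam | symplecticT T) scl (c T) (tvec C T)))
   /\ (forall c : tab lam -> C,
       inW (\sum_(T : tab lam | symplecticT T) scl (c T) (tvec C T)) ->
       forall T : tab lam, symplecticT T -> c T = 0))
  /\
  (* (ii) E^{lam,f} is a G_n-module, irreducible, with highest weight lam *)
  ((forall g : lab n -> lab n -> C, isSp g ->
       forall v : tens C lam, inW v -> inW (act g v))
   /\ ~ (forall v : tens C lam, inW v)
   /\ (forall U : tens C lam -> Prop, subspaceP U ->
         (forall v, inW v -> U v) ->
         (forall g : lab n -> lab n -> C, isSp g -> forall v, U v -> U (act g v)) ->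
         (forall v, U v -> inW v) \/ (forall v, U v))
   /\ (exists v : tens C lam, ~ inW v /\
         forall g : lab n -> lab n -> C, inBorel g ->
           inW (act g v - scl (chi lam g) v)))
  /\
  (* (iii) I is generated by the x_rho, rho a relation with at most two columns *)
  (forall p : polR C n, inI p <-> in_ideal (@gen C n) p).
Proof.
move=> n_gt0 plam C; split; last split.
- split; first exact: (@symplectic_spanning C n lam plam).
  exact: (@symplectic_free C n lam plam).
- split; first by move=> g gSp v; apply: (@act_inW C n lam plam g gSp v).
  split; first by move=> /(_ (tvec C (T0 lam))); apply: (@T0_notW C n lam plam).
  split; first by move=> U Usub UW UG; apply: (@irreducible C n lam plam U Usub UW UG).
  exists (tvec C (T0 lam)); split; first exact: (@T0_notW C n lam plam).
  by move=> g gB; apply: (@T0_highest C n lam plam g gB).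
move=> p; split; first exact: (@ideal_generated C n n_gt0).
exact: (@ideal_inI C n).
Qed.
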